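(* Let $p\ge 1$ be an integer and let $f$ be a univalent $p$-harmonic mapping of $\mathbb{D}$ of the form $$f(z)=G(z)\sum_{k=1}^{p}\lambda_k|z|^{2(k-1)},$$ where $G$ is a locally univalent harmonic mapping of $\mathbb{D}$ and $\lambda_1,\dots,\lambda_p$ are complex constants. Then: (a) $\displaystyle \frac{D(f)}{f}=\frac{D(G)}{G}$ and $\displaystyle \frac{D^2(f)}{D(f)}=\frac{D^2(G)}{D(G)}$. (b) $f$ is convex (resp. starlike) if and only if $G$ is convex (resp. starlike).
   Context: $\mathbb{D}=\{z\in\mathbb{C}:|z|<1\}$. A $2p$-times continuously differentiable complex-valued function $f$ on $\mathbb{D}$ is $p$-harmonic if $\Delta^p f=0$, where $\Delta=4\frac{\partial^2}{\partial z\partial\overline z}$ is the Laplacian and $\Delta^p$ its $p$-fold iterate; harmonic means $1$-harmonic (complex-valued). For a $C^1$ function $f$, $Df=D(f)=zf_z-\overline{z}f_{\overline z}$, and $D^2(f)=D(D(f))$. For a sense-preserving $C^1$-mapping the Jacobian is $J_f=|f_z|^2-|f_{\overline z}|^2>0$. Starlike: a $C^1$-mapping $f$ with $f(0)=0$ is called starlike if $f$ maps $\mathbb{D}$ univalently onto a domain $\Omega$ that is starlike with respect to the origin, i.e. for every $w\in\Omega$ the segment $[0,w]$ lies in $\Omega$. It is known that $f$ is starlike if it is sense-preserving, $f(0)=0$, $f(z)\ne0$ for $z\in\mathbb{D}\setminus\{0\}$ and $\frac{\partial}{\partial t}\big(\arg f(re^{it})\big):=\mathrm{Re}\left(\frac{Df(z)}{f(z)}\right)>0$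 for all $z=re^{it}\in\mathbb{D}\setminus\{0\}$. Convex: let $f$ and $Df$ belong to $C^1(\mathbb{D})$. Then $f$ is convex in $\mathbb{D}$ if it is sense-preserving, $f(0)=0$, $f(z)\cdot Df(z)\neq 0$ for all $z\in\mathbb{D}\setminus\{0\}$ and $\mathrm{Re}\left(\frac{D^2f(z)}{Df(z)}\right)>0$ for all $z\in\mathbb{D}\setminus\{0\}$.
   Formalization: In (b), the implication ''G convex implies f convex'' is stated for sense-preserving f (J_f > 0 on the disk); without this it fails, e.g. for p = 2, G(z) = z, f(z) = z|z|^2, where J_f(0) = 0. *)

(* Defs.v *)
From Stdlib Require Import Reals.
From Coquelicot Require Import Coquelicot.
Open Scope C_scope.

(* Mappings of the unit disk are total functions [C -> C]; every notion below
   only inspects values in the open disk, the derivatives being local. *)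
Definition disk (z : C) : Prop := (Cmod z < 1)%R.

Definition partial_x (f : C -> C) (z : C) : C :=
  (Derive (fun x : R => Re (f (x, Im z))) (Re z),
   Derive (fun x : R => Im (f (x, Im z))) (Re z)).

Definition partial_y (f : C -> C) (z : C) : C :=
  (Derive (fun y : R => Re (f (Re z, y))) (Im z),
   Derive (fun y : R => Im (f (Re z, y))) (Im z)).

Definition d_z (f : C -> C) (z : C) : C :=
  (partial_x f z - Ci * partial_y f z) / 2.

Definition d_zbar (f : C -> C) (z : C) : C :=
  (partial_x f z + Ci * partial_y f z) / 2.

(* [Derive] is total, so existence of the first partials is required
   explicitly; continuity of a [C^(k+1)] function follows from that of its
   partials. *)
Fixpoint class_C (k : nat) (f : C -> C) : Prop :=
  match k with
  | O => forall z, disk z -> continuous f z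
  | S k' =>
      (forall z, disk z ->
         ex_derive (V := C_R_NormedModule) (fun x : R => f (x, Im z)) (Re z) /\
         ex_derive (V := C_R_NormedModule) (fun y : R => f (Re z, y)) (Im z)) /\
      class_C k' (partial_x f) /\ class_C k' (partial_y f)
  end.

Definition laplacian (f : C -> C) (z : C) : C := 4 * d_z (d_zbar f) z.

Definition p_harmonic (p : nat) (f : C -> C) : Prop :=
  class_C (2 * p) f /\
  forall z, disk z -> Nat.iter p laplacian f z = 0.

Definition harmonic (f : C -> C) : Prop := p_harmonic 1 f.

Definition Dop (f : C -> C) (z : C) : C :=
  z * d_z f z - Cconj z * d_zbar f z.

Definition jacobian (f : C -> C) (z : C) : R :=
  (Cmod (d_z f z) ^ 2 - Cmod (d_zbar f z) ^ 2)%R.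

Definition sense_preserving (f : C -> C) : Prop :=
  forall z, disk z -> (0 < jacobian f z)%R.

Definition univalent (f : C -> C) : Prop :=
  forall z w, disk z -> disk w -> f z = f w -> z = w.

Definition locally_univalent (f : C -> C) : Prop :=
  forall z0, disk z0 -> exists r : R, (0 < r)%R /\
    forall z w, disk z -> disk w ->
      (Cmod (z - z0) < r)%R -> (Cmod (w - z0) < r)%R -> f z = f w -> z = w.

Definition image_disk (f : C -> C) (w : C) : Prop :=
  exists z, disk z /\ f z = w.

(* Domain starlike with respect to the origin; connectedness follows from the
   segment condition. *)
Definition starlike_domain (Omega : C -> Prop) : Prop :=
  open Omega /\ Omega 0 /\
  forall (w : C) (t : R), Omega w -> (0 <= t <= 1)%R -> Omega (RtoC t * w).

Definition starlike (f : C -> C) : Prop :=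
  class_C 1 f /\ f 0 = 0 /\ univalent f /\ starlike_domain (image_disk f).

Definition convex (f : C -> C) : Prop :=
  class_C 1 f /\ class_C 1 (Dop f) /\
  sense_preserving f /\ f 0 = 0 /\
  (forall z, disk z -> z <> 0 -> f z * Dop f z <> 0) /\
  (forall z, disk z -> z <> 0 -> (0 < Re (Dop (Dop f) z / Dop f z))%R).

(* Main.v *)
(** The factor [S(z) = sum_k lambda_k |z|^(2(k-1))] is invariant under rotations, so [Dop S = 0] and [Dop]
    commutes with multiplication by [S]; this gives (a). For (b), convexity passes between [f] and [G]
    through (a), the remaining point being that [G] preserves orientation: at the origin the Jacobians differ
    by the factor [|S(0)|^2], and by Lewy's theorem (the Jacobian of a locally univalent harmonic map has no
    zero) the sign propagates to the disk.

    For starlikeness the values near the unit circle matter. If [S(1)] were 0, injectivity of [f] would force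
    [|G| -> oo] at the circle, which is impossible for a locally univalent harmonic map: at the maximum of
    [exp |z|^2 (R^2 - |G|^2) / |G_z|] a Keller-Osserman argument bounds [(R^2 - |G(0)|^2) / |G_z(0)|] by a
    multiple of [R] for all [R]. Hence [S(1) <> 0], and [f] and [S(1) G] have the same cluster values at the
    circle, so that their images, both open by invariance of domain, coincide once [G] is univalent.
    Univalence of [G] when [f] is starlike follows by continuing preimages along segments and rays. *)
Require Import Defs.
From Stdlib Require Import ZArith Reals Ranalysis5 List Lra Lia Psatz Classical ClassicalEpsilon FunctionalExtensionality.
From Coquelicot Require Import Coquelicot.
Open Scope C_scope.

(** Let [s z * Cconj z] and [s z * z] be the Wirtinger derivatives of [S]. Then J_f = |S|^2 J_G + 2
    Re (s conj(S) G conj(DG)). The second term is why convexity passes from [G] to [f] only for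
    sense-preserving [f]: for 0 < a < 1 the map z (|z|^4/5 - 2a|z|^2/3 + a^2), with G(z) = z, is
    univalent since its radial profile has derivative (r^2 - a)^2, yet its Jacobian vanishes on
    |z|^2 = a. The quotients in (a) are compared where the denominators on the side of [f] are
    nonzero, so that [S z] cancels. [starlike] contains no condition on Dop f / f, so (a) does not
    settle it and the images themselves have to be compared. The topology comes from one notion, a
    loop whose direction has a continuous periodic angle, which stands for winding number 0: circles
    under an injective map give no such loop, whence invariance of domain and continuous local
    inverses. On the analytic side finite Taylor expansions with geometric remainder suffice: they
    give the leading term at a critical point in Lewy's theorem, and four-point sums replace second
    derivatives in the maximum principle. *)

(** * Moduli and coordinates of complex numbers *)

Lemma Cmod_minus_sym (z w : C) : Cmod (z - w) = Cmod (w - z).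
Proof. rewrite <- Cmod_opp. f_equal. ring. Qed.

Lemma Cmod_triangle_sub (z w : C) : (Cmod z - Cmod w <= Cmod (z - w))%R.
Proof.
  assert (H := Cmod_triangle (z - w) w).
  replace (z - w + w) with z in H by ring. lra.
Qed.

Lemma Cmod_minus_le (z w : C) : (Cmod (z - w) <= Cmod z + Cmod w)%R.
Proof. unfold Cminus. rewrite <- (Cmod_opp w). apply Cmod_triangle. Qed.

Lemma Cmod_pos_eq (x : R) : (0 <= x)%R -> Cmod (RtoC x) = x.
Proof. intros H. rewrite Cmod_R. now apply Rabs_pos_eq. Qed.

Lemma im_le_Cmod (z : C) : (Rabs (Im z) <= Cmod z)%R.
Proof. eapply Rle_trans; [apply Rmax_r|apply Rmax_Cmod]. Qed.

Lemma Cmod_le_Re_Im (z : C) : (Cmod z <= Rabs (Re z) + Rabs (Im z))%R.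
Proof.
  destruct z as [x y]. simpl.
  replace (x, y) with (RtoC x + Ci * RtoC y) by (unfold RtoC, Cplus, Cmult, Ci; simpl; f_equal; ring).
  eapply Rle_trans; [apply Cmod_triangle|].
  rewrite Cmod_mult, Cmod_Ci, !Cmod_R. lra.
Qed.

Lemma C_eta (z : C) : z = RtoC (Re z) + Ci * RtoC (Im z).
Proof. destruct z; unfold RtoC, Cplus, Cmult, Ci; simpl; f_equal; ring. Qed.

Lemma Ceq_Re_Im (z w : C) : Re z = Re w -> Im z = Im w -> z = w.
Proof. destruct z, w; simpl; intros; subst; reflexivity. Qed.

Lemma Rlt_min_l {x a b : R} : (x < Rmin a b)%R -> (x < a)%R.
Proof. intros H. eapply Rlt_le_trans; [exact H|apply Rmin_l]. Qed.

Lemma Rlt_min_r {x a b : R} : (x < Rmin a b)%R -> (x < b)%R.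
Proof. intros H. eapply Rlt_le_trans; [exact H|apply Rmin_r]. Qed.

Lemma Cminus_diag (z : C) : z - z = 0.
Proof. ring. Qed.

Lemma Cminus_0_r (z : C) : z - 0 = z.
Proof. ring. Qed.

Lemma Ceq_minus (z w : C) : z - w = 0 -> z = w.
Proof. intros H. replace z with (z - w + w) by ring. rewrite H. ring. Qed.

(** * Continuity measured by the modulus *)

(** [continuous] on [C] refers to product balls of the two coordinates, whereas the estimates for
    products and inverses are made with [Cmod]; [cont_continuous] identifies the two. *)
Definition cont (F : C -> C) (z : C) : Prop :=
  forall eps : R, (0 < eps)%R -> exists del : R, (0 < del)%R /\
    forall w, (Cmod (w - z) < del)%R -> (Cmod (F w - F z) < eps)%R.

Lemma cont_continuous (F : C -> C) (z : C) : cont F z <-> continuous F z.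
Proof.
  split.
  - intros H. apply (proj2 (filterlim_locally (F := locally z) F (F z))).
    intros eps. destruct (H eps (cond_pos eps)) as (del & Hdel & Hw).
    assert (Hd2 : (0 < del / 2)%R) by lra.
    exists (mkposreal _ Hd2). intros w [H1 H2].
    change (Rabs (Re w - Re z) < del / 2)%R in H1.
    change (Rabs (Im w - Im z) < del / 2)%R in H2.
    assert (Hc : (Cmod (w - z) < del)%R).
    { eapply Rle_lt_trans; [apply Cmod_le_Re_Im|].
      change (Re (w - z)) with (Re w - Re z)%R. change (Im (w - z)) with (Im w - Im z)%R. lra. }
    specialize (Hw w Hc).
    split.
    + change (Rabs (Re (F w - F z)) < eps)%R. eapply Rle_lt_trans; [apply re_le_Cmod|exact Hw].
    + change (Rabs (Im (F w - F z)) < eps)%R. eapply Rle_lt_trans; [apply im_le_Cmod|exact Hw].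
  - intros H eps Heps.
    assert (He2 : (0 < eps / 2)%R) by lra.
    destruct (proj1 (filterlim_locally (F := locally z) F (F z)) H (mkposreal _ He2)) as [del Hdel].
    exists del. split; [apply cond_pos|]. intros w Hw.
    destruct (Hdel w) as [H1 H2].
    + split.
      * change (Rabs (Re (w - z)) < del)%R. eapply Rle_lt_trans; [apply re_le_Cmod|exact Hw].
      * change (Rabs (Im (w - z)) < del)%R. eapply Rle_lt_trans; [apply im_le_Cmod|exact Hw].
    + change (Rabs (Re (F w - F z)) < eps / 2)%R in H1.
      change (Rabs (Im (F w - F z)) < eps / 2)%R in H2.
      eapply Rle_lt_trans; [apply Cmod_le_Re_Im|]. lra.
Qed.

Lemma open_Cmod (U : C -> Prop) :
  open U <-> forall z, U z -> exists del : R, (0 < del)%R /\ forall w, (Cmod (w - z) < del)%R -> U w.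
Proof.
  split.
  - intros H z Hz. destruct (H z Hz) as [del Hdel].
    exists del. split; [apply cond_pos|]. intros w Hw. apply Hdel. split.
    + change (Rabs (Re (w - z)) < del)%R. eapply Rle_lt_trans; [apply re_le_Cmod|exact Hw].
    + change (Rabs (Im (w - z)) < del)%R. eapply Rle_lt_trans; [apply im_le_Cmod|exact Hw].
  - intros H z Hz. destruct (H z Hz) as (del & Hdel & Hw).
    assert (Hd2 : (0 < del / 2)%R) by lra.
    exists (mkposreal _ Hd2). intros w [H1 H2]. apply Hw.
    change (Rabs (Re (w - z)) < del / 2)%R in H1.
    change (Rabs (Im (w - z)) < del / 2)%R in H2.
    eapply Rle_lt_trans; [apply Cmod_le_Re_Im|]. lra.
Qed.

Lemma cont_const (c z : C) : cont (fun _ => c) z.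
Proof. intros eps H. exists 1%R. split; [lra|]. intros w _. replace (c - c) with (RtoC 0) by ring. now rewrite Cmod_0. Qed.

Lemma cont_id (z : C) : cont (fun w => w) z.
Proof. intros eps H. exists eps. auto. Qed.

Lemma cont_ext_loc (F G : C -> C) (z : C) (d : R) :
  (0 < d)%R -> (forall w, (Cmod (w - z) < d)%R -> F w = G w) -> cont F z -> cont G z.
Proof.
  intros Hd He H eps Heps. destruct (H eps Heps) as (del & Hdel & Hw).
  exists (Rmin d del). split; [now apply Rmin_pos|]. intros w Hlt.
  rewrite <- !He; [apply Hw| |].
  - exact (Rlt_min_r Hlt).
  - replace (z - z) with (RtoC 0) by ring. now rewrite Cmod_0.
  - exact (Rlt_min_l Hlt).
Qed.

Lemma cont_comp (F G : C -> C) (z : C) : cont F z -> cont G (F z) -> cont (fun w => G (F w)) z.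
Proof.
  intros HF HG eps Heps. destruct (HG eps Heps) as (d1 & Hd1 & H1).
  destruct (HF d1 Hd1) as (d2 & Hd2 & H2). exists d2. split; auto.
Qed.

Lemma cont_lip (F G : C -> C) (z : C) :
  (forall w, (Cmod (G w - G z) <= Cmod (F w - F z))%R) -> cont F z -> cont G z.
Proof.
  intros H HF eps Heps. destruct (HF eps Heps) as (d & Hd & Hw). exists d. split; [exact Hd|].
  intros w Hlt. eapply Rle_lt_trans; [apply H|now apply Hw].
Qed.

Lemma cont_conj (F : C -> C) (z : C) : cont F z -> cont (fun w => Cconj (F w)) z.
Proof. apply cont_lip. intros w. rewrite <- Cminus_conj, Cmod_conj. lra. Qed.

Lemma cont_Re (F : C -> C) (z : C) : cont F z -> cont (fun w => RtoC (Re (F w))) z.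
Proof. apply cont_lip. intros w. rewrite <- RtoC_minus, Cmod_R. apply (re_le_Cmod (F w - F z)). Qed.

Lemma cont_Im (F : C -> C) (z : C) : cont F z -> cont (fun w => RtoC (Im (F w))) z.
Proof. apply cont_lip. intros w. rewrite <- RtoC_minus, Cmod_R. apply (im_le_Cmod (F w - F z)). Qed.

Lemma cont_Cmod (F : C -> C) (z : C) : cont F z -> cont (fun w => RtoC (Cmod (F w))) z.
Proof.
  apply cont_lip. intros w. rewrite <- RtoC_minus, Cmod_R. apply Rabs_le.
  assert (H1 := Cmod_triangle_sub (F w) (F z)). assert (H2 := Cmod_triangle_sub (F z) (F w)).
  rewrite (Cmod_minus_sym (F z)) in H2. lra.
Qed.

Lemma cont_plus (F G : C -> C) (z : C) : cont F z -> cont G z -> cont (fun w => F w + G w) z.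
Proof.
  intros HF HG eps Heps.
  destruct (HF (eps / 2)%R ltac:(lra)) as (d1 & Hd1 & H1).
  destruct (HG (eps / 2)%R ltac:(lra)) as (d2 & Hd2 & H2).
  exists (Rmin d1 d2). split; [now apply Rmin_pos|]. intros w Hw.
  assert (Ha := H1 w (Rlt_min_l Hw)).
  assert (Hb := H2 w (Rlt_min_r Hw)).
  replace (F w + G w - (F z + G z)) with ((F w - F z) + (G w - G z)) by ring.
  eapply Rle_lt_trans; [apply Cmod_triangle|lra].
Qed.

Lemma cont_bounded (F : C -> C) (z : C) : cont F z ->
  exists del : R, (0 < del)%R /\ forall w, (Cmod (w - z) < del)%R -> (Cmod (F w) <= Cmod (F z) + 1)%R.
Proof.
  intros H. destruct (H 1%R ltac:(lra)) as (d & Hd & Hw). exists d. split; [exact Hd|].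
  intros w Hlt. specialize (Hw w Hlt). assert (H1 := Cmod_triangle_sub (F w) (F z)). lra.
Qed.

Lemma cont_mult (F G : C -> C) (z : C) : cont F z -> cont G z -> cont (fun w => F w * G w) z.
Proof.
  intros HF HG eps Heps.
  destruct (cont_bounded F z HF) as (d0 & Hd0 & H0).
  set (A := (Cmod (F z) + 1)%R) in *. set (B := (Cmod (G z) + 1)%R).
  assert (HA : (0 < A)%R) by (unfold A; assert (H := Cmod_ge_0 (F z)); lra).
  assert (HB : (0 < B)%R) by (unfold B; assert (H := Cmod_ge_0 (G z)); lra).
  destruct (HG (eps / 2 / A)%R) as (d1 & Hd1 & H1). { apply Rdiv_lt_0_compat; lra. }
  destruct (HF (eps / 2 / B)%R) as (d2 & Hd2 & H2). { apply Rdiv_lt_0_compat; lra. }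
  exists (Rmin d0 (Rmin d1 d2)). split; [repeat apply Rmin_pos; auto|]. intros w Hw.
  assert (Hw0 := Rlt_min_l Hw).
  assert (Hw' := Rlt_min_r Hw).
  specialize (H0 w Hw0).
  specialize (H1 w (Rlt_min_l Hw')).
  specialize (H2 w (Rlt_min_r Hw')).
  replace (F w * G w - F z * G z) with (F w * (G w - G z) + (F w - F z) * G z) by ring.
  eapply Rle_lt_trans; [apply Cmod_triangle|]. rewrite !Cmod_mult.
  assert (E1 : (Cmod (F w) * Cmod (G w - G z) <= A * Cmod (G w - G z))%R)
    by (apply Rmult_le_compat_r; [apply Cmod_ge_0|exact H0]).
  assert (E2 : (A * Cmod (G w - G z) < A * (eps / 2 / A))%R) by (apply Rmult_lt_compat_l; assumption).
  assert (E3 : (Cmod (F w - F z) * Cmod (G z) <= Cmod (F w - F z) * B)%R)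
    by (apply Rmult_le_compat_l; [apply Cmod_ge_0|unfold B; lra]).
  assert (E4 : (Cmod (F w - F z) * B < eps / 2 / B * B)%R) by (apply Rmult_lt_compat_r; assumption).
  replace (A * (eps / 2 / A))%R with (eps / 2)%R in E2 by (field; lra).
  replace (eps / 2 / B * B)%R with (eps / 2)%R in E4 by (field; lra).
  lra.
Qed.

Lemma cont_opp (F : C -> C) (z : C) : cont F z -> cont (fun w => - F w) z.
Proof. apply cont_lip. intros w. rewrite <- Cmod_opp. right. f_equal. ring. Qed.

Lemma cont_minus (F G : C -> C) (z : C) : cont F z -> cont G z -> cont (fun w => F w - G w) z.
Proof. intros HF HG. apply (cont_plus F (fun w => - G w)); [exact HF|now apply cont_opp]. Qed.

Lemma cont_pow (F : C -> C) (n : nat) (z : C) : cont F z -> cont (fun w => F w ^ n) z.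
Proof.
  intros H. induction n as [|n IH]; simpl; [apply cont_const|now apply cont_mult].
Qed.

Lemma cont_inv (F : C -> C) (z : C) : F z <> 0 -> cont F z -> cont (fun w => / F w) z.
Proof.
  intros H0 HF eps Heps. assert (Hm := proj1 (Cmod_gt_0 _) H0). set (m := Cmod (F z)) in *.
  assert (He : (0 < eps * (m * m / 2))%R) by (apply Rmult_lt_0_compat; nra).
  destruct (HF (Rmin (m / 2) (eps * (m * m / 2)))%R) as (d & Hd & Hw). { apply Rmin_pos; lra. }
  exists d. split; [exact Hd|]. intros w Hlt. specialize (Hw w Hlt).
  assert (H1 := Rlt_min_l Hw). assert (H2 := Rlt_min_r Hw).
  assert (H3 := Cmod_triangle_sub (F z) (F w)). rewrite Cmod_minus_sym in H3. fold m in H3.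
  assert (H4 : (m / 2 < Cmod (F w))%R) by lra.
  assert (Hw0 : F w <> 0) by (apply Cmod_gt_0; lra).
  replace (/ F w - / F z) with (- (F w - F z) / (F w * F z)) by (field; auto).
  rewrite Cmod_div by (now apply Cmult_neq_0). rewrite Cmod_opp, Cmod_mult. fold m.
  apply Rlt_div_l; [nra|]. eapply Rlt_le_trans; [exact H2|]. apply Rmult_le_compat_l; nra.
Qed.

Lemma disk_open (z : C) : disk z -> exists d : R, (0 < d)%R /\
  forall w, (Cmod (w - z) < d)%R -> disk w.
Proof.
  unfold disk. intros H. exists (1 - Cmod z)%R. split; [lra|]. intros w Hw.
  assert (H1 := Cmod_triangle_sub w z). lra.
Qed.

(** * Real differentiability in Wirtinger form *)

(** Little-o of [w] at 0. The weak inequality also covers [w = 0], where it forces [e 0 = 0]. *)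
Definition lito (e : C -> C) : Prop :=
  forall eps : R, (0 < eps)%R -> exists del : R, (0 < del)%R /\
    forall w, (Cmod w < del)%R -> (Cmod (e w) <= eps * Cmod w)%R.

(** Real Fréchet differentiability, the differential being a dz + b dzbar. By [rdiff_d] the pair is
    determined, so that [d_z] and [d_zbar] follow from sum, product and conjugation rules without
    returning to [Derive]. *)
Definition rdiff (F : C -> C) (z a b : C) : Prop :=
  lito (fun w => F (z + w) - F z - (a * w + b * Cconj w)).

Lemma lito_ext (e e' : C -> C) : (forall w, e w = e' w) -> lito e -> lito e'.
Proof. intros H He eps Heps. destruct (He eps Heps) as (d & Hd & Hw). exists d. split; auto. intros w; rewrite <- H; auto. Qed.

Lemma lito_plus (e e' : C -> C) : lito e -> lito e' -> lito (fun w => e w + e' w).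
Proof.
  intros H H' eps Heps.
  destruct (H (eps / 2)%R ltac:(lra)) as (d1 & Hd1 & H1).
  destruct (H' (eps / 2)%R ltac:(lra)) as (d2 & Hd2 & H2).
  exists (Rmin d1 d2). split; [now apply Rmin_pos|]. intros w Hw.
  assert (Ha := H1 w (Rlt_min_l Hw)).
  assert (Hb := H2 w (Rlt_min_r Hw)).
  eapply Rle_trans; [apply Cmod_triangle|lra].
Qed.

Lemma lito_mult (e g : C -> C) (M d : R) : (0 < d)%R ->
  (forall w, (Cmod w < d)%R -> (Cmod (g w) <= M)%R) -> lito e -> lito (fun w => g w * e w).
Proof.
  intros Hd HM H eps Heps.
  assert (HM0 : (0 <= M)%R). { eapply Rle_trans; [apply Cmod_ge_0|apply (HM 0)]. now rewrite Cmod_0. }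
  destruct (H (eps / (M + 1))%R) as (d1 & Hd1 & H1). { apply Rdiv_lt_0_compat; lra. }
  exists (Rmin d d1). split; [now apply Rmin_pos|]. intros w Hw.
  assert (Ha := HM w (Rlt_min_l Hw)).
  assert (Hb := H1 w (Rlt_min_r Hw)).
  rewrite Cmod_mult.
  apply Rle_trans with ((M + 1) * (eps / (M + 1) * Cmod w))%R.
  - apply Rmult_le_compat; try apply Cmod_ge_0; lra.
  - right. field. lra.
Qed.

Lemma rdiff_ext_loc (F G : C -> C) (z a b : C) (d : R) :
  (0 < d)%R -> (forall w, (Cmod (w - z) < d)%R -> F w = G w) -> rdiff F z a b -> rdiff G z a b.
Proof.
  intros Hd He H eps Heps. destruct (H eps Heps) as (del & Hdel & Hw).
  exists (Rmin d del). split; [now apply Rmin_pos|]. intros w Hlt.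
  rewrite <- !He; [apply Hw| |].
  - exact (Rlt_min_r Hlt).
  - replace (z - z) with (RtoC 0) by ring. now rewrite Cmod_0.
  - replace (z + w - z) with w by ring. exact (Rlt_min_l Hlt).
Qed.

Lemma rdiff_ext_disk (F G : C -> C) (z a b : C) :
  disk z -> (forall w, disk w -> F w = G w) -> rdiff F z a b -> rdiff G z a b.
Proof.
  intros Hz He. destruct (disk_open z Hz) as (d & Hd & Hw).
  apply (rdiff_ext_loc F G z a b d Hd). auto.
Qed.

Lemma rdiff_val (F : C -> C) (z a b a' b' : C) : a = a' -> b = b' -> rdiff F z a b -> rdiff F z a' b'.
Proof. now intros -> ->. Qed.

Lemma rdiff_const (c z : C) : rdiff (fun _ => c) z 0 0.
Proof.
  intros eps Heps. exists 1%R. split; [lra|]. intros w _.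
  replace (c - c - (0 * w + 0 * Cconj w)) with (RtoC 0) by ring. rewrite Cmod_0.
  apply Rmult_le_pos; [lra|apply Cmod_ge_0].
Qed.

Lemma rdiff_id (z : C) : rdiff (fun w => w) z 1 0.
Proof.
  intros eps Heps. exists 1%R. split; [lra|]. intros w _.
  replace (z + w - z - (1 * w + 0 * Cconj w)) with (RtoC 0) by ring. rewrite Cmod_0.
  apply Rmult_le_pos; [lra|apply Cmod_ge_0].
Qed.

Lemma rdiff_conj (F : C -> C) (z a b : C) :
  rdiff F z a b -> rdiff (fun w => Cconj (F w)) z (Cconj b) (Cconj a).
Proof.
  intros H eps Heps. destruct (H eps Heps) as (del & Hdel & Hw). exists del. split; [exact Hdel|].
  intros w Hlt. rewrite <- (Cmod_conj).
  replace (Cconj (Cconj (F (z + w)) - Cconj (F z) - (Cconj b * w + Cconj a * Cconj w)))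
    with (F (z + w) - F z - (a * w + b * Cconj w)); [auto|].
  rewrite !Cminus_conj, Cplus_conj, !Cmult_conj, !Cconj_conj. ring.
Qed.

Lemma rdiff_plus (F G : C -> C) (z a b a' b' : C) :
  rdiff F z a b -> rdiff G z a' b' -> rdiff (fun w => F w + G w) z (a + a') (b + b').
Proof. intros HF HG. eapply lito_ext; [|apply (lito_plus _ _ HF HG)]. intros w. simpl. ring. Qed.

Lemma rdiff_cont (F : C -> C) (z a b : C) : rdiff F z a b -> cont F z.
Proof.
  intros H eps Heps. destruct (H 1%R ltac:(lra)) as (d & Hd & Hw).
  set (M := (Cmod a + Cmod b + 1)%R).
  assert (HM : (0 < M)%R) by (unfold M; assert (Ha := Cmod_ge_0 a); assert (Hb := Cmod_ge_0 b); lra).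
  exists (Rmin d (eps / M)). split; [apply Rmin_pos; [lra|now apply Rdiv_lt_0_compat]|].
  intros w Hlt. specialize (Hw (w - z) (Rlt_min_l Hlt)).
  assert (H2 := Rlt_min_r Hlt).
  replace (z + (w - z)) with w in Hw by ring.
  apply Rlt_div_r in H2; [|exact HM].
  eapply Rle_lt_trans; [|exact H2].
  replace (F w - F z) with ((F w - F z - (a * (w - z) + b * Cconj (w - z))) + (a * (w - z) + b * Cconj (w - z))) by ring.
  eapply Rle_trans; [apply Cmod_triangle|].
  assert (H3 := Cmod_triangle (a * (w - z)) (b * Cconj (w - z))).
  rewrite !Cmod_mult, Cmod_conj in H3. unfold M. lra.
Qed.

Lemma rdiff_mult (F G : C -> C) (z a b a' b' : C) :
  rdiff F z a b -> rdiff G z a' b' ->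
  rdiff (fun w => F w * G w) z (a * G z + F z * a') (b * G z + F z * b').
Proof.
  intros HF HG.
  assert (CG := rdiff_cont _ _ _ _ HG).
  destruct (cont_bounded G z CG) as (d & Hd & HB).
  assert (L1 : lito (fun w => G (z + w) * (F (z + w) - F z - (a * w + b * Cconj w)))).
  { apply (lito_mult _ (fun w => G (z + w)) (Cmod (G z) + 1)%R d Hd); [|exact HF]. intros w Hw. apply HB.
    now replace (z + w - z) with w by ring. }
  assert (L2 : lito (fun w => F z * (G (z + w) - G z - (a' * w + b' * Cconj w)))).
  { apply (lito_mult _ (fun w => F z) (Cmod (F z)) 1 ltac:(lra)); [|exact HG]. intros; lra. }
  assert (L3 : lito (fun w => (G (z + w) - G z) * (a * w + b * Cconj w))).
  { intros eps Heps. set (M := (Cmod a + Cmod b + 1)%R).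
    assert (HM : (0 < M)%R) by (unfold M; assert (Ha := Cmod_ge_0 a); assert (Hb := Cmod_ge_0 b); lra).
    destruct (CG (eps / M)%R ltac:(now apply Rdiv_lt_0_compat)) as (d1 & Hd1 & H1).
    exists d1. split; [exact Hd1|]. intros w Hw. rewrite Cmod_mult.
    specialize (H1 (z + w)). replace (z + w - z) with w in H1 by ring. specialize (H1 Hw).
    apply Rle_trans with (eps / M * (M * Cmod w))%R.
    - apply Rmult_le_compat; try apply Cmod_ge_0; [lra|].
      eapply Rle_trans; [apply Cmod_triangle|]. rewrite !Cmod_mult, Cmod_conj. unfold M.
      assert (Hc := Cmod_ge_0 w). lra.
    - right. field. lra. }
  eapply lito_ext; [|apply (lito_plus _ _ (lito_plus _ _ L1 L2) L3)].
  intros w. simpl. ring.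
Qed.

Lemma rdiff_scal (c : C) (F : C -> C) (z a b : C) :
  rdiff F z a b -> rdiff (fun w => c * F w) z (c * a) (c * b).
Proof.
  intros H. eapply rdiff_val; [| |apply (rdiff_mult _ _ _ _ _ _ _ (rdiff_const c z) H)]; ring.
Qed.

Lemma rdiff_opp (F : C -> C) (z a b : C) : rdiff F z a b -> rdiff (fun w => - F w) z (- a) (- b).
Proof.
  intros H. eapply lito_ext; [|apply (rdiff_scal (-(1)) F z a b H)]. intros w. simpl. ring.
Qed.

Lemma rdiff_minus (F G : C -> C) (z a b a' b' : C) :
  rdiff F z a b -> rdiff G z a' b' -> rdiff (fun w => F w - G w) z (a - a') (b - b').
Proof. intros HF HG. apply (rdiff_plus _ _ _ _ _ _ _ HF (rdiff_opp _ _ _ _ HG)). Qed.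

Lemma rdiff_shift (F : C -> C) (c z a b : C) : rdiff F (c + z) a b -> rdiff (fun w => F (c + w)) z a b.
Proof. intros H. eapply lito_ext; [|exact H]. intros w. simpl. now rewrite Cplus_assoc. Qed.

Lemma rdiff_pow (n : nat) (z : C) : rdiff (fun w => w ^ n) z (INR n * z ^ (n - 1)) 0.
Proof.
  induction n as [|n IH].
  - simpl. eapply rdiff_val; [| |apply rdiff_const]; ring.
  - eapply rdiff_val; [| |apply (rdiff_mult _ _ _ _ _ _ _ (rdiff_id z) IH)]; [|ring].
    replace (S n - 1)%nat with n by lia. rewrite S_INR, RtoC_plus.
    destruct n as [|n]; [simpl; ring|]. replace (S n - 1)%nat with n by lia.
    change (z ^ S n) with (z * z ^ n). ring.
Qed.

(** * Comparison with the partial derivatives of real and imaginary parts *)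

Lemma is_derive_C_pair (f : R -> C) (t : R) (l : C) :
  is_derive (V := C_R_NormedModule) f t l <->
  is_derive (fun s => Re (f s)) t (Re l) /\ is_derive (fun s => Im (f s)) t (Im l).
Proof.
  split.
  - intros H. split.
    + apply (filterdiff_ext_lin (K := R_AbsRing) (U := R_NormedModule) (V := R_NormedModule) _ (fun y : R => Re (scal (V := C_R_NormedModule) y l)) (fun y : R => scal (V := R_NormedModule) y (Re l))); [|reflexivity].
      apply (filterdiff_comp' (U := R_NormedModule) (V := C_R_NormedModule) (W := R_NormedModule) f (fun c : C => fst c) t (fun y : R => scal (V := C_R_NormedModule) y l) (fun c => fst c)); [exact H|].
      apply filterdiff_linear. apply (is_linear_fst (K := R_AbsRing) (U := R_NormedModule) (V := R_NormedModule)).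
    + apply (filterdiff_ext_lin (K := R_AbsRing) (U := R_NormedModule) (V := R_NormedModule) _ (fun y : R => Im (scal (V := C_R_NormedModule) y l)) (fun y : R => scal (V := R_NormedModule) y (Im l))); [|reflexivity].
      apply (filterdiff_comp' (U := R_NormedModule) (V := C_R_NormedModule) (W := R_NormedModule) f (fun c : C => snd c) t (fun y : R => scal (V := C_R_NormedModule) y l) (fun c => snd c)); [exact H|].
      apply filterdiff_linear. apply (is_linear_snd (K := R_AbsRing) (U := R_NormedModule) (V := R_NormedModule)).
  - intros [H1 H2].
    assert (D := is_derive_plus (V := C_R_NormedModule) _ _ t _ _
      (is_derive_scal_l (V := C_R_NormedModule) _ t _ ((1, 0)%R : C) H1)
      (is_derive_scal_l (V := C_R_NormedModule) _ t _ ((0, 1)%R : C) H2)).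
    replace l with (plus (G := C_R_NormedModule) (scal (V := C_R_NormedModule) (Re l) ((1, 0)%R : C)) (scal (V := C_R_NormedModule) (Im l) ((0, 1)%R : C))).
    + eapply is_derive_ext; [|exact D]. intros s. unfold plus, scal; simpl.
      unfold mult; simpl. unfold Cplus; simpl. apply Ceq_Re_Im; destruct (f s) as [u v]; cbn; ring.
    + unfold plus, scal; simpl. unfold mult; simpl. unfold Cplus; simpl. apply Ceq_Re_Im; destruct l as [u v]; cbn; ring.
Qed.

Lemma plus_le_Rmax (x y : R) : (Rabs x + Rabs y <= 2 * Rmax (Rabs x) (Rabs y))%R.
Proof. assert (H1 := Rmax_l (Rabs x) (Rabs y)). assert (H2 := Rmax_r (Rabs x) (Rabs y)). lra. Qed.

(** In Wirtinger terms F_x = a + b and F_y = i (a - b). The two notions of remainder agree because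
    the modulus and the maximum of the coordinates differ by a factor at most 2. *)
Lemma rdiff_iff (F : C -> C) (z a b : C) :
  rdiff F z a b <->
  differentiable_pt_lim (fun u v => Re (F (u, v))) (Re z) (Im z) (Re (a + b)) (Re (Ci * (a - b))) /\
  differentiable_pt_lim (fun u v => Im (F (u, v))) (Re z) (Im z) (Im (a + b)) (Im (Ci * (a - b))).
Proof.
  destruct z as [x y]. destruct a as [a1 a2]. destruct b as [b1 b2].
  assert (ER : forall u v : R, (Re (F (u, v)) - Re (F (x, y)) - (Re ((a1, a2) + (b1, b2)) * (u - x) + Re (Ci * ((a1, a2) - (b1, b2))) * (v - y)))%R
     = Re (F (u, v) - F (x, y) - ((a1, a2) * (u - x, v - y)%R + (b1, b2) * Cconj (u - x, v - y)%R))).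
  { intros u v. destruct (F (u, v)), (F (x, y)). simpl. ring. }
  assert (EI : forall u v : R, (Im (F (u, v)) - Im (F (x, y)) - (Im ((a1, a2) + (b1, b2)) * (u - x) + Im (Ci * ((a1, a2) - (b1, b2))) * (v - y)))%R
     = Im (F (u, v) - F (x, y) - ((a1, a2) * (u - x, v - y)%R + (b1, b2) * Cconj (u - x, v - y)%R))).
  { intros u v. destruct (F (u, v)), (F (x, y)). simpl. ring. }
  split.
  - intros H.
    assert (K : forall eps : posreal, exists del : posreal, forall u v : R,
      (Rabs (u - x) < del -> Rabs (v - y) < del ->
      Cmod (F (u, v) - F (x, y) - ((a1, a2) * (u - x, v - y)%R + (b1, b2) * Cconj (u - x, v - y)%R))
      <= eps * Rmax (Rabs (u - x)) (Rabs (v - y)))%R).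
    { intros eps. destruct (H (eps / 2)%R) as (d & Hd & Hw). { assert (He := cond_pos eps). lra. }
      assert (Hd2 : (0 < d / 2)%R) by lra. exists (mkposreal _ Hd2). simpl. intros u v Hu Hv.
      assert (Hc : (Cmod (u - x, v - y)%R <= Rabs (u - x) + Rabs (v - y))%R) by apply (Cmod_le_Re_Im (u - x, v - y)%R).
      specialize (Hw (u - x, v - y)%R ltac:(lra)).
      replace ((x, y) + (u - x, v - y)%R) with ((u, v) : C) in Hw by (unfold Cplus; simpl; f_equal; ring).
      eapply Rle_trans; [exact Hw|].
      apply Rle_trans with (eps / 2 * (2 * Rmax (Rabs (u - x)) (Rabs (v - y))))%R; [|right; field].
      apply Rmult_le_compat_l; [assert (He := cond_pos eps); lra|].
      eapply Rle_trans; [exact Hc|apply plus_le_Rmax]. }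
    split; intros eps; destruct (K eps) as [d Hd]; exists d; intros u v Hu Hv;
      (eapply Rle_trans; [|apply (Hd u v Hu Hv)]).
    + cbv beta. simpl (Re (x, y)). simpl (Im (x, y)). rewrite ER. apply re_le_Cmod.
    + cbv beta. simpl (Re (x, y)). simpl (Im (x, y)). rewrite EI. apply im_le_Cmod.
  - intros [H1 H2] eps Heps.
    assert (He2 : (0 < eps / 2)%R) by lra.
    destruct (H1 (mkposreal _ He2)) as [d1 K1]. destruct (H2 (mkposreal _ He2)) as [d2 K2].
    exists (Rmin d1 d2). split; [apply Rmin_pos; apply cond_pos|]. intros [w1 w2] Hw.
    assert (Hw1 := Rlt_min_l Hw). assert (Hw2 := Rlt_min_r Hw).
    assert (Hr := re_le_Cmod (w1, w2)). assert (Hi := im_le_Cmod (w1, w2)). simpl in Hr, Hi.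
    specialize (K1 (x + w1)%R (y + w2)%R). specialize (K2 (x + w1)%R (y + w2)%R).
    cbv beta in K1, K2. simpl (Re (x, y)) in K1, K2. simpl (Im (x, y)) in K1, K2.
    rewrite ER in K1. rewrite EI in K2.
    replace (x + w1 - x)%R with w1 in K1, K2 by ring. replace (y + w2 - y)%R with w2 in K1, K2 by ring.
    specialize (K1 ltac:(lra) ltac:(lra)). specialize (K2 ltac:(lra) ltac:(lra)). simpl (pos _) in K1, K2.
    change ((x, y) + (w1, w2)) with (((x + w1)%R, (y + w2)%R) : C).
    eapply Rle_trans; [apply Cmod_le_Re_Im|].
    assert (HM : (Rmax (Rabs w1) (Rabs w2) <= Cmod (w1, w2))%R) by (apply Rmax_lub; assumption).
    assert (HM2 : (eps / 2 * Rmax (Rabs w1) (Rabs w2) <= eps / 2 * Cmod (w1, w2))%R) by (apply Rmult_le_compat_l; lra).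
    lra.
Qed.

Lemma rdiff_partials (F : C -> C) (z a b : C) : rdiff F z a b ->
  is_derive (V := C_R_NormedModule) (fun x : R => F (x, Im z)) (Re z) (a + b) /\
  is_derive (V := C_R_NormedModule) (fun y : R => F (Re z, y)) (Im z) (Ci * (a - b)).
Proof.
  intros H. destruct (proj1 (rdiff_iff F z a b) H) as [H1 H2].
  assert (P : forall (f : R -> R -> R) x y lx ly, differentiable_pt_lim f x y lx ly ->
    is_derive (fun t => f t y) x lx /\ is_derive (fun t => f x t) y ly).
  { intros f x y lx ly D. split.
    - apply is_derive_Reals. replace lx with (lx * 1 + ly * 0)%R by ring.
      apply (derivable_pt_lim_comp_2d f (fun t => t) (fun _ => y)); [exact D| |].
      + apply derivable_pt_lim_id.
      + apply derivable_pt_lim_const.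
    - apply is_derive_Reals. replace ly with (lx * 0 + ly * 1)%R by ring.
      apply (derivable_pt_lim_comp_2d f (fun _ => x) (fun t => t)); [exact D| |].
      + apply derivable_pt_lim_const.
      + apply derivable_pt_lim_id. }
  destruct (P _ _ _ _ _ H1) as [A1 A2]. destruct (P _ _ _ _ _ H2) as [B1 B2].
  split; apply is_derive_C_pair; split; assumption.
Qed.

Lemma rdiff_d (F : C -> C) (z a b : C) : rdiff F z a b -> d_z F z = a /\ d_zbar F z = b.
Proof.
  intros H. destruct (rdiff_partials F z a b H) as [Hx Hy].
  apply is_derive_C_pair in Hx. apply is_derive_C_pair in Hy.
  destruct Hx as [Hx1 Hx2]. destruct Hy as [Hy1 Hy2].
  assert (Ex : partial_x F z = a + b).
  { apply Ceq_Re_Im; [exact (is_derive_unique _ _ _ Hx1)|exact (is_derive_unique _ _ _ Hx2)]. }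
  assert (Ey : partial_y F z = Ci * (a - b)).
  { apply Ceq_Re_Im; [exact (is_derive_unique _ _ _ Hy1)|exact (is_derive_unique _ _ _ Hy2)]. }
  assert (H2 : (2 : C) <> 0) by (intros E; injection E; lra).
  assert (Hi : Ci * Ci = -(1)) by (unfold Ci, Cmult, Copp, RtoC; simpl; f_equal; ring).
  unfold d_z, d_zbar. rewrite Ex, Ey. rewrite !Cmult_assoc, Hi. split; field; auto.
Qed.

Lemma rdiff_curve (F : C -> C) (v : R -> C) (t : R) (a b v' : C) :
  rdiff F (v t) a b -> is_derive (V := C_R_NormedModule) v t v' ->
  is_derive (fun s => Re (F (v s))) t (Re (a * v' + b * Cconj v')).
Proof.
  intros H Hv. apply rdiff_iff in H. destruct H as [H _].
  apply is_derive_C_pair in Hv. destruct Hv as [Hx Hy].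
  apply (is_derive_ext (fun s => Re (F (Re (v s), Im (v s))))).
  { intros s. now destruct (v s). }
  apply is_derive_Reals.
  replace (Re (a * v' + b * Cconj v')) with (Re (a + b) * Re v' + Re (Ci * (a - b)) * Im v')%R
    by (destruct a, b, v'; simpl; ring).
  apply (derivable_pt_lim_comp_2d (fun u v => Re (F (u, v))) (fun s => Re (v s)) (fun s => Im (v s))); [exact H| |]; now apply is_derive_Reals.
Qed.

Lemma partial_d (F : C -> C) (z : C) :
  partial_x F z = d_z F z + d_zbar F z /\ partial_y F z = Ci * (d_z F z - d_zbar F z).
Proof.
  assert (H2 : (2 : C) <> 0) by (intros E; injection E; lra).
  unfold d_z, d_zbar. split; [field; auto|].
  transitivity (- (Ci * Ci) * partial_y F z); [|field; auto].
  assert (Hi : Ci * Ci = -(1)) by (unfold Ci, Cmult, Copp, RtoC; simpl; f_equal; ring).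
  rewrite Hi. ring.
Qed.

Definition C1_disk (F : C -> C) : Prop :=
  forall z, disk z -> rdiff F z (d_z F z) (d_zbar F z) /\ cont (d_z F) z /\ cont (d_zbar F) z.

Lemma C1_disk_intro (F a b : C -> C) :
  (forall z, disk z -> rdiff F z (a z) (b z)) ->
  (forall z, disk z -> cont a z /\ cont b z) -> C1_disk F.
Proof.
  intros H Hc z Hz. destruct (rdiff_d _ _ _ _ (H z Hz)) as [E1 E2].
  destruct (Hc z Hz) as [Ca Cb]. destruct (disk_open z Hz) as (d & Hd & Hw).
  rewrite E1, E2. split; [auto|]. split.
  - apply (cont_ext_loc a _ z d Hd); [|exact Ca]. intros w Hlt.
    symmetry. apply (rdiff_d _ _ _ _ (H w (Hw w Hlt))).
  - apply (cont_ext_loc b _ z d Hd); [|exact Cb]. intros w Hlt.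
    symmetry. apply (rdiff_d _ _ _ _ (H w (Hw w Hlt))).
Qed.

Lemma disk_nhds (z : C) : disk z -> locally (Re z, Im z) (fun u : R * R => disk (fst u, snd u)).
Proof.
  intros Hz. assert (O : open disk).
  { apply open_Cmod. exact disk_open. }
  specialize (O z Hz). destruct z as [x y]. destruct O as [d Hd]. exists d. intros [u v] Hu.
  apply Hd. exact Hu.
Qed.

Lemma cont_partial (F : C -> C) (z : C) :
  cont (partial_x F) z -> cont (partial_y F) z -> cont (d_z F) z /\ cont (d_zbar F) z.
Proof.
  intros Hx Hy. unfold d_z, d_zbar, Cdiv. split.
  - apply (cont_mult (fun z => partial_x F z - Ci * partial_y F z) (fun _ => / 2)); [|apply cont_const].
    apply cont_minus; [exact Hx|]. apply (cont_mult (fun _ => Ci)); [apply cont_const|exact Hy].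
  - apply (cont_mult (fun z => partial_x F z + Ci * partial_y F z) (fun _ => / 2)); [|apply cont_const].
    apply cont_plus; [exact Hx|]. apply (cont_mult (fun _ => Ci)); [apply cont_const|exact Hy].
Qed.

(** [class_C 1] only provides partial derivatives. Total differentiability is the classical
    criterion: one partial derivative exists nearby and is continuous at the point, the other exists
    at the point. *)
Lemma class_C_1 (F : C -> C) : class_C 1 F <-> C1_disk F.
Proof.
  split.
  - intros (Hex & Cx & Cy).
    intros z Hz. assert (Hx := proj2 (cont_continuous _ _) (Cx z Hz)). assert (Hy := proj2 (cont_continuous _ _) (Cy z Hz)).
    split; [|now apply cont_partial].
    destruct (partial_d F z) as [Ex Ey].
    apply rdiff_iff. rewrite <- Ex, <- Ey.
    destruct (Hex z Hz) as [_ [ly Ly]]. apply is_derive_C_pair in Ly. destruct Ly as [Ly1 Ly2].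
    assert (Kc : forall pr : C -> R, cont (fun w => RtoC (pr (partial_x F w))) z ->
      continuous (fun u : R * R => pr (partial_x F (fst u, snd u))) (Re z, Im z)).
    { intros pr K. apply cont_continuous in K. replace (Re z, Im z) with z by (now destruct z).
      apply (continuous_comp (U := C_UniformSpace) (V := C_UniformSpace) (W := R_UniformSpace) (fun u : C => RtoC (pr (partial_x F (fst u, snd u)))) (fun c => fst c)).
      - eapply continuous_ext; [|exact K]. intros [u v]. reflexivity.
      - apply (continuous_fst (U := R_UniformSpace) (V := R_UniformSpace)). }
    assert (Kx : locally (Re z, Im z) (fun u : R * R => exists lx : C,
      is_derive (fun x => Re (F (x, snd u))) (fst u) (Re lx) /\ is_derive (fun x => Im (F (x, snd u))) (fst u) (Im lx))).
    { generalize (disk_nhds z Hz). apply filter_imp. intros [u v] Huv.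
      destruct (Hex _ Huv) as [[lx Lx] _]. apply is_derive_C_pair in Lx. now exists lx. }
    split; apply filterdiff_differentiable_pt_lim.
    + apply (is_derive_filterdiff (fun u v => Re (F (u, v))) (Re z) (Im z) (fun u v => Re (partial_x F (u, v))) (Re (partial_y F z))).
      * generalize Kx. apply filter_imp. intros u (lx & L & _). apply Derive_correct. now exists (Re lx).
      * apply Derive_correct. now exists (Re ly).
      * now apply (Kc Re), cont_Re.
    + apply (is_derive_filterdiff (fun u v => Im (F (u, v))) (Re z) (Im z) (fun u v => Im (partial_x F (u, v))) (Im (partial_y F z))).
      * generalize Kx. apply filter_imp. intros u (lx & _ & L). apply Derive_correct. now exists (Im lx).
      * apply Derive_correct. now exists (Im ly).
      * now apply (Kc Im), cont_Im.
  - intros H. split; [|split].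
    + intros z Hz. destruct (H z Hz) as [D _]. destruct (rdiff_partials _ _ _ _ D) as [D1 D2].
      split; eexists; eassumption.
    + intros z Hz. apply cont_continuous. destruct (H z Hz) as [_ [Ca Cb]].
      eapply cont_ext_loc; [apply Rlt_0_1| |apply (cont_plus _ _ _ Ca Cb)].
      intros w _. symmetry. apply partial_d.
    + intros z Hz. apply cont_continuous. destruct (H z Hz) as [_ [Ca Cb]].
      eapply cont_ext_loc; [apply Rlt_0_1| |apply (cont_mult _ _ _ (cont_const Ci z) (cont_minus _ _ _ Ca Cb))].
      intros w _. symmetry. apply partial_d.
Qed.

(** * Harmonic maps and their holomorphic derivatives *)

Lemma Ci_sqr : Ci * Ci = - (1).
Proof. unfold Ci, Cmult, Copp, RtoC; simpl; f_equal; ring. Qed.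

Lemma class_C_pred (k : nat) (F : C -> C) : class_C (S k) F -> class_C k F.
Proof.
  revert F. induction k as [|k IH]; intros F H.
  - intros z Hz. apply cont_continuous. apply class_C_1 in H.
    eapply rdiff_cont. apply (H z Hz).
  - destruct H as (H1 & H2 & H3). split; [exact H1|]. split; now apply IH.
Qed.

Lemma cont_2d (F : C -> C) (u v : R) : cont F (u, v) ->
  continuity_2d_pt (fun x y => Re (F (x, y))) u v /\ continuity_2d_pt (fun x y => Im (F (x, y))) u v.
Proof.
  intros H.
  assert (K : forall eps : posreal, exists del : posreal, forall x y : R,
    (Rabs (x - u) < del -> Rabs (y - v) < del -> Cmod (F (x, y) - F (u, v)) < eps)%R).
  { intros eps. destruct (H eps (cond_pos eps)) as (d & Hd & Hw).
    assert (Hd2 : (0 < d / 2)%R) by lra. exists (mkposreal _ Hd2). simpl. intros x y Hx Hy. apply Hw.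
    eapply Rle_lt_trans; [apply Cmod_le_Re_Im|]. simpl. unfold Rminus in *. lra. }
  split; intros eps; destruct (K eps) as [d Hd]; exists d; intros x y Hx Hy; eapply Rle_lt_trans; [|apply (Hd x y Hx Hy)| |apply (Hd x y Hx Hy)].
  - apply (re_le_Cmod (F (x, y) - F (u, v))).
  - apply (im_le_Cmod (F (x, y) - F (u, v))).
Qed.

Lemma disk_locally_2d (z : C) (P : R -> R -> Prop) : disk z ->
  (forall u v, disk (u, v) -> P u v) -> locally_2d P (Re z) (Im z).
Proof.
  intros Hz HP. destruct (disk_nhds z Hz) as [d Hd]. exists d. intros u v Hu Hv.
  apply HP. apply (Hd (u, v)). split; assumption.
Qed.

Lemma Schwarz_disk (F : C -> C) (z : C) : class_C 2 F -> disk z ->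
  partial_x (partial_y F) z = partial_y (partial_x F) z.
Proof.
  intros (H0 & Hx & Hy) Hz.
  destruct Hx as (Hxe & _ & Hxy). destruct Hy as (Hye & Hyx & _).
  assert (E : forall (g : R -> C) t, ex_derive (V := C_R_NormedModule) g t ->
     ex_derive (fun s => Re (g s)) t /\ ex_derive (fun s => Im (g s)) t).
  { intros g t [l Hl]. apply is_derive_C_pair in Hl. destruct Hl. split; eexists; eassumption. }
  assert (Cxy := proj2 (cont_continuous _ _) (Hxy z Hz)).
  assert (Cyx := proj2 (cont_continuous _ _) (Hyx z Hz)).
  rewrite (surjective_pairing z) in Cxy, Cyx.
  destruct (cont_2d _ _ _ Cxy) as [Cxy1 Cxy2]. destruct (cont_2d _ _ _ Cyx) as [Cyx1 Cyx2].
  apply Ceq_Re_Im;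
    [apply (Schwarz (fun u v => Re (F (u, v))) (Re z) (Im z)); [|exact Cyx1|exact Cxy1]
    |apply (Schwarz (fun u v => Im (F (u, v))) (Re z) (Im z)); [|exact Cyx2|exact Cxy2]];
    (apply disk_locally_2d; [exact Hz|]; intros u v Huv;
    destruct (H0 _ Huv) as [A1 A2]; destruct (Hxe _ Huv) as [_ A3]; destruct (Hye _ Huv) as [A4 _];
    repeat split; [apply (E _ _ A1)|apply (E _ _ A2)|apply (E _ _ A4)|apply (E _ _ A3)]).
Qed.

(** Holomorphy as vanishing of the zbar-derivative. Continuity of the derivative is included, so
    that differentiation under the integral sign is available for Cauchy's formula. *)
Definition hol (R0 : R) (F F' : C -> C) : Prop :=
  forall z, (Cmod z < R0)%R -> rdiff F z (F' z) 0 /\ cont F' z.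

(** The decomposition G = h + conj(g) enters only through its derivatives h' = G_z and g' =
    conj(G_zbar). The Laplace equation gives directly that conj(G_zbar) is holomorphic; for G_z the
    order of differentiation has to be exchanged, by the symmetry of second partials. *)
Lemma harmonic_hol (G : C -> C) : harmonic G ->
  C1_disk G /\ C1_disk (d_z G) /\ C1_disk (d_zbar G) /\
  hol 1 (d_z G) (d_z (d_z G)) /\
  hol 1 (fun z => Cconj (d_zbar G z)) (fun z => Cconj (d_zbar (d_zbar G) z)).
Proof.
  intros [HC HL]. simpl in HC, HL.
  assert (C1 : C1_disk G). { apply class_C_1. now apply class_C_pred. }
  assert (HC' := HC). destruct HC' as (_ & Cx & Cy).
  apply class_C_1 in Cx. apply class_C_1 in Cy.
  assert (D : forall z, disk z -> d_z G z = / 2 * (partial_x G z - Ci * partial_y G z)).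
  { intros z _. unfold d_z, Cdiv. ring. }
  assert (Db : forall z, disk z -> d_zbar G z = / 2 * (partial_x G z + Ci * partial_y G z)).
  { intros z _. unfold d_zbar, Cdiv. ring. }
  set (P := partial_x G) in *. set (Q := partial_y G) in *.
  assert (RD : forall z, disk z -> rdiff (d_z G) z (/ 2 * (d_z P z - Ci * d_z Q z)) (/ 2 * (d_zbar P z - Ci * d_zbar Q z))).
  { intros z Hz. eapply rdiff_ext_disk; [exact Hz|intros w Hw; symmetry; apply (D w Hw)|].
    apply (rdiff_scal (/ 2)). apply rdiff_minus; [apply (Cx z Hz)|]. apply rdiff_scal. apply (Cy z Hz). }
  assert (RDb : forall z, disk z -> rdiff (d_zbar G) z (/ 2 * (d_z P z + Ci * d_z Q z)) (/ 2 * (d_zbar P z + Ci * d_zbar Q z))).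
  { intros z Hz. eapply rdiff_ext_disk; [exact Hz|intros w Hw; symmetry; apply (Db w Hw)|].
    apply (rdiff_scal (/ 2)). apply rdiff_plus; [apply (Cx z Hz)|]. apply rdiff_scal. apply (Cy z Hz). }
  assert (CD : C1_disk (d_z G)).
  { eapply C1_disk_intro; [exact RD|]. intros z Hz. destruct (Cx z Hz) as (_ & ? & ?). destruct (Cy z Hz) as (_ & ? & ?).
    split; (apply (cont_mult (fun _ => / 2)); [apply cont_const|]); apply cont_minus; auto;
      (apply (cont_mult (fun _ => Ci)); [apply cont_const|auto]). }
  assert (CDb : C1_disk (d_zbar G)).
  { eapply C1_disk_intro; [exact RDb|]. intros z Hz. destruct (Cx z Hz) as (_ & ? & ?). destruct (Cy z Hz) as (_ & ? & ?).
    split; (apply (cont_mult (fun _ => / 2)); [apply cont_const|]); apply cont_plus; auto;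
      (apply (cont_mult (fun _ => Ci)); [apply cont_const|auto]). }
  assert (L : forall z, disk z -> d_z (d_zbar G) z = 0).
  { intros z Hz. specialize (HL z Hz). unfold laplacian in HL.
    replace (d_z (d_zbar G) z) with (/ 4 * (4 * d_z (d_zbar G) z)).
    - rewrite HL. ring.
    - field. }
  assert (Lb : forall z, disk z -> d_zbar (d_z G) z = 0).
  { intros z Hz. rewrite <- (L z Hz).
    rewrite (proj2 (rdiff_d _ _ _ _ (RD z Hz))), (proj1 (rdiff_d _ _ _ _ (RDb z Hz))).
    f_equal.
    assert (S := Schwarz_disk G z HC Hz). fold P Q in S.
    destruct (partial_d P z) as [_ E1]. destruct (partial_d Q z) as [E2 _].
    rewrite E1, E2 in S.
    assert (S' : Ci * (d_z Q z + d_zbar Q z) = - (d_z P z - d_zbar P z)).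
    { rewrite S, Cmult_assoc, Ci_sqr. ring. }
    replace (d_z P z + Ci * d_z Q z) with (d_z P z + (Ci * (d_z Q z + d_zbar Q z) - Ci * d_zbar Q z)) by ring.
    rewrite S'. ring. }
  split; [exact C1|split; [exact CD|split; [exact CDb|split; intros z H; split]]].
  - eapply rdiff_val; [reflexivity|apply (Lb z H)|apply (CD z H)].
  - apply (CD z H).
  - eapply rdiff_val; [reflexivity| |apply rdiff_conj; apply (CDb z H)].
    rewrite (L z H). apply Ceq_Re_Im; simpl; ring.
  - apply cont_conj. apply (CDb z H).
Qed.

(** * The radial factor *)

Definition radial (p : nat) (lambda : nat -> C) (z : C) : C :=
  sum_n_m (fun k : nat => lambda k * RtoC (Cmod z ^ (2 * (k - 1)))%R) 1 p.

Lemma rdiff_sqmod (z : C) : rdiff (fun w => RtoC (Cmod w ^ 2)%R) z (Cconj z) z.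
Proof.
  eapply (rdiff_ext_loc (fun w => w * Cconj w) _ z _ _ 1 Rlt_0_1).
  - intros w _. symmetry. apply Cmod2_conj.
  - eapply rdiff_val; [| |apply (rdiff_mult _ _ _ _ _ _ _ (rdiff_id z) (rdiff_conj _ _ _ _ (rdiff_id z)))];
    apply Ceq_Re_Im; unfold Re, Im; simpl; ring.
Qed.

Lemma radial_S (p : nat) (lambda : nat -> C) (z : C) :
  radial (S p) lambda z = radial p lambda z + lambda (S p) * RtoC (Cmod z ^ 2)%R ^ p.
Proof.
  unfold radial. rewrite sum_n_Sm by lia.
  change plus with Cplus. f_equal. f_equal. replace (S p - 1)%nat with p by lia.
  now rewrite pow_mult, RtoC_pow.
Qed.

(** [radial] is a function of [z * Cconj z], so its two Wirtinger derivatives are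
    proportional to [Cconj z] and [z] with the same factor and [Dop] kills it. *)
Lemma rdiff_radial (p : nat) (lambda : nat -> C) : exists s : C -> C,
  forall z, rdiff (radial p lambda) z (s z * Cconj z) (s z * z) /\ cont s z.
Proof.
  induction p as [|p [s IH]].
  - exists (fun _ => 0). intros z. split; [|apply cont_const].
    eapply (rdiff_ext_loc (fun _ => 0) _ z _ _ 1 Rlt_0_1).
    + intros w _. unfold radial. now rewrite sum_n_m_zero by lia.
    + eapply rdiff_val; [| |apply rdiff_const]; ring.
  - assert (P : forall n, exists t : C -> C, forall z,
      rdiff (fun w => RtoC (Cmod w ^ 2)%R ^ n) z (t z * Cconj z) (t z * z) /\ cont t z).
    { induction n as [|n [t IHn]].
      - exists (fun _ => 0). intros z. split; [|apply cont_const].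
        eapply rdiff_val; [| |exact (rdiff_const 1 z)]; ring.
      - exists (fun z => RtoC (Cmod z ^ 2) ^ n + RtoC (Cmod z ^ 2) * t z). intros z.
        destruct (IHn z) as [IH1 IH2]. assert (Cz := rdiff_cont _ _ _ _ (rdiff_sqmod z)). split.
        + eapply rdiff_val; [| |apply (rdiff_mult _ _ _ _ _ _ _ (rdiff_sqmod z) IH1)]; ring.
        + apply cont_plus; [now apply cont_pow|now apply cont_mult]. }
    destruct (P p) as [t Ht]. exists (fun z => s z + lambda (S p) * t z). intros z.
    destruct (IH z) as [IH1 IH2]. destruct (Ht z) as [Ht1 Ht2]. split.
    + eapply (rdiff_ext_loc _ _ z _ _ 1 Rlt_0_1).
      * intros w _. symmetry. apply radial_S.
      * eapply rdiff_val; [| |apply rdiff_plus; [exact IH1|apply rdiff_scal; exact Ht1]]; ring.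
    + apply cont_plus; [exact IH2|]. apply cont_mult; [apply cont_const|exact Ht2].
Qed.

Lemma cont_radial (p : nat) (lambda : nat -> C) (z : C) : cont (radial p lambda) z.
Proof. destruct (rdiff_radial p lambda) as [s Hs]. eapply rdiff_cont; apply (Hs z). Qed.

Lemma radial_Cmod (p : nat) (lambda : nat -> C) (z w : C) :
  Cmod z = Cmod w -> radial p lambda z = radial p lambda w.
Proof. intros H. unfold radial. now rewrite H. Qed.

Lemma Dop_rdiff (F : C -> C) (z a b : C) : rdiff F z a b -> Dop F z = z * a - Cconj z * b.
Proof. intros H. destruct (rdiff_d _ _ _ _ H) as [E1 E2]. unfold Dop. now rewrite E1, E2. Qed.

Lemma Dop_radial_mult (p : nat) (lambda : nat -> C) (f G : C -> C) (z : C) : disk z ->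
  (forall w, disk w -> f w = G w * radial p lambda w) ->
  rdiff G z (d_z G z) (d_zbar G z) -> Dop f z = Dop G z * radial p lambda z.
Proof.
  intros Hz He HG. destruct (rdiff_radial p lambda) as [s Hs0]. destruct (Hs0 z) as [Hs _].
  erewrite (Dop_rdiff f z).
  2:{ eapply rdiff_ext_disk; [exact Hz| |apply (rdiff_mult _ _ _ _ _ _ _ HG Hs)].
      intros w Hw. symmetry. now apply He. }
  unfold Dop. ring.
Qed.

Lemma C1_Dop (F : C -> C) : C1_disk (d_z F) -> C1_disk (d_zbar F) -> C1_disk (Dop F).
Proof.
  intros H1 H2.
  eapply C1_disk_intro.
  - intros z Hz. apply rdiff_minus; apply rdiff_mult.
    + apply rdiff_id.
    + apply (H1 z Hz).
    + apply rdiff_conj, rdiff_id.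
    + apply (H2 z Hz).
  - intros z Hz. destruct (H1 z Hz) as (A & A1 & A2). destruct (H2 z Hz) as (B & B1 & B2).
    assert (Z := cont_id z). assert (Zb := cont_conj _ _ Z).
    apply rdiff_cont in A. apply rdiff_cont in B.
    split; apply cont_minus; apply cont_plus; apply cont_mult; auto; apply cont_const.
Qed.

Lemma C1_radial_mult (p : nat) (lambda : nat -> C) (f G : C -> C) :
  (forall w, disk w -> f w = G w * radial p lambda w) -> C1_disk G -> C1_disk f.
Proof.
  intros He HG. destruct (rdiff_radial p lambda) as [s Hs].
  eapply C1_disk_intro.
  - intros z Hz. eapply rdiff_ext_disk; [exact Hz|intros w Hw; symmetry; apply (He w Hw)|].
    apply rdiff_mult; [apply (HG z Hz)|apply (Hs z)].
  - intros z Hz. destruct (HG z Hz) as (A & A1 & A2). destruct (Hs z) as [_ B].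
    assert (Z := cont_id z). assert (Zb := cont_conj _ _ Z). assert (S := cont_radial p lambda z).
    apply rdiff_cont in A.
    split; apply cont_plus; apply cont_mult; auto; apply cont_mult; auto.
Qed.

(** * Compactness *)

Definition box (a b a' b' : R) (z : C) : Prop := (a <= Re z <= b)%R /\ (a' <= Im z <= b')%R.

(** Lebesgue number argument: a property that improves as [d] decreases and holds with a common [d]
    near every point of the box holds with one [d] on the whole box. *)
Lemma compact_unif (a b a' b' : R) (P : C -> R -> Prop) :
  (forall z d d', (0 < d' <= d)%R -> P z d -> P z d') ->
  (forall z, box a b a' b' z -> exists d : R, (0 < d)%R /\
     forall w, box a b a' b' w -> (Cmod (w - z) < d)%R -> P w d) ->
  exists d : R, (0 < d)%R /\ forall z, box a b a' b' z -> P z d.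
Proof.
  intros Hanti Hloc.
  (* A tolerance is chosen at every point. The factor 2 accounts for the square neighbourhoods of
     [compactness_value_2d]: a square of half-side [d] lies in the disc of radius [2 * d]. *)
  assert (S : forall u v : R, exists d : posreal, box a b a' b' (u, v) ->
     forall w, box a b a' b' w -> (Cmod (w - (u, v)) < 2 * d)%R -> P w d).
  { intros u v. destruct (classic (box a b a' b' (u, v))) as [Hb|Hb].
    - destruct (Hloc _ Hb) as (d & Hd & Hw). assert (Hd2 : (0 < d / 2)%R) by lra.
      exists (mkposreal _ Hd2). simpl. intros _ w Hw1 Hw2. apply (Hanti w d); [lra|].
      apply Hw; [exact Hw1|lra].
    - exists (mkposreal 1 Rlt_0_1). intros H; contradiction. }
  destruct (compactness_value_2d a b a' b' (fun u v => proj1_sig (constructive_indefinite_description _ (S u v)))) as [d Hd].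
  exists d. split; [apply cond_pos|]. intros z [Hz1 Hz2]. apply NNPP. intros HN.
  apply (Hd _ _ Hz1 Hz2). intros (u & v & Hu & Hv & H1 & H2 & H3). apply HN.
  destruct (constructive_indefinite_description _ (S u v)) as [e He]. simpl in *.
  apply (Hanti z e); [split; [apply cond_pos|exact H3]|].
  apply He; [split; assumption|split; assumption|].
  eapply Rle_lt_trans; [apply Cmod_le_Re_Im|].
  change (Re (z - (u, v))) with (Re z - u)%R. change (Im (z - (u, v))) with (Im z - v)%R. lra.
Qed.

Lemma disc_box (z0 z : C) (r : R) : (Cmod (z - z0) <= r)%R ->
  box (Re z0 - r) (Re z0 + r) (Im z0 - r) (Im z0 + r) z.
Proof.
  intros H. assert (H1 := re_le_Cmod (z - z0)). assert (H2 := im_le_Cmod (z - z0)).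
  change (Re (z - z0)) with (Re z - Re z0)%R in H1. change (Im (z - z0)) with (Im z - Im z0)%R in H2.
  assert (H3 := Rle_trans _ _ _ H1 H). assert (H4 := Rle_trans _ _ _ H2 H).
  apply Rabs_le_between in H3. apply Rabs_le_between in H4. split; lra.
Qed.

(** [A] restricts the points where the property is wanted, while the local hypothesis is asked at
    every centre of the closed disc; this allows sets [A] that are not closed. *)
Lemma disc_unif (z0 : C) (r : R) (A : C -> Prop) (P : C -> R -> Prop) :
  (forall z d d', (0 < d' <= d)%R -> P z d -> P z d') ->
  (forall z, (Cmod (z - z0) <= r)%R -> exists d : R, (0 < d)%R /\
     forall w, A w -> (Cmod (w - z0) <= r)%R -> (Cmod (w - z) < d)%R -> P w d) ->
  exists d : R, (0 < d)%R /\ forall z, A z -> (Cmod (z - z0) <= r)%R -> P z d.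
Proof.
  intros Hanti Hloc.
  destruct (compact_unif (Re z0 - r) (Re z0 + r) (Im z0 - r) (Im z0 + r)
    (fun z d => A z -> (Cmod (z - z0) <= r)%R -> P z d)) as (d & Hd & H).
  - intros z d d' Hd H H1 H2. eapply Hanti; eauto.
  - intros z _. destruct (Rle_lt_dec (Cmod (z - z0)) r) as [Hz|Hz].
    + destruct (Hloc z Hz) as (d & Hd & H). exists d. split; auto.
    + exists (Cmod (z - z0) - r)%R. split; [lra|]. intros w _ Hw _ Hw2. exfalso.
      assert (T := Cmod_triangle (z - w) (w - z0)). rewrite (Cmod_minus_sym z w) in T.
      replace (z - w + (w - z0)) with (z - z0) in T by ring. lra.
  - exists d. split; [exact Hd|]. intros z Hz1 Hz2. apply H; [now apply disc_box|exact Hz1|exact Hz2].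
Qed.

(** Zeros of [F] are allowed as long as they keep a distance from [A]; compactness then yields the
    positive minimum. *)
Lemma disc_pos_lower (F : C -> C) (z0 : C) (r : R) (A : C -> Prop) :
  (forall z, (Cmod (z - z0) <= r)%R -> cont F z) ->
  (forall z, (Cmod (z - z0) <= r)%R -> F z = 0 ->
     exists d : R, (0 < d)%R /\ forall w, (Cmod (w - z) < d)%R -> ~ A w) ->
  exists m : R, (0 < m)%R /\ forall z, A z -> (Cmod (z - z0) <= r)%R -> (m <= Cmod (F z))%R.
Proof.
  intros Hc H0. apply (disc_unif z0 r A (fun z d => (d <= Cmod (F z))%R)).
  - intros; lra.
  - intros z Hz. destruct (classic (F z = 0)) as [E|E].
    + destruct (H0 z Hz E) as (d & Hd & HA). exists d. split; [exact Hd|]. intros w Hw _ Hwd. now destruct (HA w Hwd).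
    + apply Cmod_gt_0 in E. destruct (Hc z Hz (Cmod (F z) / 2)%R ltac:(lra)) as (d & Hd & Hw).
      exists (Rmin d (Cmod (F z) / 2)). split; [apply Rmin_pos; lra|]. intros w _ _ Hlt.
      specialize (Hw w (Rlt_min_l Hlt)).
      assert (T := Cmod_triangle_sub (F z) (F w)). rewrite Cmod_minus_sym in T.
      assert (T2 := Rmin_r d (Cmod (F z) / 2)). lra.
Qed.

Lemma disc_bounded (F : C -> C) (z0 : C) (r : R) :
  (forall z, (Cmod (z - z0) <= r)%R -> cont F z) ->
  exists M : R, (0 < M)%R /\ forall z, (Cmod (z - z0) <= r)%R -> (Cmod (F z) <= M)%R.
Proof.
  intros Hc.
  destruct (disc_unif z0 r (fun _ => True) (fun z d => (Cmod (F z) <= / d)%R)) as (d & Hd & H).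
  - intros z d d' Hd H. eapply Rle_trans; [exact H|]. apply Rinv_le_contravar; lra.
  - intros z Hz. destruct (cont_bounded F z (Hc z Hz)) as (d & Hd & Hw).
    assert (Hp : (0 < Cmod (F z) + 1)%R) by (assert (T := Cmod_ge_0 (F z)); lra).
    exists (Rmin d (/ (Cmod (F z) + 1))). split; [apply Rmin_pos; [lra|now apply Rinv_0_lt_compat]|].
    intros w _ _ Hlt. eapply Rle_trans; [apply (Hw w (Rlt_min_l Hlt))|].
    rewrite <- (Rinv_inv (Cmod (F z) + 1)) at 1. apply Rinv_le_contravar; [|apply Rmin_r].
    apply Rmin_pos; [lra|now apply Rinv_0_lt_compat].
  - exists (/ d)%R. split; [now apply Rinv_0_lt_compat|]. auto.
Qed.

(** If the supremum were not attained, each point would keep a positive gap to it on a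
    neighbourhood, and compactness would make the gap uniform. *)
Lemma disc_max (q : C -> R) (z0 : C) (r : R) : (0 <= r)%R ->
  (forall z, (Cmod (z - z0) <= r)%R -> cont (fun w => RtoC (q w)) z) ->
  exists z1, (Cmod (z1 - z0) <= r)%R /\ forall z, (Cmod (z - z0) <= r)%R -> (q z <= q z1)%R.
Proof.
  intros Hr Hc.
  set (E := fun x : R => exists z, (Cmod (z - z0) <= r)%R /\ x = q z).
  destruct (completeness E) as [M [HM1 HM2]].
  - destruct (disc_bounded _ z0 r Hc) as (M & _ & HM). exists M. intros x (z & Hz & ->).
    specialize (HM z Hz). rewrite Cmod_R in HM. eapply Rle_trans; [apply Rle_abs|exact HM].
  - exists (q z0), z0. split; [|reflexivity]. replace (z0 - z0) with (RtoC 0) by ring. now rewrite Cmod_0.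
  - apply NNPP. intros HN.
    assert (HL : forall z, (Cmod (z - z0) <= r)%R -> (q z < M)%R).
    { intros z Hz. assert (Hle : (q z <= M)%R) by (apply HM1; now exists z).
      destruct (Rle_lt_or_eq_dec _ _ Hle) as [H|H]; [exact H|].
      exfalso. apply HN. exists z. split; [exact Hz|]. intros w Hw. rewrite H. apply HM1. now exists w. }
    destruct (disc_unif z0 r (fun _ => True) (fun z d => (q z <= M - d)%R)) as (d & Hd & H).
    + intros; lra.
    + intros z Hz. specialize (HL z Hz). destruct (Hc z Hz ((M - q z) / 2)%R ltac:(lra)) as (d & Hd & Hw).
      exists (Rmin d ((M - q z) / 2)). split; [apply Rmin_pos; lra|]. intros w _ _ Hlt.
      specialize (Hw w (Rlt_min_l Hlt)). rewrite <- RtoC_minus, Cmod_R in Hw.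
      apply Rabs_lt_between in Hw. assert (T := Rmin_r d ((M - q z) / 2)). lra.
    + assert (M <= M - d)%R; [|lra]. apply HM2. intros x (z & Hz & ->). now apply H.
Qed.

(** * Loops with a continuous logarithm *)

Definition cis (t : R) : C := (cos t, sin t).

Lemma Cmod_cis (t : R) : Cmod (cis t) = 1%R.
Proof.
  unfold cis, Cmod; simpl. transitivity (sqrt 1); [|apply sqrt_1]. f_equal.
  assert (H := sin2_cos2 t). unfold Rsqr in H. lra.
Qed.

Lemma cis_neq_0 (t : R) : cis t <> 0.
Proof. apply Cmod_gt_0. rewrite Cmod_cis. lra. Qed.

Lemma cis_plus (s t : R) : cis (s + t) = cis s * cis t.
Proof. unfold cis, Cmult; simpl. rewrite cos_plus, sin_plus. f_equal; ring. Qed.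

Lemma cis_2PI (t : R) : cis (t + 2 * PI) = cis t.
Proof. rewrite cis_plus. unfold cis at 2. rewrite cos_2PI, sin_2PI. unfold cis, Cmult; simpl. f_equal; ring. Qed.

Lemma cis_PI (t : R) : cis (t + PI) = - cis t.
Proof. rewrite cis_plus. unfold cis at 2. rewrite cos_PI, sin_PI. unfold cis, Cmult, Copp; simpl. f_equal; ring. Qed.

Definition loop (g : R -> C) : Prop :=
  (forall t, continuity_pt (fun s => Re (g s)) t /\ continuity_pt (fun s => Im (g s)) t) /\
  forall t, g (t + 2 * PI)%R = g t.

(** Stands for winding number 0 about the origin: the direction of [g] has an angle that is
    continuous and returns to its value after one period. The constant [u] absorbs a fixed rotation,
    so no initial angle has to be computed. *)
Definition has_log (g : R -> C) : Prop :=
  exists (u : C) (theta : R -> R), continuity theta /\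
    (forall t, theta (t + 2 * PI)%R = theta t) /\
    forall t, g t = u * RtoC (Cmod (g t)) * cis (theta t).

Lemma cis_atan (z : C) : (0 < Re z)%R -> z = RtoC (Cmod z) * cis (atan (Im z / Re z)).
Proof.
  destruct z as [x y]. simpl. intros Hx. unfold cis. rewrite cos_atan, sin_atan.
  assert (HC : Cmod (x, y) = (x * sqrt (1 + (y / x)²))%R).
  { unfold Cmod. simpl. rewrite <- (sqrt_square x) at 3 by lra. rewrite <- sqrt_mult_alt by nra.
    f_equal. unfold Rsqr. field. lra. }
  rewrite HC.
  assert (Hs : (0 < sqrt (1 + (y / x)²))%R) by (apply sqrt_lt_R0; assert (T := Rle_0_sqr (y / x)); lra).
  unfold RtoC, Cmult; simpl. f_equal; field; lra.
Qed.

Lemma continuity_pt_const_fun (c t : R) : continuity_pt (fun _ => c) t.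
Proof. apply continuity_pt_const. intros x y. reflexivity. Qed.

(** Rouché's argument: h / g stays in the right half-plane, where the arctangent is a continuous
    angle, and this angle is added to that of [g]. The product [h * Cconj g] has the same direction
    as the quotient and avoids the division. *)
Lemma has_log_close (g h : R -> C) : loop g -> loop h ->
  (forall t, (Cmod (h t - g t) < Cmod (g t))%R) -> has_log g -> has_log h.
Proof.
  intros [Cg Pg] [Ch Ph] Hlt (u & theta & Ct & Pt & Eg).
  set (q := fun t => h t * Cconj (g t)).
  assert (Hq : forall t, (0 < Re (q t))%R).
  { intros t. assert (H1 := Hlt t).
    assert (H2 : (Cmod (h t - g t) ^ 2 < Cmod (g t) ^ 2)%R).
    { assert (T := Cmod_ge_0 (h t - g t)). nra. }
    rewrite !Cmod2_alt in H2. unfold q. destruct (h t) as [a b]. destruct (g t) as [c d]. simpl in *. nra. }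
  exists u, (fun t => theta t + atan (Im (q t) / Re (q t)))%R.
  assert (Cq : forall t, continuity_pt (fun s => Re (q s)) t /\ continuity_pt (fun s => Im (q s)) t).
  { intros t. destruct (Cg t) as [G1 G2]. destruct (Ch t) as [H1 H2]. unfold q. simpl.
    split.
    - apply (continuity_pt_minus (fun s => fst (h s) * fst (g s))%R (fun s => snd (h s) * - snd (g s))%R).
      + now apply (continuity_pt_mult (fun s => Re (h s)) (fun s => Re (g s))).
      + apply (continuity_pt_mult (fun s => Im (h s)) (fun s => - Im (g s))%R); [exact H2|]. now apply (continuity_pt_opp (fun s => Im (g s))).
    - apply (continuity_pt_plus (fun s => fst (h s) * - snd (g s))%R (fun s => snd (h s) * fst (g s))%R).
      + apply (continuity_pt_mult (fun s => Re (h s)) (fun s => - Im (g s))%R); [exact H1|]. now apply (continuity_pt_opp (fun s => Im (g s))).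
      + now apply (continuity_pt_mult (fun s => Im (h s)) (fun s => Re (g s))). }
  split; [|split].
  - intros t. apply (continuity_pt_plus theta (fun t => atan (Im (q t) / Re (q t)))); [apply Ct|].
    apply (continuity_pt_comp (fun t => Im (q t) / Re (q t))%R atan).
    + apply (continuity_pt_div (fun t => Im (q t)) (fun t => Re (q t))); try apply Cq. specialize (Hq t). lra.
    + apply derivable_continuous_pt. apply derivable_pt_atan.
  - intros t. unfold q. now rewrite Pt, Pg, Ph.
  - intros t. rewrite cis_plus. assert (E := cis_atan (q t) (Hq t)).
    assert (Hg0 : (0 < Cmod (g t))%R) by (specialize (Hlt t); assert (T := Cmod_ge_0 (h t - g t)); lra).
    assert (HgC : RtoC (Cmod (g t)) <> 0) by (intros E0; injection E0; lra).
    assert (E2 : q t * g t = h t * RtoC (Cmod (g t)) * RtoC (Cmod (g t))).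
    { unfold q. replace (h t * Cconj (g t) * g t) with (h t * (g t * Cconj (g t))) by ring.
      rewrite <- Cmod2_conj. rewrite RtoC_pow. ring. }
    apply (f_equal (fun x => x * g t)) in E. rewrite E2 in E.
    assert (E3 : Cmod (q t) = (Cmod (h t) * Cmod (g t))%R) by (unfold q; now rewrite Cmod_mult, Cmod_conj).
    rewrite E3, RtoC_mult in E. rewrite (Eg t) in E at 4.
    assert (E4 : h t * (RtoC (Cmod (g t)) * RtoC (Cmod (g t))) =
      (u * Cmod (h t) * (cis (theta t) * cis (atan (Im (q t) / Re (q t))))) * (RtoC (Cmod (g t)) * RtoC (Cmod (g t)))).
    { rewrite Cmult_assoc, E. ring. }
    assert (H0 : RtoC (Cmod (g t)) * RtoC (Cmod (g t)) <> 0) by now apply Cmult_neq_0.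
    transitivity (h t * (RtoC (Cmod (g t)) * RtoC (Cmod (g t))) / (RtoC (Cmod (g t)) * RtoC (Cmod (g t)))); [field; auto|].
    rewrite E4. field. auto.
Qed.

Lemma periodic_ind (P : R -> Prop) :
  (forall t, P t <-> P (t + 2 * PI)%R) -> (forall t, (0 <= t <= 2 * PI)%R -> P t) -> forall t, P t.
Proof.
  intros Hp H0 t.
  assert (HN : forall n t, P t <-> P (t + INR n * (2 * PI))%R).
  { induction n as [|n IH]; intros s.
    - simpl. now replace (s + 0 * (2 * PI))%R with s by ring.
    - rewrite S_INR. rewrite (IH s). replace (s + (INR n + 1) * (2 * PI))%R with (s + INR n * (2 * PI) + 2 * PI)%R by ring. apply Hp. }
  assert (Hpi := PI_RGT_0).
  destruct (archimed (t / (2 * PI))) as [A1 A2]. set (k := up (t / (2 * PI))) in *.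
  assert (Ht : (0 <= t - (IZR k - 1) * (2 * PI) <= 2 * PI)%R).
  { assert (E : (t = t / (2 * PI) * (2 * PI))%R) by (field; lra). set (x := (t / (2 * PI))%R) in *. split; nra. }
  specialize (H0 _ Ht).
  destruct (Z.le_gt_cases 0 (k - 1)) as [Hk|Hk].
  - rewrite (HN (Z.to_nat (k - 1)) (t - (IZR k - 1) * (2 * PI))%R) in H0.
    rewrite INR_IZR_INZ, Z2Nat.id, minus_IZR in H0 by lia.
    now replace (t - (IZR k - 1) * (2 * PI) + (IZR k - 1) * (2 * PI))%R with t in H0 by ring.
  - rewrite (HN (Z.to_nat (1 - k)) t).
    rewrite INR_IZR_INZ, Z2Nat.id, minus_IZR by lia.
    now replace (t + (1 - IZR k) * (2 * PI))%R with (t - (IZR k - 1) * (2 * PI))%R by ring.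
Qed.

Lemma cont_curve (F : C -> C) (x y : R -> R) (t : R) :
  cont F (x t, y t) -> continuity_pt x t -> continuity_pt y t ->
  continuity_pt (fun s => Re (F (x s, y s))) t /\ continuity_pt (fun s => Im (F (x s, y s))) t.
Proof.
  intros HF Hx Hy.
  assert (K : forall eps, (0 < eps)%R -> exists d, (0 < d)%R /\ forall s, (Rabs (s - t) < d -> Cmod (F (x s, y s) - F (x t, y t)) < eps)%R).
  { intros eps Heps. destruct (HF eps Heps) as (d & Hd & Hw).
    destruct (Hx (d / 2)%R ltac:(lra)) as (d1 & Hd1 & H1). destruct (Hy (d / 2)%R ltac:(lra)) as (d2 & Hd2 & H2).
    exists (Rmin d1 d2). split; [now apply Rmin_pos|]. intros s Hs. apply Hw.
    assert (K1 : (Rabs (x s - x t) < d / 2)%R).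
    { destruct (Req_dec t s) as [->|Hn]; [rewrite Rminus_diag, Rabs_R0; lra|].
      apply H1. split; [now repeat split|]. eapply Rlt_le_trans; [exact Hs|apply Rmin_l]. }
    assert (K2 : (Rabs (y s - y t) < d / 2)%R).
    { destruct (Req_dec t s) as [->|Hn]; [rewrite Rminus_diag, Rabs_R0; lra|].
      apply H2. split; [now repeat split|]. eapply Rlt_le_trans; [exact Hs|apply Rmin_r]. }
    eapply Rle_lt_trans; [apply Cmod_le_Re_Im|]. simpl. unfold Rminus in *. lra. }
  split; intros eps Heps; destruct (K eps Heps) as (d & Hd & H); exists d; split; auto;
    intros s [_ Hs]; (eapply Rle_lt_trans; [|apply (H s Hs)]).
  - apply (re_le_Cmod (F (x s, y s) - F (x t, y t))).
  - apply (im_le_Cmod (F (x s, y s) - F (x t, y t))).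
Qed.

(** The homotopy parameter and the angle are packed into one complex number, so that compactness of
    a box applies. It cuts [0, 1] into finitely many steps, each short enough for
    [has_log_close]. *)
Lemma has_log_homotopy (H : C -> C) :
  (forall s t : R, (0 <= s <= 1)%R -> cont H (s, t)) ->
  (forall s t : R, (0 <= s <= 1)%R -> H (s, t) <> 0) ->
  (forall s t : R, H (s, (t + 2 * PI)%R) = H (s, t)) ->
  has_log (fun t => H (0%R, t)) -> has_log (fun t => H (1%R, t)).
Proof.
  intros Hc H0 Hp HL.
  assert (U : exists d : R, (0 < d)%R /\ forall z, box 0 1 0 (2 * PI) z ->
    forall w, (0 <= Re w <= 1)%R -> (Cmod (w - z) < d)%R -> (Cmod (H w - H z) < Cmod (H z))%R).
  { apply compact_unif.
    - intros z d d' Hd K w Hw Hlt. apply K; [exact Hw|lra].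
    - intros z [Hz1 Hz2]. destruct z as [s t]. simpl in *.
      assert (Hm := proj1 (Cmod_gt_0 _) (H0 s t Hz1)). set (m := Cmod (H (s, t))) in *.
      (* When all values lie within m / 3 of [H (s, t)], two of them differ by less than 2 m / 3,
         and every modulus exceeds 2 m / 3. *)
      destruct (Hc s t Hz1 (m / 3)%R ltac:(lra)) as (d & Hd & Hw).
      exists (d / 2)%R. split; [lra|]. intros w _ Hw1 v _ Hv.
      assert (K1 := Hw w ltac:(lra)).
      assert (K2 : (Cmod (H v - H (s, t)) < m / 3)%R).
      { apply Hw. replace (v - (s, t)) with ((v - w) + (w - (s, t))) by ring.
        eapply Rle_lt_trans; [apply Cmod_triangle|lra]. }
      assert (T1 := Cmod_triangle_sub (H (s, t)) (H w)). fold m in T1. rewrite (Cmod_minus_sym (H (s, t))) in T1.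
      replace (H v - H w) with ((H v - H (s, t)) - (H w - H (s, t))) by ring.
      eapply Rle_lt_trans; [apply Cmod_minus_le|]. lra. }
  destruct U as (d & Hd & U).
  assert (V : forall s s' : R, (0 <= s <= 1)%R -> (0 <= s' <= 1)%R -> (Rabs (s' - s) < d)%R -> forall t,
    (Cmod (H (s', t) - H (s, t)) < Cmod (H (s, t)))%R).
  { intros s s' Hs Hs' Hd'. apply periodic_ind.
    - intros t. now rewrite !Hp.
    - intros t Ht. apply U; [split; simpl; lra|simpl; lra|].
      eapply Rle_lt_trans; [apply Cmod_le_Re_Im|]. simpl.
      replace (t + - t)%R with 0%R by ring. rewrite Rabs_R0. unfold Rminus in Hd'. lra. }
  assert (LP : forall s, (0 <= s <= 1)%R -> loop (fun t => H (s, t))).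
  { intros s Hs. split; [|intros t; apply Hp]. intros t.
    apply (cont_curve H (fun _ => s) (fun t => t)); [now apply Hc| |].
    - apply continuity_pt_const_fun.
    - apply derivable_continuous_pt, derivable_pt_id. }
  destruct (nfloor_ex (/ d)) as [n Hn]. { left. now apply Rinv_0_lt_compat. }
  assert (HN0 : (0 < INR (S n))%R) by (apply lt_0_INR; lia).
  assert (HN : (/ INR (S n) < d)%R).
  { rewrite S_INR in *. rewrite <- (Rinv_inv d). apply Rinv_lt_contravar; [|lra].
    apply Rmult_lt_0_compat; [now apply Rinv_0_lt_compat|lra]. }
  assert (K : forall k, (k <= S n)%nat -> has_log (fun t => H ((INR k / INR (S n))%R, t))).
  { assert (B : forall k, (k <= S n)%nat -> (0 <= INR k / INR (S n) <= 1)%R).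
    { intros k Hk. apply le_INR in Hk. split.
      - apply Rdiv_le_0_compat; [apply pos_INR|exact HN0].
      - apply Rle_div_l; lra. }
    induction k as [|k IH]; intros Hk.
    - replace (INR 0 / INR (S n))%R with 0%R by (simpl INR at 1; field; lra). exact HL.
    - refine (has_log_close _ _ (LP _ (B k ltac:(lia))) (LP _ (B (S k) Hk)) _ (IH ltac:(lia))).
      apply V; [apply B; lia|apply B; lia|].
      replace (INR (S k) / INR (S n) - INR k / INR (S n))%R with (/ INR (S n))%R
        by (rewrite (S_INR k); field; lra).
      rewrite Rabs_pos_eq; [exact HN|left; now apply Rinv_0_lt_compat]. }
  specialize (K (S n) (le_n _)). now replace (INR (S n) / INR (S n))%R with 1%R in K by (field; lra).
Qed.

(** By periodicity theta (t + PI) - theta t takes opposite values at 0 and PI, so it vanishes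
    somewhere. There the loop has the same direction at [t] and [t + PI], although oddness makes
    these directions opposite. *)
Lemma odd_no_log (g : R -> C) : (forall t, g t <> 0) -> (forall t, g (t + PI)%R = - g t) -> ~ has_log g.
Proof.
  intros H0 Ho (u & theta & Ct & Pt & E).
  destruct (IVT_gen (fun t => theta (t + PI) - theta t)%R 0 PI 0) as (t & _ & Ht).
  - intros t. apply (continuity_pt_minus (fun t => theta (t + PI)%R) theta); [|apply Ct].
    apply (continuity_pt_comp (fun t => t + PI)%R theta); [|apply Ct].
    apply derivable_continuous_pt. reg.
  - replace (PI + PI)%R with (0 + 2 * PI)%R by ring. rewrite Pt, Rplus_0_l.
    set (x := theta PI). set (y := theta 0%R). unfold Rmin, Rmax. destruct (Rle_dec (x - y) (y - x)); lra.
  - assert (E1 := E (t + PI)%R). rewrite Ho in E1. rewrite Cmod_opp in E1.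
    replace (theta (t + PI)%R) with (theta t) in E1 by lra. rewrite <- E in E1.
    apply (H0 t). assert (E2 : 2 * g t = 0) by (replace (2 * g t) with (g t - - g t) by ring; rewrite E1; ring).
    replace (g t) with (/ 2 * (2 * g t)) by (field; intros E3; injection E3; lra). rewrite E2. ring.
Qed.

Lemma cont_cis (z : C) : cont (fun w => cis (Im w)) z.
Proof.
  intros eps Heps.
  destruct (continuity_cos (Im z) (eps / 2)%R ltac:(lra)) as (d1 & Hd1 & H1).
  destruct (continuity_sin (Im z) (eps / 2)%R ltac:(lra)) as (d2 & Hd2 & H2).
  exists (Rmin d1 d2). split; [now apply Rmin_pos|]. intros w Hw.
  assert (Hi : (Rabs (Im w - Im z) <= Cmod (w - z))%R) by apply (im_le_Cmod (w - z)).
  assert (Hw1 := Rlt_min_l Hw). assert (Hw2 := Rlt_min_r Hw).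
  eapply Rle_lt_trans; [apply Cmod_le_Re_Im|].
  destruct (Req_dec (Im z) (Im w)) as [En|Hn].
  - rewrite En. simpl. rewrite !Rplus_opp_r, Rabs_R0. lra.
  - specialize (H1 (Im w) (conj (conj I Hn) (Rle_lt_trans _ _ _ Hi Hw1))).
    specialize (H2 (Im w) (conj (conj I Hn) (Rle_lt_trans _ _ _ Hi Hw2))).
    simpl in *. unfold Rdist, Rminus in *. lra.
Qed.

Lemma cont_circle (a : C -> R) (z0 z : C) :
  cont (fun w => RtoC (a w)) z -> cont (fun w => z0 + RtoC (a w) * cis (Im w)) z.
Proof. intros H. apply cont_plus; [apply cont_const|]. apply cont_mult; [exact H|apply cont_cis]. Qed.

Lemma cont_Re_id (z : C) : cont (fun w => RtoC (Re w)) z.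
Proof. apply (cont_Re (fun w => w)), cont_id. Qed.

(** Borsuk's homotopy from [f (z0 + zeta) - f z0] to an odd loop. *)
Lemma injective_no_log (f : C -> C) (z0 : C) (r : R) : (0 < r)%R ->
  (forall z, (Cmod (z - z0) <= r)%R -> cont f z) ->
  (forall z w, (Cmod (z - z0) <= r)%R -> (Cmod (w - z0) <= r)%R -> f z = f w -> z = w) ->
  ~ has_log (fun t => f (z0 + RtoC r * cis t) - f z0).
Proof.
  intros Hr Hc Hi HL.
  (* At parameter s the two points are z0 + (r / (1 + s)) cis t and z0 - (s r / (1 + s)) cis t. They
     stay in the disc at mutual distance [r]; s = 0 gives the circle and its centre, s = 1 an
     antipodal pair on the circle of radius r / 2. *)
  set (a := fun w : C => (r * / (1 + Re w))%R). set (b := fun w : C => (- (Re w * (r * / (1 + Re w))))%R).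
  set (H := fun w : C => f (z0 + RtoC (a w) * cis (Im w)) - f (z0 + RtoC (b w) * cis (Im w))).
  assert (D : forall c t, (Rabs c <= r)%R -> (Cmod (z0 + RtoC c * cis t - z0) <= r)%R).
  { intros c t Hcr. replace (z0 + RtoC c * cis t - z0) with (RtoC c * cis t) by ring.
    rewrite Cmod_mult, Cmod_cis, Cmod_R. lra. }
  assert (B : forall s, (0 <= s <= 1)%R -> (0 < r * / (1 + s) <= r)%R /\ (0 <= s * (r * / (1 + s)) <= r)%R).
  { intros s Hs. assert (Q : (0 < / (1 + s) <= 1)%R).
    { split; [apply Rinv_0_lt_compat; lra|]. rewrite <- Rinv_1. apply Rinv_le_contravar; lra. }
    split; [nra|]. assert (0 < r * / (1 + s) <= r)%R by nra. nra. }
  refine (odd_no_log (fun t => H (1%R, t)) _ _ (has_log_homotopy H _ _ _ _)).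
  - intros t E. unfold H, a, b in E. simpl in E.
    assert (E' : f (z0 + RtoC (r * / (1 + 1))%R * cis t) = f (z0 + RtoC (- (1 * (r * / (1 + 1))))%R * cis t)).
    { replace (f (z0 + RtoC (r * / (1 + 1))%R * cis t)) with (f (z0 + RtoC (r * / (1 + 1))%R * cis t) - f (z0 + RtoC (- (1 * (r * / (1 + 1))))%R * cis t) + f (z0 + RtoC (- (1 * (r * / (1 + 1))))%R * cis t)) by ring.
      rewrite E. ring. }
    apply Hi in E'; [|apply D|apply D]; try (apply Rabs_le; lra).
    assert (E2 : RtoC r * cis t = 0).
    { replace (RtoC r) with (RtoC (r * / (1 + 1))%R - RtoC (- (1 * (r * / (1 + 1))))%R) by (rewrite <- RtoC_minus; f_equal; field).
      replace ((RtoC (r * / (1 + 1))%R - RtoC (- (1 * (r * / (1 + 1))))%R) * cis t) with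
        ((z0 + RtoC (r * / (1 + 1))%R * cis t) - (z0 + RtoC (- (1 * (r * / (1 + 1))))%R * cis t)) by ring.
      rewrite E'. ring. }
    apply (f_equal Cmod) in E2. rewrite Cmod_mult, Cmod_cis, Cmod_0, Cmod_pos_eq in E2; lra.
  - intros t. unfold H, a, b. simpl. rewrite cis_PI.
    replace (z0 + RtoC (r * / (1 + 1))%R * - cis t) with (z0 + RtoC (- (1 * (r * / (1 + 1))))%R * cis t)
      by (rewrite RtoC_opp, Rmult_1_l; ring).
    replace (z0 + RtoC (- (1 * (r * / (1 + 1))))%R * - cis t) with (z0 + RtoC (r * / (1 + 1))%R * cis t)
      by (rewrite RtoC_opp, Rmult_1_l; ring).
    ring.
  - intros s t Hs. destruct (B s Hs) as [B1 B2].
    assert (Ca : cont (fun w => RtoC (a w)) (s, t)).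
    { unfold a. eapply (cont_ext_loc (fun w => RtoC r * / (1 + RtoC (Re w))) _ _ 1 Rlt_0_1).
      - intros w Hw. assert (Hn : (1 + Re w <> 0)%R).
        { assert (T := re_le_Cmod (w - (s, t))). change (Re (w - (s, t))) with (Re w - s)%R in T.
          assert (T2 : (Rabs (Re w - s) < 1)%R) by lra. apply Rabs_lt_between in T2. lra. }
        now rewrite RtoC_mult, RtoC_inv, RtoC_plus.
      - apply cont_mult; [apply cont_const|]. apply cont_inv.
        + rewrite <- RtoC_plus. simpl. intros E. injection E. lra.
        + apply cont_plus; [apply cont_const|apply cont_Re_id]. }
    assert (Cb : cont (fun w => RtoC (b w)) (s, t)).
    { unfold b. eapply (cont_ext_loc (fun w => - (RtoC (Re w) * RtoC (a w))) _ _ 1 Rlt_0_1).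
      - intros w _. unfold a. rewrite RtoC_opp, !RtoC_mult. reflexivity.
      - apply cont_opp. apply cont_mult; [apply cont_Re_id|exact Ca]. }
    apply cont_minus.
    + apply (cont_comp (fun w => z0 + RtoC (a w) * cis (Im w)) f); [now apply cont_circle|].
      apply Hc. apply D. unfold a. simpl. apply Rabs_le. lra.
    + apply (cont_comp (fun w => z0 + RtoC (b w) * cis (Im w)) f); [now apply cont_circle|].
      apply Hc. apply D. unfold b. simpl. apply Rabs_le. lra.
  - intros s t Hs E. destruct (B s Hs) as [B1 B2]. unfold H, a, b in E. simpl in E.
    set (p := (r * / (1 + s))%R) in *.
    assert (E' : f (z0 + RtoC p * cis t) = f (z0 + RtoC (- (s * p))%R * cis t)).
    { replace (f (z0 + RtoC p * cis t)) with (f (z0 + RtoC p * cis t) - f (z0 + RtoC (- (s * p))%R * cis t) + f (z0 + RtoC (- (s * p))%R * cis t)) by ring.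
      rewrite E. ring. }
    apply Hi in E'; [|apply D|apply D]; try (apply Rabs_le; lra).
    assert (E2 : RtoC (p + s * p)%R * cis t = 0).
    { replace (RtoC (p + s * p)%R) with (RtoC p - RtoC (- (s * p))%R) by (rewrite <- RtoC_minus; f_equal; ring).
      replace ((RtoC p - RtoC (- (s * p))%R) * cis t) with
        ((z0 + RtoC p * cis t) - (z0 + RtoC (- (s * p))%R * cis t)) by ring.
      rewrite E'. ring. }
    apply (f_equal Cmod) in E2. rewrite Cmod_mult, Cmod_cis, Cmod_0, Cmod_pos_eq in E2; lra.
  - intros s t. unfold H, a, b. simpl. now rewrite cis_2PI.
  - destruct HL as (u & theta & K1 & K2 & K3). exists u, theta. split; [exact K1|]. split; [exact K2|].
    intros t. unfold H, a, b. simpl.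
    replace (r * / (1 + 0))%R with r by (field). replace (- (0 * r))%R with 0%R by ring.
    replace (z0 + 0 * cis t) with z0 by ring. apply K3.
Qed.

(** * Invariance of domain in the plane *)

Lemma circle_point (z : C) (t : R) (r : R) : (0 <= r)%R -> Cmod (z + RtoC r * cis t - z) = r.
Proof.
  intros Hr. replace (z + RtoC r * cis t - z) with (RtoC r * cis t) by ring.
  rewrite Cmod_mult, Cmod_cis, Cmod_pos_eq; lra.
Qed.

Lemma loop_circle (F : C -> C) (z0 c : C) (r : R) : (0 <= r)%R ->
  (forall z, (Cmod (z - z0) <= r)%R -> cont F z) -> loop (fun t => F (z0 + RtoC r * cis t) - c).
Proof.
  intros Hr Hc. split; [|intros t; now rewrite cis_2PI].
  intros t. apply (cont_curve (fun w => F (z0 + RtoC r * cis (Im w)) - c) (fun _ => 0%R) (fun t => t)).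
  - apply cont_minus; [|apply cont_const].
    apply (cont_comp (fun w => z0 + RtoC r * cis (Im w)) F).
    + apply (cont_circle (fun _ => r)). apply cont_const.
    + apply Hc. rewrite circle_point by exact Hr. apply Rle_refl.
  - apply continuity_pt_const_fun.
  - apply derivable_continuous_pt, derivable_pt_id.
Qed.

(** If a value [w] near [f z0] were missed, shrinking the circle to its centre would contract the
    loop f - w, through nonvanishing loops, to a constant, so it would have a logarithm. The loop f
    - f z0 is close to it and would have one as well, against [injective_no_log]. *)
Lemma open_map_disc (f : C -> C) (z0 : C) (r : R) : (0 < r)%R ->
  (forall z, (Cmod (z - z0) <= r)%R -> cont f z) ->
  (forall z w, (Cmod (z - z0) <= r)%R -> (Cmod (w - z0) <= r)%R -> f z = f w -> z = w) ->
  exists eps : R, (0 < eps)%R /\ forall w, (Cmod (w - f z0) < eps)%R ->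
    exists z, (Cmod (z - z0) < r)%R /\ f z = w.
Proof.
  intros Hr Hc Hi.
  assert (Z0 : (Cmod (z0 - z0) <= r)%R) by (rewrite Cminus_diag, Cmod_0; lra).
  destruct (disc_pos_lower (fun z => f z - f z0) z0 r (fun z => Cmod (z - z0) = r)) as (m & Hm & HM).
  - intros z Hz. apply cont_minus; [now apply Hc|apply cont_const].
  - intros z Hz E. assert (Ez : z = z0).
    { apply Hi; auto. replace (f z) with (f z - f z0 + f z0) by ring. rewrite E. ring. }
    exists r. split; [exact Hr|]. intros w Hw. rewrite Ez in Hw. lra.
  (* [m] bounds from below the distance between [f z0] and the image of the circle. With half of it,
     [f] on the circle stays farther from [w] than [w] is from [f z0], as [has_log_close]
     requires. *)
  - exists (m / 2)%R. split; [lra|]. intros w Hw. apply NNPP. intros HN.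
    assert (HC : forall t, (m <= Cmod (f (z0 + RtoC r * cis t)%C - f z0))%R).
    { intros t. apply HM; rewrite circle_point; lra. }
    assert (HC2 : forall t, (m / 2 < Cmod (f (z0 + RtoC r * cis t)%C - w))%R).
    { intros t. specialize (HC t). assert (T := Cmod_triangle (f (z0 + RtoC r * cis t) - w) (w - f z0)).
      replace (f (z0 + RtoC r * cis t) - w + (w - f z0)) with (f (z0 + RtoC r * cis t) - f z0) in T by ring. lra. }
    apply (injective_no_log f z0 r Hr Hc Hi).
    apply (has_log_close (fun t => f (z0 + RtoC r * cis t) - w)).
    + apply loop_circle; [lra|exact Hc].
    + apply loop_circle; [lra|exact Hc].
    + intros t. replace (f (z0 + RtoC r * cis t) - f z0 - (f (z0 + RtoC r * cis t) - w)) with (w - f z0) by ring.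
      specialize (HC2 t). lra.
    + set (H := fun v : C => f (z0 + RtoC (Re v * r)%R * cis (Im v)) - w).
      assert (D : forall s t, (0 <= s <= 1)%R -> Cmod (z0 + RtoC (s * r)%R * cis t - z0) = (s * r)%R).
      { intros s t Hs. apply circle_point. nra. }
      assert (HH : has_log (fun t => H (1%R, t))).
      { apply has_log_homotopy.
        - intros s t Hs. apply cont_minus; [|apply cont_const].
          apply (cont_comp (fun v => z0 + RtoC (Re v * r)%R * cis (Im v)) f).
          + apply (cont_circle (fun v => Re v * r)%R).
            eapply (cont_ext_loc (fun v => RtoC (Re v) * RtoC r) _ _ 1 Rlt_0_1).
            * intros v _. now rewrite RtoC_mult.
            * apply cont_mult; [apply cont_Re_id|apply cont_const].
          + apply Hc. simpl. rewrite D by exact Hs. nra.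
        - intros s t Hs E. unfold H in E. simpl in E.
          assert (E' : f (z0 + RtoC (s * r)%R * cis t) = w).
          { replace (f (z0 + RtoC (s * r)%R * cis t)) with (f (z0 + RtoC (s * r)%R * cis t) - w + w) by ring. rewrite E. ring. }
          destruct (Rle_lt_or_eq_dec s 1 (proj2 Hs)) as [Hs1|Hs1].
          + apply HN. exists (z0 + RtoC (s * r)%R * cis t). split; [rewrite D by exact Hs; nra|exact E'].
          + subst s. rewrite Rmult_1_l in E'. specialize (HC2 t). rewrite E' in HC2.
            replace (w - w) with (RtoC 0) in HC2 by ring. rewrite Cmod_0 in HC2. lra.
        - intros s t. unfold H. simpl. now rewrite cis_2PI.
        - assert (Hz : f z0 - w <> 0).
          { intros E. apply HN. exists z0. split; [rewrite Cminus_diag, Cmod_0; lra|].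
            replace (f z0) with (f z0 - w + w) by ring. rewrite E. ring. }
          exists ((f z0 - w) / RtoC (Cmod (f z0 - w))), (fun _ => 0%R).
          split; [intros t; apply continuity_pt_const_fun|]. split; [reflexivity|].
          intros t. unfold H. simpl. rewrite Rmult_0_l. replace (z0 + 0 * cis t) with z0 by ring.
          unfold cis. rewrite cos_0, sin_0. change (1%R, 0%R) with (RtoC 1).
          field. apply Cmod_gt_0 in Hz. intros E. injection E. lra. }
      unfold H in HH. simpl in HH. rewrite Rmult_1_l in HH. exact HH.
Qed.

(** * Cauchy's formula and finite Taylor expansions *)

(** Precomposition with [Im] turns a function of a real variable into one on [C], so that the lemmas
    on [cont] apply to it. *)
Definition contR (g : R -> C) : Prop := forall z, cont (fun w => g (Im w)) z.

Lemma contR_pt (g : R -> C) (t : R) : contR g ->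
  continuity_pt (fun s => Re (g s)) t /\ continuity_pt (fun s => Im (g s)) t.
Proof.
  intros H. apply (cont_curve (fun w => g (Im w)) (fun _ => 0%R) (fun t => t)).
  - apply H.
  - apply continuity_pt_const_fun.
  - apply derivable_continuous_pt, derivable_pt_id.
Qed.

Definition CInt (g : R -> C) : C :=
  (RInt (fun t => Re (g t)) 0 (2 * PI), RInt (fun t => Im (g t)) 0 (2 * PI)).

Lemma contR_ex (g : R -> C) : contR g ->
  ex_RInt (fun t => Re (g t)) 0 (2 * PI) /\ ex_RInt (fun t => Im (g t)) 0 (2 * PI).
Proof.
  intros H. split; apply (ex_RInt_continuous (V := R_CompleteNormedModule)); intros t _; apply continuity_pt_filterlim; now apply (contR_pt g).
Qed.

Lemma CInt_ext (g h : R -> C) : (forall t, g t = h t) -> CInt g = CInt h.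
Proof. intros H. unfold CInt. f_equal; apply RInt_ext; intros t _; now rewrite H. Qed.

Lemma CInt_plus (g h : R -> C) : contR g -> contR h -> CInt (fun t => g t + h t) = CInt g + CInt h.
Proof.
  intros Hg Hh. destruct (contR_ex g Hg). destruct (contR_ex h Hh).
  unfold CInt, Cplus; simpl. f_equal; now apply (RInt_plus (V := R_CompleteNormedModule)).
Qed.

Lemma CInt_scal (c : C) (g : R -> C) : contR g -> CInt (fun t => c * g t) = c * CInt g.
Proof.
  intros Hg. destruct (contR_ex g Hg) as [H1 H2]. destruct c as [a b].
  assert (S : forall k (h : R -> R), ex_RInt h 0 (2 * PI) -> ex_RInt (fun t => k * h t)%R 0 (2 * PI) /\ RInt (fun t => k * h t)%R 0 (2 * PI) = (k * RInt h 0 (2 * PI))%R).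
  { intros k h Hh. split; [now apply (ex_RInt_scal (V := R_NormedModule))|now apply (RInt_scal (V := R_CompleteNormedModule))]. }
  destruct (S a _ H1) as [A1 A1']. destruct (S a _ H2) as [A2 A2'].
  destruct (S b _ H1) as [B1 B1']. destruct (S b _ H2) as [B2 B2'].
  unfold CInt, Cmult; simpl. f_equal.
  - rewrite <- A1', <- B2'. apply (RInt_minus (V := R_CompleteNormedModule) (fun t => a * Re (g t))%R (fun t => b * Im (g t))%R); assumption.
  - rewrite <- A2', <- B1'. apply (RInt_plus (V := R_CompleteNormedModule) (fun t => a * Im (g t))%R (fun t => b * Re (g t))%R); assumption.
Qed.

(** The constant is twice the sharp one, the real and imaginary parts being bounded separately. *)
Lemma CInt_bound (g : R -> C) (M : R) : contR g -> (forall t, (Cmod (g t) <= M)%R) ->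
  (Cmod (CInt g) <= 4 * PI * M)%R.
Proof.
  intros Hg HM. destruct (contR_ex g Hg) as [H1 H2]. assert (Hpi := PI_RGT_0).
  eapply Rle_trans; [apply Cmod_le_Re_Im|]. simpl.
  assert (K1 : (Rabs (RInt (fun t => Re (g t)) 0 (2 * PI)) <= (2 * PI - 0) * M)%R).
  { apply abs_RInt_le_const; [lra|exact H1|]. intros t _. eapply Rle_trans; [apply re_le_Cmod|apply HM]. }
  assert (K2 : (Rabs (RInt (fun t => Im (g t)) 0 (2 * PI)) <= (2 * PI - 0) * M)%R).
  { apply abs_RInt_le_const; [lra|exact H2|]. intros t _. eapply Rle_trans; [apply im_le_Cmod|apply HM]. }
  lra.
Qed.

Lemma contR_const (c : C) : contR (fun _ => c).
Proof. intros z. apply cont_const. Qed.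

Lemma contR_cis : contR cis.
Proof. intros z. apply cont_cis. Qed.

Lemma contR_mult (g h : R -> C) : contR g -> contR h -> contR (fun t => g t * h t).
Proof. intros Hg Hh z. apply cont_mult; [apply Hg|apply Hh]. Qed.

Lemma contR_minus (g h : R -> C) : contR g -> contR h -> contR (fun t => g t - h t).
Proof. intros Hg Hh z. apply cont_minus; [apply Hg|apply Hh]. Qed.

Lemma contR_pow (g : R -> C) (n : nat) : contR g -> contR (fun t => g t ^ n).
Proof. intros Hg z. apply (cont_pow (fun w => g (Im w))). apply Hg. Qed.

Lemma contR_inv (g : R -> C) : (forall t, g t <> 0) -> contR g -> contR (fun t => / g t).
Proof. intros H0 Hg z. apply (cont_inv (fun w => g (Im w))); [apply H0|apply Hg]. Qed.

Lemma contR_comp (F : C -> C) (g : R -> C) : contR g -> (forall t, cont F (g t)) -> contR (fun t => F (g t)).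
Proof. intros Hg HF z. apply (cont_comp (fun w => g (Im w)) F); [apply Hg|apply HF]. Qed.

Section Cauchy.
Variables (r : R) (z : C).
Hypothesis (Hr : (0 < r)%R) (Hz : (Cmod z < r)%R).

Let zeta (t : R) : C := RtoC r * cis t.
(** On the circle [zeta], [ker t] dt is the Cauchy kernel d zeta / (i (zeta - z)). *)
Let ker (t : R) : C := zeta t / (zeta t - z).

Lemma Cmod_zeta (t : R) : Cmod (zeta t) = r.
Proof. unfold zeta. rewrite Cmod_mult, Cmod_cis, Cmod_pos_eq; lra. Qed.

Lemma zeta_neq_0 (t : R) : zeta t <> 0.
Proof. apply Cmod_gt_0. rewrite Cmod_zeta. exact Hr. Qed.

Lemma zeta_minus (t : R) : (r - Cmod z <= Cmod (zeta t - z))%R.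
Proof. assert (H := Cmod_triangle_sub (zeta t) z). rewrite Cmod_zeta in H. exact H. Qed.

Lemma zeta_minus_neq_0 (t : R) : zeta t - z <> 0.
Proof. apply Cmod_gt_0. assert (H := zeta_minus t). lra. Qed.

Lemma contR_zeta : contR zeta.
Proof. apply contR_mult; [apply contR_const|apply contR_cis]. Qed.

Lemma contR_ker : contR ker.
Proof.
  apply contR_mult; [apply contR_zeta|]. apply contR_inv; [apply zeta_minus_neq_0|].
  apply contR_minus; [apply contR_zeta|apply contR_const].
Qed.

Lemma Cmod_ker (t : R) : (Cmod (ker t) <= r / (r - Cmod z))%R.
Proof.
  unfold ker. rewrite Cmod_div by apply zeta_minus_neq_0. rewrite Cmod_zeta.
  apply Rmult_le_compat_l; [lra|]. apply Rinv_le_contravar; [lra|apply zeta_minus].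
Qed.

(** One step of the geometric series of 1 / (1 - z / zeta). Iterating it finitely often gives Taylor
    polynomials with an exact remainder, so no convergence of power series is involved. *)
Lemma ker_step (t : R) : ker t = 1 + z * (/ zeta t * ker t).
Proof. unfold ker. field. split; [apply zeta_minus_neq_0|apply zeta_neq_0]. Qed.

Let W (s t : R) : C := z + RtoC s * (zeta t - z).

Lemma Cmod_W (s t : R) : (Cmod (W s t) <= (Rabs (1 - s) + Rabs s) * r)%R.
Proof.
  unfold W. replace (z + RtoC s * (zeta t - z)) with (RtoC (1 - s)%R * z + RtoC s * zeta t)
    by (rewrite RtoC_minus; ring).
  eapply Rle_trans; [apply Cmod_triangle|]. rewrite !Cmod_mult, Cmod_zeta, !Cmod_R.
  assert (Ha := Rabs_pos (1 - s)). nra.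
Qed.

(** The mean of [F (z + s (zeta - z)) zeta / (zeta - z)] does not depend on [s]:
    its [s]-derivative is the mean of a [t]-derivative. *)
Lemma cauchy_Re (R0 : R) (F F' : C -> C) : (r < R0)%R -> hol R0 F F' ->
  RInt (fun t => Re (ker t * F (zeta t))) 0 (2 * PI) = RInt (fun t => Re (ker t * F z)) 0 (2 * PI).
Proof.
  (* Slack beyond [0, 1], so that the integral is differentiable in the parameter at both ends: (1 +
     2 eta) r = (r + R0) / 2 is still below [R0]. *)
  intros HR HF. set (eta := ((R0 - r) / (4 * r))%R).
  assert (Heta : (0 < eta)%R) by (apply Rdiv_lt_0_compat; lra).
  assert (Hin : forall s t, (- eta < s < 1 + eta)%R -> (Cmod (W s t) < R0)%R).
  { intros s t Hs. eapply Rle_lt_trans; [apply Cmod_W|].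
    apply Rle_lt_trans with ((1 + 2 * eta) * r)%R.
    - apply Rmult_le_compat_r; [lra|]. unfold Rabs. destruct (Rcase_abs (1 - s)), (Rcase_abs s); lra.
    - assert (E : (eta * r = (R0 - r) / 4)%R) by (unfold eta; field; lra). nra. }
  set (Phi := fun s => RInt (fun t => Re (ker t * F (W s t))) 0 (2 * PI)).
  assert (CW : forall v : C, cont (fun w => W (Re w) (Im w)) v).
  { intros v. unfold W. apply cont_plus; [apply cont_const|]. apply cont_mult; [apply cont_Re_id|].
    apply cont_minus; [apply contR_zeta|apply cont_const]. }
  assert (CWs : forall s, contR (W s)).
  { intros s v. unfold W. apply cont_plus; [apply cont_const|]. apply cont_mult; [apply cont_const|].
    apply cont_minus; [apply contR_zeta|apply cont_const]. }
  assert (Ds : forall s t, (- eta < s < 1 + eta)%R ->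
    is_derive (fun s => Re (ker t * F (W s t))) s (Re (zeta t * F' (W s t)))).
  { intros s t Hs.
    assert (D : rdiff (fun w => ker t * F w) (W s t) (ker t * F' (W s t)) (ker t * 0)).
    { apply rdiff_scal. apply HF. now apply Hin. }
    replace (Re (zeta t * F' (W s t))) with (Re (ker t * F' (W s t) * (zeta t - z) + ker t * 0 * Cconj (zeta t - z)))
      by (f_equal; unfold ker; field; apply zeta_minus_neq_0).
    apply (rdiff_curve (fun w => ker t * F w) (fun s => W s t)); [exact D|].
    apply is_derive_C_pair. unfold W. split; simpl; auto_derive; trivial; unfold Re, Im; simpl; ring. }
  assert (DPhi : forall s, (- eta < s < 1 + eta)%R -> is_derive Phi s (RInt (fun t => Re (zeta t * F' (W s t))) 0 (2 * PI))).
  { intros s Hs. unfold Phi.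
    assert (Hloc : locally s (fun y => (- eta < y < 1 + eta)%R)).
    { apply (locally_interval _ s (- eta)%R (1 + eta)%R); simpl; [lra|lra|]. intros y Hy1 Hy2. simpl in *. lra. }
    rewrite (RInt_ext (V := R_CompleteNormedModule) (fun t => Re (zeta t * F' (W s t))) (fun t => Derive (fun u => Re (ker t * F (W u t))) s)).
    2:{ intros t _. symmetry. apply is_derive_unique. now apply Ds. }
    apply is_derive_RInt_param.
    - generalize Hloc. apply filter_imp. intros y Hy t _. eexists. now apply Ds.
    - intros t _. apply continuity_2d_pt_ext_loc with (fun u v => Re (zeta v * F' (W u v))).
      + destruct Hloc as [d Hd]. exists d. intros u v Hu _. symmetry. apply is_derive_unique. apply Ds. now apply Hd.
      + apply (cont_2d (fun w => zeta (Im w) * F' (W (Re w) (Im w)))). apply cont_mult; [apply contR_zeta|].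
        apply (cont_comp (fun w => W (Re w) (Im w)) F'); [apply CW|]. apply HF. simpl. now apply Hin.
    - generalize Hloc. apply filter_imp. intros y Hy. apply (contR_ex (fun t => ker t * F (W y t))).
      apply contR_mult; [apply contR_ker|]. apply contR_comp; [apply CWs|]. intros t.
      eapply rdiff_cont. apply HF. now apply Hin. }
  (* The primitive in [t] is F (W s t) / (i s), which is periodic. Division by [s] excludes s = 0,
     but the mean value theorem asks for the derivative on the open interval only. *)
  assert (Z : forall s, (0 < s < 1)%R -> RInt (fun t => Re (zeta t * F' (W s t))) 0 (2 * PI) = 0%R).
  { intros s Hs. apply is_RInt_unique.
    assert (Hsc : RtoC s <> 0) by (intros E; injection E; lra).
    assert (Hci : Ci <> 0) by (intros E; injection E; lra).
    assert (E0 : minus (Re (/ (Ci * RtoC s) * F (W s (2 * PI)%R))) (Re (/ (Ci * RtoC s) * F (W s 0%R))) = 0%R).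
    { replace (W s (2 * PI)%R) with (W s 0%R); [unfold minus, plus, opp; simpl; ring|].
      unfold W, zeta. do 4 f_equal. rewrite <- (cis_2PI 0). now rewrite Rplus_0_l. }
    refine (eq_rect _ (is_RInt _ _ _) _ _ E0).
    apply (is_RInt_derive (V := R_CompleteNormedModule) (fun t => Re (/ (Ci * RtoC s) * F (W s t)))).
    - intros t _.
      assert (D : rdiff (fun w => / (Ci * RtoC s) * F w) (W s t) (/ (Ci * RtoC s) * F' (W s t)) (/ (Ci * RtoC s) * 0)).
      { apply rdiff_scal. apply HF. apply Hin. lra. }
      replace (Re (zeta t * F' (W s t))) with (Re (/ (Ci * RtoC s) * F' (W s t) * (Ci * RtoC s * zeta t) + / (Ci * RtoC s) * 0 * Cconj (Ci * RtoC s * zeta t)))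
        by (f_equal; field; split; assumption).
      apply (rdiff_curve (fun w => / (Ci * RtoC s) * F w) (W s)); [exact D|].
      apply is_derive_C_pair. unfold W, zeta, cis. split; simpl; auto_derive; trivial; unfold Re, Im; simpl; ring.
    - intros t _. apply continuity_pt_filterlim. apply (contR_pt (fun t => zeta t * F' (W s t))).
      apply contR_mult; [apply contR_zeta|]. apply contR_comp; [apply CWs|]. intros u. apply HF. apply Hin. lra. }
  destruct (MVT_gen Phi 0 1 (fun _ => 0%R)) as (c & _ & Hc).
  - rewrite Rmin_left, Rmax_right by lra. intros s Hs. rewrite <- (Z s Hs). apply DPhi. lra.
  - rewrite Rmin_left, Rmax_right by lra. intros s Hs. apply continuity_pt_filterlim.
    apply (ex_derive_continuous (V := R_NormedModule)). eexists. apply DPhi. lra.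
  - rewrite Rmult_0_l in Hc. apply Rminus_diag_uniq in Hc.
    transitivity (Phi 1%R).
    + apply RInt_ext. intros t _. unfold W. do 2 f_equal. f_equal. ring.
    + rewrite Hc. apply RInt_ext. intros t _. unfold W. do 2 f_equal. f_equal. ring.
Qed.

Lemma hol_scal (R0 : R) (c : C) (F F' : C -> C) : hol R0 F F' -> hol R0 (fun w => c * F w) (fun w => c * F' w).
Proof.
  intros H w Hw. destruct (H w Hw) as [H1 H2]. split.
  - eapply rdiff_val; [reflexivity| |apply rdiff_scal; exact H1]. ring.
  - apply cont_mult; [apply cont_const|exact H2].
Qed.

Lemma cauchy (R0 : R) (F F' : C -> C) : (r < R0)%R -> hol R0 F F' ->
  CInt (fun t => F (zeta t) * ker t) = F z * CInt ker.
Proof.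
  intros HR HF. rewrite <- CInt_scal by apply contR_ker. unfold CInt. f_equal.
  - rewrite (RInt_ext (fun t => Re (F (zeta t) * ker t)) (fun t => Re (ker t * F (zeta t)))) by (intros; now rewrite Cmult_comm).
    rewrite (cauchy_Re R0 F F' HR HF). apply RInt_ext. intros; now rewrite Cmult_comm.
  - assert (E : forall u, Im u = Re (- Ci * u)) by (intros [a b]; simpl; ring).
    rewrite (RInt_ext (fun t => Im (F (zeta t) * ker t)) (fun t => Re (ker t * (- Ci * F (zeta t))))) by (intros; rewrite E; f_equal; ring).
    rewrite (cauchy_Re R0 _ _ HR (hol_scal R0 (- Ci) F F' HF)). apply RInt_ext. intros. rewrite E. f_equal. ring.
Qed.

Fixpoint psum (c : nat -> C) (n : nat) (w : C) : C :=
  match n with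
  | O => 0
  | S n' => psum c n' w + c n' * w ^ n'
  end.

Lemma kernel_expansion (g : R -> C) (n : nat) : contR g ->
  CInt (fun t => g t * ker t) =
  psum (fun j => CInt (fun t => g t * (/ zeta t) ^ j)) n z + z ^ n * CInt (fun t => g t * (/ zeta t) ^ n * ker t).
Proof.
  intros Hg. assert (Ci := contR_inv _ zeta_neq_0 contR_zeta).
  induction n as [|n IH].
  - simpl. rewrite Cplus_0_l, Cmult_1_l. apply CInt_ext. intros t. ring.
  - rewrite IH. simpl. rewrite <- Cplus_assoc. f_equal.
    assert (C1 : contR (fun t => g t * (/ zeta t) ^ n)) by (apply contR_mult; [exact Hg|now apply contR_pow]).
    assert (C2 : contR (fun t => g t * (/ zeta t * (/ zeta t) ^ n) * ker t)).
    { apply contR_mult; [|apply contR_ker]. apply contR_mult; [exact Hg|]. apply contR_mult; [exact Ci|now apply contR_pow]. }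
    rewrite (CInt_ext (fun t => g t * (/ zeta t) ^ n * ker t) (fun t => g t * (/ zeta t) ^ n + z * (g t * (/ zeta t * (/ zeta t) ^ n) * ker t))).
    + rewrite CInt_plus, CInt_scal; [ring|exact C2|exact C1|]. apply contR_mult; [apply contR_const|exact C2].
    + intros t. rewrite (ker_step t) at 1. ring.
Qed.

Lemma kernel_remainder (g : R -> C) (n : nat) (M : R) : contR g -> (forall t, (Cmod (g t) <= M)%R) ->
  (Cmod (z ^ n * CInt (fun t => g t * (/ zeta t) ^ n * ker t)%C) <= 4 * PI * M * (r / (r - Cmod z)) * (Cmod z / r) ^ n)%R.
Proof.
  intros Hg HM. rewrite Cmod_mult, Cmod_pow.
  assert (Ci := contR_inv _ zeta_neq_0 contR_zeta).
  assert (M0 : (0 <= M)%R) by (eapply Rle_trans; [apply Cmod_ge_0|apply (HM 0%R)]).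
  apply Rle_trans with (Cmod z ^ n * (4 * PI * (M * (/ r) ^ n * (r / (r - Cmod z)))))%R.
  - apply Rmult_le_compat_l; [apply pow_le, Cmod_ge_0|]. apply CInt_bound.
    + apply contR_mult; [|apply contR_ker]. apply contR_mult; [exact Hg|now apply contR_pow].
    + intros t. rewrite !Cmod_mult, Cmod_pow, Cmod_inv, Cmod_zeta by apply zeta_neq_0.
      apply Rmult_le_compat; [|apply Cmod_ge_0| |apply Cmod_ker].
      * apply Rmult_le_pos; [apply Cmod_ge_0|]. apply pow_le. left. now apply Rinv_0_lt_compat.
      * apply Rmult_le_compat_r; [|apply HM]. apply pow_le. left. now apply Rinv_0_lt_compat.
  - right. unfold Rdiv. rewrite Rpow_mult_distr. ring.
Qed.

Lemma cis_0 : cis 0 = 1.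
Proof. unfold cis. now rewrite cos_0, sin_0. Qed.

Lemma cis_pow_inv (n : nat) (t : R) : (/ cis t) ^ n = cis (- (INR n * t)).
Proof.
  assert (E : / cis t = cis (- t)).
  { transitivity (/ cis t * (cis t * cis (- t))); [|field; apply cis_neq_0].
    rewrite <- cis_plus. replace (t + - t)%R with 0%R by ring. rewrite cis_0. ring. }
  induction n as [|n IH].
  - replace (- (INR 0 * t))%R with 0%R by (simpl; ring). now rewrite cis_0.
  - rewrite S_INR. change ((/ cis t) ^ S n) with (/ cis t * (/ cis t) ^ n). rewrite IH, E, <- cis_plus. f_equal. ring.
Qed.

Lemma CInt_cis_pow (n : nat) : (0 < n)%nat -> CInt (fun t => 1 * (/ zeta t) ^ n) = 0.
Proof.
  intros Hn. assert (Hn' : (0 < INR n)%R) by now apply lt_0_INR.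
  rewrite (CInt_ext _ (fun t => (/ RtoC r) ^ n * cis (- (INR n * t)))).
  - rewrite CInt_scal.
    + assert (E0 : CInt (fun t => cis (- (INR n * t))) = 0); [|rewrite E0; ring].
      assert (P : cis (- (INR n * (2 * PI))) = cis 0).
      { rewrite <- cis_pow_inv. replace (cis (2 * PI)) with (RtoC 1).
        - replace (/ 1) with (RtoC 1) by field.
          unfold cis. rewrite cos_0, sin_0. clear. induction n as [|n IH]; [reflexivity|]. simpl. rewrite IH.
          unfold Cmult, RtoC; simpl; f_equal; ring.
        - rewrite <- (Rplus_0_l (2 * PI)), cis_2PI. unfold cis. now rewrite cos_0, sin_0. }
      injection P as P1 P2. unfold CInt, cis. cbn [Re Im fst snd].
      apply injective_projections; simpl; apply is_RInt_unique.
      * assert (E0 : minus (- / INR n * sin (- (INR n * (2 * PI))))%R (- / INR n * sin (- (INR n * 0)))%R = 0%R).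
        { rewrite P2, Rmult_0_r, Ropp_0. unfold minus, plus, opp; simpl; ring. }
        refine (eq_rect _ (is_RInt _ _ _) _ _ E0).
        apply (is_RInt_derive (V := R_CompleteNormedModule) (fun t => - / INR n * sin (- (INR n * t)))%R).
        -- intros t _. auto_derive; [trivial|]. field. lra.
        -- intros t _. apply (ex_derive_continuous (V := R_NormedModule)). auto_derive. trivial.
      * assert (E0 : minus (/ INR n * cos (- (INR n * (2 * PI))))%R (/ INR n * cos (- (INR n * 0)))%R = 0%R).
        { rewrite P1, Rmult_0_r, Ropp_0. unfold minus, plus, opp; simpl; ring. }
        refine (eq_rect _ (is_RInt _ _ _) _ _ E0).
        apply (is_RInt_derive (V := R_CompleteNormedModule) (fun t => / INR n * cos (- (INR n * t)))%R).
        -- intros t _. auto_derive; [trivial|]. field. lra.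
        -- intros t _. apply (ex_derive_continuous (V := R_NormedModule)). auto_derive. trivial.
    + intros v. apply (cont_ext_loc (fun w => (/ cis (Im w)) ^ n) _ v 1 Rlt_0_1).
      * intros w _. apply cis_pow_inv.
      * apply cont_pow. apply (cont_inv (fun w => cis (Im w))); [apply cis_neq_0|apply cont_cis].
  - intros t. rewrite Cmult_1_l, <- cis_pow_inv. unfold zeta.
    rewrite <- Cpow_mult_l. f_equal. field. split; [apply cis_neq_0|]. intros E; injection E; lra.
Qed.

Lemma pow_bound_zero (x A : R) (q : R) : (0 <= q < 1)%R -> (forall n : nat, (0 < n)%nat -> (Rabs x <= A * q ^ n)%R) -> x = 0%R.
Proof.
  intros Hq H. apply NNPP. intros Hx. assert (Hx' := Rabs_pos_lt x Hx).
  assert (HA : (0 <= A)%R).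
  { specialize (H 1%nat ltac:(lia)). simpl in H. rewrite Rmult_1_r in H.
    destruct (Rle_lt_dec 0 A) as [|HA]; [assumption|]. nra. }
  destruct (pow_lt_1_zero q ltac:(rewrite Rabs_pos_eq; lra) (Rabs x / (A + 1))%R) as [N HN].
  { apply Rdiv_lt_0_compat; lra. }
  specialize (HN (S N) ltac:(lia)). specialize (H (S N) ltac:(lia)).
  rewrite Rabs_pos_eq in HN by (apply pow_le; lra).
  apply Rlt_div_r in HN; [|lra].
  assert (Hp : (0 <= q ^ S N)%R) by (apply pow_le; lra). lra.
Qed.

(** Cauchy's formula for a constant is a tautology in the form above, so the total mass comes from
    the kernel expansion with g = 1: only the moment of order 0 survives, and the remainder is
    geometric in |z| / r. *)
Lemma CInt_ker : CInt ker = RtoC (2 * PI)%R.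
Proof.
  assert (HB : forall n, (0 < n)%nat -> (Cmod (CInt ker - RtoC (2 * PI)%R) <= 4 * PI * 1 * (r / (r - Cmod z)) * (Cmod z / r) ^ n)%R).
  { intros n Hn. assert (E := kernel_expansion (fun _ => 1) n (contR_const 1)).
    assert (E1 : CInt (fun t => 1 * ker t) = CInt ker) by (apply CInt_ext; intros; ring).
    cbv beta in E. rewrite E1 in E.
    assert (E2 : psum (fun j => CInt (fun t => 1 * (/ zeta t) ^ j)) n z = RtoC (2 * PI)%R).
    { destruct n as [|n]; [lia|]. clear -Hr. induction n as [|n IH].
      - simpl. rewrite Cplus_0_l, Cmult_1_r. rewrite (CInt_ext _ (fun _ => 1)) by (intros; ring).
        unfold CInt, RtoC. simpl. rewrite !RInt_const. unfold scal; simpl. unfold mult; simpl. f_equal; ring.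
      - change (psum (fun j => CInt (fun t => 1 * (/ zeta t) ^ j)) (S (S n)) z) with
          (psum (fun j => CInt (fun t => 1 * (/ zeta t) ^ j)) (S n) z + CInt (fun t => 1 * (/ zeta t) ^ (S n)) * z ^ (S n)).
        rewrite IH, CInt_cis_pow by lia. ring. }
    rewrite E2 in E. rewrite E.
    match goal with |- (Cmod (?a + ?b - ?a) <= _)%R => replace (a + b - a) with b by ring end.
    apply kernel_remainder; [apply contR_const|]. intros _. rewrite Cmod_1. lra. }
  assert (Hq : (0 <= Cmod z / r < 1)%R).
  { split; [apply Rdiv_le_0_compat; [apply Cmod_ge_0|exact Hr]|]. apply Rlt_div_l; lra. }
  assert (E : Cmod (CInt ker - RtoC (2 * PI)%R) = 0%R).
  { apply (pow_bound_zero _ (4 * PI * 1 * (r / (r - Cmod z))) (Cmod z / r) Hq). intros n Hn.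
    rewrite Rabs_pos_eq by apply Cmod_ge_0. now apply HB. }
  apply Cmod_eq_0 in E. replace (CInt ker) with (CInt ker - RtoC (2 * PI)%R + RtoC (2 * PI)%R) by ring.
  rewrite E. ring.
Qed.

Lemma taylor_circle (R0 M : R) (F F' : C -> C) (n : nat) : (r < R0)%R -> hol R0 F F' ->
  (forall w, (Cmod w <= r)%R -> (Cmod (F w) <= M)%R) ->
  (Cmod (F z - psum (fun j => / RtoC (2 * PI)%R * CInt (fun t => F (zeta t) * (/ zeta t) ^ j))%C n z)
   <= 2 * M * (r / (r - Cmod z)) * (Cmod z / r) ^ n)%R.
Proof.
  intros HR HF HM.
  assert (Hpi : (0 < 2 * PI)%R) by (assert (T := PI_RGT_0); lra).
  assert (HpiC : RtoC (2 * PI)%R <> 0) by (intros E; injection E; lra).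
  assert (Cg : contR (fun t => F (zeta t))).
  { apply contR_comp; [apply contR_zeta|]. intros t. eapply rdiff_cont. apply HF. rewrite Cmod_zeta. exact HR. }
  assert (E := cauchy R0 F F' HR HF). rewrite CInt_ker, (kernel_expansion _ n Cg) in E.
  assert (EP : psum (fun j => / RtoC (2 * PI)%R * CInt (fun t => F (zeta t) * (/ zeta t) ^ j)) n z
    = / RtoC (2 * PI)%R * psum (fun j => CInt (fun t => F (zeta t) * (/ zeta t) ^ j)) n z).
  { clear. induction n as [|n IH]; simpl; [ring|]. rewrite IH. ring. }
  rewrite EP.
  assert (EF : F z = / RtoC (2 * PI)%R * (F z * RtoC (2 * PI)%R)) by (field; assumption).
  rewrite EF, <- E.
  match goal with |- (Cmod (?c * (?a + ?b) - ?c * ?a) <= _)%R => replace (c * (a + b) - c * a) with (c * b) by ring end.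
  rewrite Cmod_mult, Cmod_inv, Cmod_pos_eq by (assumption || lra).
  apply Rle_trans with (/ (2 * PI) * (4 * PI * M * (r / (r - Cmod z)) * (Cmod z / r) ^ n))%R.
  - apply Rmult_le_compat_l; [left; now apply Rinv_0_lt_compat|].
    apply (kernel_remainder (fun t => F (zeta t))); [exact Cg|]. intros t. apply HM. rewrite Cmod_zeta. lra.
  - right. field. split; lra.
Qed.

End Cauchy.

(** The coefficients and [K] do not depend on [n], which lets [hol_leading] pass through all orders.
    For |z| <= r / 2 the factor r / (r - |z|) is at most 2, which turns the 2 M of [taylor_circle]
    into 4 M. *)
Lemma taylor (R0 : R) (F F' : C -> C) : (0 < R0)%R -> hol R0 F F' ->
  exists (c : nat -> C) (r K : R), (0 < r < R0)%R /\ (0 < K)%R /\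
    forall n z, (Cmod z <= r / 2)%R -> (Cmod (F z - psum c n z) <= K * (Cmod z / r) ^ n)%R.
Proof.
  intros HR HF. set (r := (R0 / 2)%R). assert (Hr : (0 < r < R0)%R) by (unfold r; lra).
  destruct (disc_bounded F 0 r) as (M & HM0 & HM).
  { intros z Hz. eapply rdiff_cont. apply HF. rewrite Cminus_0_r in Hz. lra. }
  exists (fun j => / RtoC (2 * PI)%R * CInt (fun t => F (RtoC r * cis t) * (/ (RtoC r * cis t)) ^ j)), r, (4 * M)%R.
  split; [exact Hr|]. split; [lra|]. intros n z Hz.
  eapply Rle_trans; [apply (taylor_circle r z (proj1 Hr) ltac:(lra) R0 M F F' n (proj2 Hr) HF)|].
  - intros w Hw. apply HM. now rewrite Cminus_0_r.
  - apply Rmult_le_compat_r; [apply pow_le, Rdiv_le_0_compat; [apply Cmod_ge_0|lra]|].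
    assert (T := Cmod_ge_0 z).
    assert (Q : (r / (r - Cmod z) <= 2)%R) by (apply Rle_div_l; lra). nra.
Qed.

Lemma hol_shift (F F' : C -> C) (z0 : C) : hol 1 F F' ->
  hol (1 - Cmod z0) (fun w => F (z0 + w)) (fun w => F' (z0 + w)).
Proof.
  intros H w Hw. assert (T := Cmod_triangle z0 w). destruct (H (z0 + w) ltac:(lra)) as [H1 H2]. split.
  - now apply rdiff_shift.
  - apply (cont_comp (fun w => z0 + w) F'); [|exact H2]. apply cont_plus; [apply cont_const|apply cont_id].
Qed.

(** * Lewy's theorem *)

(** The inverse is chosen pointwise. Its continuity at [w1] is the openness of [f] on arbitrarily
    small discs about [Phi w1], injectivity identifying the preimage found there with the chosen
    one. *)
Lemma local_inverse (f : C -> C) (z0 : C) (r : R) : (0 < r)%R ->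
  (forall z, (Cmod (z - z0) <= r)%R -> cont f z) ->
  (forall z w, (Cmod (z - z0) <= r)%R -> (Cmod (w - z0) <= r)%R -> f z = f w -> z = w) ->
  exists (eps : R) (Phi : C -> C), (0 < eps)%R /\ forall w, (Cmod (w - f z0) < eps)%R ->
    (Cmod (Phi w - z0) < r)%R /\ f (Phi w) = w /\ cont Phi w.
Proof.
  intros Hr Hc Hi. destruct (open_map_disc f z0 r Hr Hc Hi) as (eps & He & Hw).
  assert (S : forall w, exists z, (Cmod (w - f z0) < eps)%R -> (Cmod (z - z0) < r)%R /\ f z = w).
  { intros w. destruct (Rlt_le_dec (Cmod (w - f z0)) eps) as [H|H].
    - destruct (Hw w H) as [z Hz]. now exists z.
    - exists 0. lra. }
  set (Phi := fun w => proj1_sig (constructive_indefinite_description _ (S w))).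
  assert (HP : forall w, (Cmod (w - f z0) < eps)%R -> (Cmod (Phi w - z0) < r)%R /\ f (Phi w) = w).
  { intros w. unfold Phi. now destruct (constructive_indefinite_description _ (S w)). }
  exists eps, Phi. split; [exact He|]. intros w1 H1. destruct (HP w1 H1) as [P1 P2].
  split; [exact P1|]. split; [exact P2|]. intros eta Heta.
  set (e1 := Rmin (eta / 2) ((r - Cmod (Phi w1 - z0)) / 2)).
  assert (He1 : (0 < e1)%R) by (apply Rmin_pos; lra).
  assert (He2 : (e1 <= eta / 2)%R) by apply Rmin_l.
  assert (He3 : (e1 <= (r - Cmod (Phi w1 - z0)) / 2)%R) by apply Rmin_r.
  assert (Sub : forall z, (Cmod (z - Phi w1) <= e1)%R -> (Cmod (z - z0) <= r)%R).
  { intros z Hz. assert (T := Cmod_triangle (z - Phi w1) (Phi w1 - z0)).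
    replace (z - Phi w1 + (Phi w1 - z0)) with (z - z0) in T by ring. lra. }
  destruct (open_map_disc f (Phi w1) e1 He1) as (d & Hd & HD).
  - intros z Hz. apply Hc. now apply Sub.
  - intros z w Hz Hzw. apply Hi; now apply Sub.
  - rewrite P2 in HD. exists (Rmin d (eps - Cmod (w1 - f z0))). split; [apply Rmin_pos; lra|].
    intros w Hlt. assert (L1 := Rlt_min_l Hlt). assert (L2 := Rlt_min_r Hlt).
    destruct (HD w L1) as (z & Hz1 & Hz2).
    assert (Hwe : (Cmod (w - f z0) < eps)%R).
    { assert (T := Cmod_triangle (w - w1) (w1 - f z0)). replace (w - w1 + (w1 - f z0)) with (w - f z0) in T by ring. lra. }
    destruct (HP w Hwe) as [Q1 Q2].
    assert (Ez : Phi w = z) by (apply Hi; [lra|apply Sub; lra|now rewrite Q2, Hz2]).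
    rewrite Ez. lra.
Qed.

Lemma polar (z : C) : exists t, z = RtoC (Cmod z) * cis t.
Proof.
  destruct (total_order_T (Re z) 0) as [[H|H]|H].
  - assert (H' : (0 < Re (- z))%R) by (change (0 < - Re z)%R; lra).
    exists (atan (Im (- z) / Re (- z)) + PI)%R. rewrite cis_PI.
    assert (E := cis_atan (- z) H'). rewrite Cmod_opp in E.
    replace (RtoC (Cmod z) * - cis (atan (Im (- z) / Re (- z)))) with (- (RtoC (Cmod z) * cis (atan (Im (- z) / Re (- z))))) by ring.
    rewrite <- E. ring.
  - assert (E : z = RtoC (Im z) * Ci) by (rewrite (C_eta z) at 1; rewrite H; ring).
    assert (HC : Cmod z = Rabs (Im z)) by (rewrite E at 1; now rewrite Cmod_mult, Cmod_Ci, Cmod_R, Rmult_1_r).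
    assert (C2 : cis (PI / 2) = Ci) by (unfold cis; now rewrite cos_PI2, sin_PI2).
    destruct (Rle_lt_dec 0 (Im z)) as [Hi|Hi].
    + exists (PI / 2)%R. rewrite C2, HC, Rabs_pos_eq by exact Hi. exact E.
    + exists (PI / 2 + PI)%R. rewrite cis_PI, C2, HC, Rabs_left by exact Hi. rewrite E at 1. rewrite RtoC_opp. ring.
  - eexists. now apply cis_atan.
Qed.

(** The real mean value theorem is applied to Re (conj(D) H) along the segment, with [D] the whole
    increment; this keeps the constant [M], where separate coordinates would lose a factor. *)
Lemma rdiff_MVT (H a b : C -> C) (z0 w : C) (M : R) :
  (forall s : R, (0 <= s <= 1)%R -> let z := z0 + RtoC s * w in
     rdiff H z (a z) (b z) /\ (Cmod (a z) + Cmod (b z) <= M)%R) ->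
  (Cmod (H (z0 + w)%C - H z0) <= M * Cmod w)%R.
Proof.
  intros HH. set (D := H (z0 + w) - H z0).
  destruct (Rle_lt_or_eq_dec 0 (Cmod D) (Cmod_ge_0 D)) as [HD|HD].
  2:{ rewrite <- HD. destruct (HH 0%R ltac:(lra)) as [_ HM]. cbv zeta in HM.
      assert (T1 := Cmod_ge_0 (a (z0 + RtoC 0 * w))). assert (T2 := Cmod_ge_0 (b (z0 + RtoC 0 * w))).
      assert (T := Cmod_ge_0 w). nra. }
  set (p := fun s : R => z0 + RtoC s * w).
  set (phi := fun s : R => Re (Cconj D * H (p s))).
  set (dphi := fun s : R => Re (Cconj D * a (p s) * w + Cconj D * b (p s) * Cconj w)).
  assert (Dphi : forall s, (0 <= s <= 1)%R -> is_derive phi s (dphi s)).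
  { intros s Hs. destruct (HH s Hs) as [R1 _]. fold (p s) in R1.
    apply (rdiff_curve (fun z => Cconj D * H z) p); [now apply rdiff_scal|].
    apply is_derive_C_pair. unfold p. split; simpl; auto_derive; trivial; unfold Re, Im; simpl; ring. }
  destruct (MVT_gen phi 0 1 dphi) as (s & Hs & E).
  - rewrite Rmin_left, Rmax_right by lra. intros s Hs. apply Dphi. lra.
  - rewrite Rmin_left, Rmax_right by lra. intros s Hs. apply continuity_pt_filterlim.
    apply (ex_derive_continuous (V := R_NormedModule)). eexists. now apply Dphi.
  - rewrite Rmin_left, Rmax_right in Hs by lra.
    assert (E1 : (phi 1 - phi 0 = Cmod D ^ 2)%R).
    { unfold phi, p. replace (z0 + RtoC 1 * w) with (z0 + w) by ring. replace (z0 + RtoC 0 * w) with z0 by ring.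
      transitivity (Re (Cconj D * D)); [|rewrite Cmod2_alt; destruct D; simpl; ring].
      replace (Cconj D * D) with (Cconj D * H (z0 + w) - Cconj D * H z0) by (unfold D; ring). reflexivity. }
    destruct (HH s Hs) as [_ HM]. cbv zeta in HM. fold (p s) in HM.
    assert (B : (Rabs (dphi s) <= Cmod D * (M * Cmod w))%R).
    { eapply Rle_trans; [apply re_le_Cmod|]. eapply Rle_trans; [apply Cmod_triangle|].
      rewrite !Cmod_mult, !Cmod_conj.
      replace (Cmod D * Cmod (a (p s)) * Cmod w + Cmod D * Cmod (b (p s)) * Cmod w)%R
        with (Cmod D * ((Cmod (a (p s)) + Cmod (b (p s))) * Cmod w))%R by ring.
      apply Rmult_le_compat_l; [lra|]. apply Rmult_le_compat_r; [apply Cmod_ge_0|exact HM]. }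
    assert (B2 := Rle_abs (dphi s)). rewrite E in E1.
    assert (Cmod D * Cmod D <= Cmod D * (M * Cmod w))%R by nra.
    apply Rmult_le_reg_l with (Cmod D); assumption.
Qed.

(** [p1] and [p2] are signed distances to the lines bounding the sector, which is the set where both
    are positive because beta < PI. Where their minimum is 0, one vanishes and the other is
    nonnegative; this places the point on a bounding ray and not on the opposite one. *)
Lemma sector_crossing (v : R -> C) (tau beta t0 t1 r0 r1 : R) :
  (forall u, (0 <= u <= 1)%R -> continuity_pt (fun s => Re (v s)) u /\ continuity_pt (fun s => Im (v s)) u) ->
  (0 < beta < PI)%R -> (0 < r0)%R -> (0 < r1)%R ->
  v 0%R = RtoC r0 * cis t0 -> v 1%R = RtoC r1 * cis t1 ->
  (tau < t0 < tau + beta)%R -> (tau + beta < t1 < tau + beta + PI)%R ->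
  exists u x : R, (0 <= u <= 1)%R /\ (0 <= x)%R /\ (v u = RtoC x * cis tau \/ v u = RtoC x * cis (tau + beta)).
Proof.
  intros Hv Hb Hr0 Hr1 E0 E1 Ht0 Ht1.
  set (p1 := fun u => (Im (v u) * cos tau - Re (v u) * sin tau)%R).
  set (p2 := fun u => (Re (v u) * sin (tau + beta) - Im (v u) * cos (tau + beta))%R).
  assert (P : forall u r t, v u = RtoC r * cis t -> p1 u = (r * sin (t - tau))%R /\ p2 u = (r * sin (tau + beta - t))%R).
  { intros u r t E. unfold p1, p2. rewrite E, !sin_minus. unfold cis; simpl. split; ring. }
  assert (C1 : forall u, (0 <= u <= 1)%R -> continuity_pt p1 u).
  { intros u Hu. destruct (Hv u Hu) as [V1 V2]. unfold p1. apply continuity_pt_minus.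
    - apply (continuity_pt_mult (fun u => Im (v u)) (fun _ => cos tau)); [exact V2|apply continuity_pt_const_fun].
    - apply (continuity_pt_mult (fun u => Re (v u)) (fun _ => sin tau)); [exact V1|apply continuity_pt_const_fun]. }
  assert (C2 : forall u, (0 <= u <= 1)%R -> continuity_pt p2 u).
  { intros u Hu. destruct (Hv u Hu) as [V1 V2]. unfold p2. apply continuity_pt_minus.
    - apply (continuity_pt_mult (fun u => Re (v u)) (fun _ => sin (tau + beta))); [exact V1|apply continuity_pt_const_fun].
    - apply (continuity_pt_mult (fun u => Im (v u)) (fun _ => cos (tau + beta))); [exact V2|apply continuity_pt_const_fun]. }
  (* This is -2 min (p1, p2), written with an absolute value to make its continuity evident. *)
  set (m := fun u => (Rabs (p1 u - p2 u) - (p1 u + p2 u))%R).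
  assert (Hm : forall u, m u = (- 2 * Rmin (p1 u) (p2 u))%R).
  { intros u. unfold m, Rmin, Rabs. destruct (Rcase_abs (p1 u - p2 u)), (Rle_dec (p1 u) (p2 u)); lra. }
  assert (Cm : forall u, (0 <= u <= 1)%R -> continuity_pt m u).
  { intros u Hu. unfold m. apply continuity_pt_minus.
    - apply (continuity_pt_comp (fun u => p1 u - p2 u)%R Rabs); [|apply Rcontinuity_abs].
      apply continuity_pt_minus; auto.
    - apply continuity_pt_plus; auto. }
  destruct (P _ _ _ E0) as [A1 A2]. destruct (P _ _ _ E1) as [B1 B2].
  destruct (IVT_interv m 0 1 Cm Rlt_0_1) as (u & Hu & Eu).
  - rewrite Hm, A1, A2.
    assert (0 < sin (t0 - tau))%R by (apply sin_gt_0; lra).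
    assert (0 < sin (tau + beta - t0))%R by (apply sin_gt_0; lra).
    assert (0 < Rmin (r0 * sin (t0 - tau)) (r0 * sin (tau + beta - t0)))%R by (apply Rmin_pos; nra). lra.
  - rewrite Hm, B2. assert (sin (tau + beta - t1) < 0)%R.
    { replace (tau + beta - t1)%R with (- (t1 - (tau + beta)))%R by ring. rewrite sin_neg.
      assert (0 < sin (t1 - (tau + beta)))%R by (apply sin_gt_0; lra). lra. }
    assert (T := Rmin_r (p1 1) (r1 * sin (tau + beta - t1))). nra.
  - assert (Em : Rmin (p1 u) (p2 u) = 0%R) by (rewrite Hm in Eu; lra).
    assert (Q1 := Rmin_l (p1 u) (p2 u)). assert (Q2 := Rmin_r (p1 u) (p2 u)). rewrite Em in Q1, Q2.
    assert (K : p1 u = 0%R \/ p2 u = 0%R).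
    { unfold Rmin in Em. destruct (Rle_dec (p1 u) (p2 u)); auto. }
    assert (Hsb : (0 < sin beta)%R) by (apply sin_gt_0; lra).
    assert (X : forall t, exists x, x = (Re (v u) * cos t + Im (v u) * sin t)%R /\ ((Im (v u) * cos t - Re (v u) * sin t = 0)%R -> v u = RtoC x * cis t)).
    { intros t. eexists. split; [reflexivity|]. intros Hz.
      assert (S := sin2_cos2 t). unfold Rsqr in S.
      apply Ceq_Re_Im; unfold cis; simpl.
      - change (fst (v u)) with (Re (v u)). change (snd (v u)) with (Im (v u)).
        transitivity (Re (v u) * (sin t * sin t + cos t * cos t) + sin t * (Im (v u) * cos t - Re (v u) * sin t))%R; [rewrite S, Hz; ring|ring].
      - change (fst (v u)) with (Re (v u)). change (snd (v u)) with (Im (v u)).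
        transitivity (Im (v u) * (sin t * sin t + cos t * cos t) - cos t * (Im (v u) * cos t - Re (v u) * sin t))%R; [rewrite S, Hz; ring|ring]. }
    destruct K as [K|K].
    + destruct (X tau) as (x & _ & Hx). specialize (Hx K). exists u, x. split; [exact Hu|].
      destruct (P _ _ _ Hx) as [_ K2]. replace (tau + beta - tau)%R with beta in K2 by ring. split; [nra|now left].
    + destruct (X (tau + beta)%R) as (x & _ & Hx). assert (K' : (Im (v u) * cos (tau + beta) - Re (v u) * sin (tau + beta) = 0)%R) by (unfold p2 in K; lra).
      specialize (Hx K'). exists u, x. split; [exact Hu|].
      destruct (P _ _ _ Hx) as [K2 _]. replace (tau + beta - tau)%R with beta in K2 by ring. split; [nra|now right].
Qed.

Lemma psum_zero (c : nat -> C) (n : nat) (z : C) : (forall j, (j < n)%nat -> c j = 0) -> psum c n z = 0.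
Proof.
  induction n as [|n IH]; intros H; [reflexivity|]. simpl. rewrite IH, H by auto. ring.
Qed.

(** Take the first nonzero Taylor coefficient. If there is none, |F z| is at most K / 2^n for all
    positive [n] on the smaller disc, hence 0. *)
Lemma hol_leading (R0 : R) (F F' : C -> C) : (0 < R0)%R -> hol R0 F F' ->
  exists r, (0 < r < R0)%R /\
  ((forall z, (Cmod z <= r)%R -> F z = 0) \/
   exists (k : nat) (A : C) (K : R), A <> 0 /\ (F 0 = 0 -> (0 < k)%nat) /\ (0 < K)%R /\
     forall z, (Cmod z <= r)%R -> (Cmod (F z - A * z ^ k) <= K * Cmod z ^ S k)%R).
Proof.
  intros HR HF. destruct (taylor R0 F F' HR HF) as (c & r & K & Hr & HK & HT).
  exists (r / 2)%R. split; [lra|].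
  destruct (classic (exists k, c k <> 0)) as [Hex|Hn].
  - right. destruct Hex as [k0 Hk0].
    destruct (dec_inh_nat_subset_has_unique_least_element (fun k => c k <> 0)) as (k & (Hk & Hmin) & _).
    + intros k. apply classic.
    + now exists k0.
    + assert (Hlow : forall j, (j < k)%nat -> c j = 0).
      { intros j Hj. apply NNPP. intros H. specialize (Hmin j H). lia. }
      exists k, (c k), (K / r ^ S k)%R. split; [exact Hk|]. split; [|split].
      * intros HF0. destruct k as [|k]; [|lia]. exfalso. apply Hk.
        assert (T := HT 1%nat 0). simpl in T. rewrite HF0, Cmod_0 in T.
        specialize (T ltac:(lra)).
        replace (0 - (0 + c 0%nat * 1)) with (- c 0%nat) in T by ring. rewrite Cmod_opp in T.
        apply Cmod_eq_0. assert (T2 := Cmod_ge_0 (c 0%nat)).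
        replace (K * (0 / r * 1))%R with 0%R in T by (field; lra). lra.
      * apply Rdiv_lt_0_compat; [exact HK|apply pow_lt; lra].
      * intros z Hz. specialize (HT (S k) z Hz). change (psum c (S k) z) with (psum c k z + c k * z ^ k) in HT.
        rewrite psum_zero, Cplus_0_l in HT by exact Hlow.
        eapply Rle_trans; [exact HT|]. right. unfold Rdiv. rewrite Rpow_mult_distr, pow_inv. ring.
  - left. intros z Hz. apply Cmod_eq_0. apply (pow_bound_zero _ K (1 / 2)); [lra|].
    intros n _. rewrite Rabs_pos_eq by apply Cmod_ge_0. specialize (HT n z Hz).
    rewrite psum_zero in HT by (intros j _; apply NNPP; intros H; apply Hn; now exists j).
    replace (F z - 0) with (F z) in HT by ring. eapply Rle_trans; [exact HT|].
    apply Rmult_le_compat_l; [lra|]. apply pow_incr. split; [apply Rdiv_le_0_compat; [apply Cmod_ge_0|lra]|].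
    apply Rle_div_l; lra.
Qed.

(** With a = G_z and b = G_zbar the hypothesis says that the Jacobian is 0, and the conclusion that
    Re (c G) has zero gradient. For a nonzero, both conj(b) - conj(a) and i (conj(a) + conj(b))
    satisfy the equation, and they cannot both vanish. *)
Lemma real_kernel (a b : C) : Cmod a = Cmod b -> exists c : C, c <> 0 /\ c * a + Cconj (c * b) = 0.
Proof.
  intros H.
  assert (H2 : a * Cconj a = b * Cconj b) by (rewrite <- !Cmod2_conj, H; reflexivity).
  destruct (classic (a = 0)) as [Ha|Ha].
  - exists 1. split; [intros E; apply (f_equal Re) in E; simpl in E; lra|].
    assert (Hb : b = 0) by (apply Cmod_eq_0; rewrite <- H, Ha; apply Cmod_0).
    rewrite Ha, Hb. apply Ceq_Re_Im; simpl; ring.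
  - destruct (classic (Ci * (Cconj b + Cconj a) = 0)) as [E|E].
    + exists (Cconj b - Cconj a). split.
      * intros E2. assert (E3 : Ci * (2 * Cconj a) = 0).
        { replace (Ci * (2 * Cconj a)) with (Ci * (Cconj b + Cconj a) - Ci * (Cconj b - Cconj a)) by ring. rewrite E, E2. ring. }
        apply Ha. apply Cmod_eq_0. apply (f_equal Cmod) in E3. rewrite !Cmod_mult, Cmod_Ci, Cmod_conj, Cmod_0, (Cmod_pos_eq 2) in E3 by lra. lra.
      * rewrite Cmult_conj, Cminus_conj, !Cconj_conj.
        replace ((Cconj b - Cconj a) * a + (b - a) * Cconj b) with (b * Cconj b - a * Cconj a) by ring. rewrite H2. ring.
    + exists (Ci * (Cconj b + Cconj a)). split; [exact E|].
      rewrite !Cmult_conj, Cplus_conj, !Cconj_conj.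
      replace (Cconj Ci) with (- Ci) by (apply Ceq_Re_Im; simpl; ring).
      replace (Ci * (Cconj b + Cconj a) * a + - Ci * (b + a) * Cconj b) with (Ci * (a * Cconj a - b * Cconj b)) by ring. rewrite H2. ring.
Qed.

Lemma Rsign_pigeonhole (a b c : R) : a <> 0%R -> b <> 0%R -> c <> 0%R ->
  (0 < a * b \/ 0 < b * c \/ 0 < a * c)%R.
Proof.
  intros Ha Hb Hc.
  destruct (Rdichotomy _ _ Ha), (Rdichotomy _ _ Hb), (Rdichotomy _ _ Hc);
  (left; nra) || (right; left; nra) || (right; right; nra).
Qed.

Lemma cis_alternate (k : nat) : cis (INR k * PI) = RtoC ((-1) ^ k)%R.
Proof.
  induction k as [|k IH].
  - simpl. rewrite Rmult_0_l. apply cis_0.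
  - rewrite S_INR. replace ((INR k + 1) * PI)%R with (INR k * PI + PI)%R by ring. rewrite cis_PI, IH, <- RtoC_opp.
    f_equal. simpl. ring.
Qed.

Lemma cis_pow (n : nat) (t : R) : cis t ^ n = cis (INR n * t).
Proof.
  induction n as [|n IH].
  - simpl. rewrite Rmult_0_l. symmetry. apply cis_0.
  - rewrite S_INR. change (cis t ^ S n) with (cis t * cis t ^ n). rewrite IH, <- cis_plus. f_equal. ring.
Qed.

(** Topological core: an injective planar map cannot straighten the zero set of a function which
    behaves like [Re (A z^n)], [n >= 2]: that set meets at least three of the sectors in which the
    rays where [U] alternates in sign cut a small disc, while its image, a segment of a line through
    the origin, only has two halves. *)
Lemma no_straightening (G : C -> C) (z0 c A : C) (n : nat) (K r : R) :
  c <> 0 -> A <> 0 -> (2 <= n)%nat -> (0 < K)%R -> (0 < r)%R ->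
  (forall z, (Cmod (z - z0) <= r)%R -> cont G z) ->
  (forall z w, (Cmod (z - z0) <= r)%R -> (Cmod (w - z0) <= r)%R -> G z = G w -> z = w) ->
  (forall w, (Cmod w <= r)%R ->
     (Rabs (Re (c * (G (z0 + w)%C - G z0)) - Re (A * w ^ n)) <= K * Cmod w ^ S n)%R) -> False.
Proof.
  intros Hc HA Hn HK Hr HG Hi HU.
  set (U := fun w => Re (c * (G (z0 + w) - G z0))).
  assert (Hn' : (2 <= INR n)%R) by (apply (le_INR 2); exact Hn).
  assert (HA' := proj1 (Cmod_gt_0 _) HA). assert (Hc' := proj1 (Cmod_gt_0 _) Hc).
  assert (Hpi := PI_RGT_0).
  destruct (polar A) as [al Hal].
  (* On the ray of angle [tau k] the value of A w^n is real of sign (-1)^k; consecutive rays are PI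
     / n apart. *)
  set (tau := fun k : nat => ((INR k * PI - al) / INR n)%R).
  set (beta := (PI / INR n)%R).
  assert (Hbeta : (0 < beta <= PI / 2)%R).
  { unfold beta. split; [apply Rdiv_lt_0_compat; lra|]. apply Rmult_le_compat_l; [lra|]. apply Rinv_le_contravar; lra. }
  assert (Htau : forall k, (tau k + beta)%R = tau (S k)).
  { intros k. unfold tau, beta. rewrite S_INR. field. lra. }
  (* Below this radius the error K |w|^(n+1) is at most half of |A w^n|, so [U] keeps the sign of
     its leading term on the rays. *)
  set (rho := Rmin (r / 2) (Cmod A / (2 * K))).
  assert (Hrho : (0 < rho)%R) by (apply Rmin_pos; [lra|apply Rdiv_lt_0_compat; lra]).
  assert (Hrho1 : (rho <= r / 2)%R) by apply Rmin_l.
  assert (Hrho2 : (K * rho <= Cmod A / 2)%R).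
  { apply Rle_trans with (K * (Cmod A / (2 * K)))%R; [apply Rmult_le_compat_l; [lra|apply Rmin_r]|right; field; lra]. }
  assert (Ray : forall k x, (0 < x <= rho)%R -> (0 < (-1) ^ k * U (RtoC x * cis (tau k))%C)%R).
  { intros k x Hx.
    assert (HC : Cmod (RtoC x * cis (tau k)) = x) by (rewrite Cmod_mult, Cmod_cis, Cmod_pos_eq; lra).
    assert (H := HU (RtoC x * cis (tau k))). rewrite HC in H. specialize (H ltac:(lra)).
    fold (U (RtoC x * cis (tau k))) in H.
    assert (E : A * (RtoC x * cis (tau k)) ^ n = RtoC (Cmod A * x ^ n * (-1) ^ k)%R).
    { rewrite Cpow_mult_l, cis_pow, Hal at 1.
      replace (RtoC (Cmod A) * cis al * (RtoC x ^ n * cis (INR n * tau k))) with (RtoC (Cmod A) * RtoC x ^ n * (cis al * cis (INR n * tau k))) by ring.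
      rewrite <- cis_plus. replace (al + INR n * tau k)%R with (INR k * PI)%R by (unfold tau; field; lra).
      rewrite cis_alternate, <- RtoC_pow, <- !RtoC_mult. reflexivity. }
    rewrite E in H. simpl (Re (RtoC _)) in H.
    assert (Hxn : (0 < x ^ n)%R) by (apply pow_lt; lra).
    assert (B : (K * x ^ S n <= Cmod A / 2 * x ^ n)%R).
    { change (x ^ S n)%R with (x * x ^ n)%R. rewrite <- Rmult_assoc. apply Rmult_le_compat_r; [lra|]. nra. }
    assert (S1 : ((-1) ^ k = 1 \/ (-1) ^ k = -1)%R).
    { clear. induction k as [|k [IH|IH]]; simpl; [left; ring|rewrite IH; right; ring|rewrite IH; left; ring]. }
    apply Rabs_le_between in H.
    assert (P : (0 < Cmod A * x ^ n)%R) by now apply Rmult_lt_0_compat.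
    destruct S1 as [S1|S1]; rewrite S1 in *; lra. }
  assert (CU : forall w, (Cmod w < r)%R -> cont (fun w => c * (G (z0 + w) - G z0)) w).
  { intros w Hw. apply cont_mult; [apply cont_const|]. apply cont_minus; [|apply cont_const].
    apply (cont_comp (fun w => z0 + w) G); [apply cont_plus; [apply cont_const|apply cont_id]|].
    apply HG. replace (z0 + w - z0) with w by ring. lra. }
  assert (Zero : forall k x, (0 < x <= rho)%R -> exists t, (tau k < t < tau k + beta)%R /\ U (RtoC x * cis t) = 0%R).
  { intros k x Hx. rewrite Htau. assert (R1 := Ray k x Hx). assert (R2 := Ray (S k) x Hx).
    assert (Hlt : (tau k < tau (S k))%R) by (rewrite <- Htau; lra).
    assert (S2 : ((-1) ^ S k = - (-1) ^ k)%R) by (simpl; ring). rewrite S2 in R2.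
    destruct (IVT_interv (fun t => - (-1) ^ k * U (RtoC x * cis t)%C)%R (tau k) (tau (S k))) as (t & Ht & Et).
    - intros t _. apply (continuity_pt_mult (fun _ => (- (-1) ^ k)%R) (fun t => U (RtoC x * cis t))); [apply continuity_pt_const_fun|].
      apply (contR_pt (fun t => c * (G (z0 + RtoC x * cis t) - G z0))).
      apply (contR_comp (fun w => c * (G (z0 + w) - G z0)) (fun t => RtoC x * cis t)).
      + apply contR_mult; [apply contR_const|apply contR_cis].
      + intros s. apply CU. rewrite Cmod_mult, Cmod_cis, Cmod_pos_eq; lra.
    - exact Hlt.
    - lra.
    - exact R2.
    - assert (Sn : ((-1) ^ k <> 0)%R) by (apply pow_nonzero; lra).
      assert (EU : U (RtoC x * cis t) = 0%R).
      { apply Rmult_integral in Et. destruct Et as [Et|Et]; [|exact Et]. exfalso. apply Sn. lra. }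
      exists t. split; [|exact EU]. split.
      + destruct (proj1 Ht) as [|E]; [assumption|]. exfalso. rewrite E, EU in R1. lra.
      + destruct (proj2 Ht) as [|E]; [assumption|]. exfalso. rewrite <- E, EU in R2. lra. }
  destruct (local_inverse G z0 rho Hrho) as (eps & Phi & Heps & HPhi).
  { intros z Hz. apply HG. lra. }
  { intros z w Hz Hw. apply Hi; lra. }
  destruct (HG z0 ltac:(rewrite Cminus_diag, Cmod_0; lra) eps Heps) as (d & Hd & HGd).
  set (x := Rmin rho (d / 2)).
  assert (Hx : (0 < x <= rho)%R) by (split; [apply Rmin_pos; lra|apply Rmin_l]).
  assert (Hxd : (x <= d / 2)%R) by apply Rmin_r.
  (* [dir] spans the line on which Re (c w) vanishes, so [G] sends a zero of [U] to [G z0 + s * dir]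
     with [s] real. *)
  set (dir := Ci * Cconj c).
  assert (Hcd : forall s : R, Re (c * (RtoC s * dir)) = 0%R).
  { intros s. unfold dir. destruct c; simpl; ring. }
  assert (Hdir : (0 < Cmod dir)%R) by (unfold dir; rewrite Cmod_mult, Cmod_Ci, Cmod_conj; lra).
  assert (Par : forall t, U (RtoC x * cis t) = 0%R -> exists s, s <> 0%R /\
     (Cmod (RtoC s * dir) < eps)%R /\ Phi (G z0 + RtoC s * dir) = z0 + RtoC x * cis t).
  { intros t Ht. set (z := z0 + RtoC x * cis t).
    assert (Hz : Cmod (z - z0) = x) by (apply circle_point; lra).
    set (y := Im (c * (G z - G z0))). exists (y / (Cmod c ^ 2))%R.
    assert (Hc2 : (0 < Cmod c ^ 2)%R) by nra.
    assert (Ec : c * (G z - G z0) = Ci * RtoC y).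
    { rewrite (C_eta (c * (G z - G z0))). fold y. unfold U in Ht. fold z in Ht. rewrite Ht. ring. }
    assert (E : RtoC (y / Cmod c ^ 2)%R * dir = G z - G z0).
    { unfold dir. rewrite RtoC_div by lra.
      transitivity (Ci * RtoC y * Cconj c / (RtoC (Cmod c ^ 2)%R)).
      - field. intros E. apply (f_equal Re) in E. simpl in E. simpl in Hc2. lra.
      - rewrite <- Ec, Cmod2_conj. field. split; [|exact Hc]. apply Cmod_gt_0. rewrite Cmod_conj. exact Hc'. }
    rewrite E. replace (G z0 + (G z - G z0)) with (G z) by ring.
    assert (HGz : (Cmod (G z - G z0) < eps)%R) by (apply HGd; lra).
    split; [|split].
    - intros E0. rewrite E0 in E. assert (Ez : G z = G z0) by (apply Ceq_minus; rewrite <- E; ring).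
      apply Hi in Ez; [|lra|rewrite Cminus_diag, Cmod_0; lra]. rewrite Ez, Cminus_diag, Cmod_0 in Hz. lra.
    - exact HGz.
    - destruct (HPhi (G z) HGz) as (P1 & P2 & _). apply Hi; [lra|lra|exact P2]. }
  (* Suppose two zeros in different sectors have images on the same half of the line. The segment
     joining these images avoids [G z0]; its pullback by [Phi] consists of zeros of [U] other than
     the centre, and yet it must cross a ray where [U] is nonzero. *)
  assert (Key : forall k t t' s s', (tau k < t < tau k + beta)%R -> (tau k + beta < t' < tau k + beta + PI)%R ->
     (0 < s * s')%R -> (Cmod (RtoC s * dir) < eps)%R -> (Cmod (RtoC s' * dir) < eps)%R ->
     Phi (G z0 + RtoC s * dir) = z0 + RtoC x * cis t -> Phi (G z0 + RtoC s' * dir) = z0 + RtoC x * cis t' -> False).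
  { intros k t t' s s' Ht Ht' Hss Hs Hs' Es Es'.
    set (l := fun u : R => (s + u * (s' - s))%R).
    assert (Hl : forall u, (0 <= u <= 1)%R -> (Cmod (G z0 + RtoC (l u) * dir - G z0) < eps)%R /\ l u <> 0%R).
    { intros u Hu. replace (G z0 + RtoC (l u) * dir - G z0) with (RtoC (l u) * dir) by ring. split.
      - rewrite Cmod_mult, Cmod_R in *. unfold l.
        assert (B : (Rabs (s + u * (s' - s)) <= Rmax (Rabs s) (Rabs s'))%R).
        { replace (s + u * (s' - s))%R with ((1 - u) * s + u * s')%R by ring.
          eapply Rle_trans; [apply Rabs_triang|]. rewrite !Rabs_mult, (Rabs_pos_eq (1 - u)), (Rabs_pos_eq u) by lra.
          assert (M1 := Rmax_l (Rabs s) (Rabs s')). assert (M2 := Rmax_r (Rabs s) (Rabs s')).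
          assert (N1 := Rmult_le_compat_l (1 - u) _ _ ltac:(lra) M1). assert (N2 := Rmult_le_compat_l u _ _ ltac:(lra) M2). lra. }
        eapply Rle_lt_trans; [apply Rmult_le_compat_r; [lra|exact B]|].
        unfold Rmax. destruct (Rle_dec (Rabs s) (Rabs s')); assumption.
      - unfold l. intros E. assert (E2 : ((1 - u) * (s * s) + u * (s * s') = 0)%R).
        { replace ((1 - u) * (s * s) + u * (s * s'))%R with (s * (s + u * (s' - s)))%R by ring. rewrite E. ring. }
        assert (Hs2 : (0 < s * s)%R) by (apply Rlt_0_sqr; intros ->; lra).
        destruct (Rle_lt_dec u (1 / 2)); nra. }
    set (v := fun u => Phi (G z0 + RtoC (l u) * dir) - z0).
    destruct (sector_crossing v (tau k) beta t t' x x) as (u & y & Hu & Hy & Huy).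
    - intros u Hu. destruct (Hl u Hu) as [L1 _]. destruct (HPhi _ L1) as (_ & _ & CP).
      apply (cont_curve (fun w => Phi (G z0 + RtoC (l (Im w)) * dir) - z0) (fun _ => 0%R) (fun u => u)).
      + apply cont_minus; [|apply cont_const].
        apply (cont_comp (fun w => G z0 + RtoC (l (Im w)) * dir) Phi); [|exact CP].
        apply cont_plus; [apply cont_const|]. apply cont_mult; [|apply cont_const].
        apply (cont_ext_loc (fun w => RtoC s + RtoC (Im w) * RtoC (s' - s)%R) _ _ 1 Rlt_0_1).
        * intros w _. unfold l. now rewrite RtoC_plus, RtoC_mult.
        * apply cont_plus; [apply cont_const|]. apply cont_mult; [apply (cont_Im (fun w => w)), cont_id|apply cont_const].
      + apply continuity_pt_const_fun.
      + apply derivable_continuous_pt, derivable_pt_id.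
    - lra.
    - lra.
    - lra.
    - unfold v, l. replace (s + 0 * (s' - s))%R with s by ring. rewrite Es. ring.
    - unfold v, l. replace (s + 1 * (s' - s))%R with s' by ring. rewrite Es'. ring.
    - exact Ht.
    - exact Ht'.
    - rewrite Htau in Huy. destruct (Hl u Hu) as [L1 L2]. destruct (HPhi _ L1) as (P1 & P2 & _).
      fold (v u) in P1.
      assert (EU : U (v u) = 0%R).
      { unfold U, v. replace (z0 + (Phi (G z0 + RtoC (l u) * dir) - z0)) with (Phi (G z0 + RtoC (l u) * dir)) by ring.
        rewrite P2. replace (G z0 + RtoC (l u) * dir - G z0) with (RtoC (l u) * dir) by ring. apply Hcd. }
      assert (Hv0 : v u <> 0).
      { intros E. unfold v in E. apply Ceq_minus in E. rewrite E in P2.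
        assert (E2 : RtoC (l u) * dir = 0).
        { replace (RtoC (l u) * dir) with (G z0 + RtoC (l u) * dir - G z0) by ring. rewrite <- P2. ring. }
        apply (f_equal Cmod) in E2. rewrite Cmod_mult, Cmod_R, Cmod_0 in E2.
        assert (T := Rabs_pos_lt _ L2). nra. }
      assert (Q : exists j, v u = RtoC y * cis (tau j)) by (destruct Huy as [H|H]; eexists; exact H).
      destruct Q as [j Q].
      assert (HC : Cmod (v u) = y) by (rewrite Q, Cmod_mult, Cmod_cis, Cmod_pos_eq; lra).
      apply Cmod_gt_0 in Hv0. assert (R := Ray j y ltac:(lra)). rewrite <- Q, EU in R. lra. }
  destruct (Zero 0%nat x Hx) as (t0 & Ht0 & Z0). destruct (Zero 1%nat x Hx) as (t1 & Ht1 & Z1).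
  destruct (Zero 2%nat x Hx) as (t2 & Ht2 & Z2).
  destruct (Par t0 Z0) as (s0 & S0 & S0' & E0). destruct (Par t1 Z1) as (s1 & S1 & S1' & E1). destruct (Par t2 Z2) as (s2 & S2 & S2' & E2).
  assert (T0 := Htau 0%nat). assert (T1 := Htau 1%nat).
  (* Two of the three parameters have the same sign. For sectors 0 and 2 the angular range in [Key]
     amounts to 2 beta <= PI, which is n >= 2. *)
  destruct (Rsign_pigeonhole s0 s1 s2 S0 S1 S2) as [H|[H|H]].
  - apply (Key 0%nat t0 t1 s0 s1); auto; lra.
  - apply (Key 1%nat t1 t2 s1 s2); auto; lra.
  - apply (Key 0%nat t0 t2 s0 s2); auto; lra.
Qed.

Lemma loc_univ_disc (G : C -> C) (z0 : C) : locally_univalent G -> disk z0 ->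
  exists r, (0 < r)%R /\ (forall z, (Cmod (z - z0) <= r)%R -> disk z) /\
   forall z w, (Cmod (z - z0) <= r)%R -> (Cmod (w - z0) <= r)%R -> G z = G w -> z = w.
Proof.
  intros HG Hz. destruct (HG z0 Hz) as (r & Hr & Hi). destruct (disk_open z0 Hz) as (d & Hd & HD).
  exists (Rmin (r / 2) (d / 2)). split; [apply Rmin_pos; lra|].
  assert (M1 := Rmin_l (r / 2) (d / 2)). assert (M2 := Rmin_r (r / 2) (d / 2)).
  split.
  - intros z Hzz. apply HD. lra.
  - intros z w H1 H2. apply Hi; [apply HD| apply HD | |]; lra.
Qed.

(** A zero Jacobian makes the differential degenerate, so some U = Re (c (G - G z0)) is critical at
    [z0]. As [U] is real harmonic, its gradient is carried by the holomorphic F = 2 U_z, with F z0 =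
    0. Either [F] vanishes near [z0] and [G] maps a disc into a line, against openness; or F behaves
    like A w^k with k >= 1 and [U] like Re (A w^(k+1) / (k+1)), against [no_straightening]. *)
Theorem lewy (G : C -> C) (z0 : C) : harmonic G -> locally_univalent G -> disk z0 -> jacobian G z0 <> 0%R.
Proof.
  intros HG HL Hz HJ.
  destruct (harmonic_hol G HG) as (CG & _ & _ & Hh & Hg).
  assert (Hm : Cmod (d_z G z0) = Cmod (d_zbar G z0)).
  { unfold jacobian in HJ. assert (T1 := Cmod_ge_0 (d_z G z0)). assert (T2 := Cmod_ge_0 (d_zbar G z0)). nra. }
  destruct (real_kernel _ _ Hm) as (c & Hc & E).
  set (F := fun z => c * d_z G z + Cconj (c * d_zbar G z)).
  set (F' := fun z => c * d_z (d_z G) z + Cconj c * Cconj (d_zbar (d_zbar G) z)).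
  assert (HF : hol 1 F F').
  { intros z Hzz. destruct (Hh z Hzz) as [A1 A2]. destruct (Hg z Hzz) as [B1 B2]. split.
    - eapply (rdiff_ext_loc (fun z => c * d_z G z + Cconj c * Cconj (d_zbar G z)) F z _ _ 1 Rlt_0_1).
      + intros w _. unfold F. now rewrite Cmult_conj.
      + eapply rdiff_val; [reflexivity| |apply rdiff_plus; apply rdiff_scal; [exact A1|exact B1]]. ring.
    - apply cont_plus; (apply cont_mult; [apply cont_const|assumption]). }
  assert (HU : forall z, disk z -> rdiff (fun z => RtoC (Re (c * (G z - G z0)))) z (F z / 2) (Cconj (F z) / 2)).
  { intros z Hzz. destruct (CG z Hzz) as [D _].
    assert (D1 := rdiff_scal c _ _ _ _ (rdiff_minus _ _ _ _ _ _ _ D (rdiff_const (G z0) z))).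
    assert (D2 := rdiff_scal (/ 2) _ _ _ _ (rdiff_plus _ _ _ _ _ _ _ D1 (rdiff_conj _ _ _ _ D1))).
    eapply (rdiff_ext_loc _ _ z _ _ 1 Rlt_0_1); [|eapply rdiff_val; [| |exact D2]].
    - intros w _. rewrite re_alt. unfold Cdiv. ring.
    - unfold F. rewrite !Cmult_conj, Cminus_conj. replace (Cconj 0) with (RtoC 0) by (apply Ceq_Re_Im; simpl; ring). unfold Cdiv. ring.
    - unfold F. rewrite Cplus_conj, Cconj_conj, !Cmult_conj, Cminus_conj. replace (Cconj 0) with (RtoC 0) by (apply Ceq_Re_Im; simpl; ring). unfold Cdiv. ring. }
  assert (HF0 := hol_shift F F' z0 HF).
  destruct (loc_univ_disc G z0 HL Hz) as (r1 & Hr1 & HD1 & Hi1).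
  destruct (hol_leading (1 - Cmod z0) _ _ ltac:(unfold disk in Hz; lra) HF0) as (r & Hr & Hcase).
  set (r2 := Rmin r1 r). assert (Hr2 : (0 < r2)%R) by (apply Rmin_pos; lra).
  assert (M1 := Rmin_l r1 r). assert (M2 := Rmin_r r1 r). fold r2 in M1, M2.
  assert (Hsub : forall w, (Cmod w <= r2)%R -> disk (z0 + w)).
  { intros w Hw. apply HD1. replace (z0 + w - z0) with w by ring. lra. }
  assert (Hseg : forall (w : C) (s : R), (0 <= s <= 1)%R -> (Cmod (RtoC s * w) <= Cmod w)%R).
  { intros w s Hs. rewrite Cmod_mult, Cmod_pos_eq by lra. assert (T := Cmod_ge_0 w). nra. }
  assert (CGr : forall z, (Cmod (z - z0) <= r2)%R -> cont G z).
  { intros z Hzz. eapply rdiff_cont. apply CG. apply HD1. lra. }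
  destruct Hcase as [HZ|(k & A & K & HA & Hk & HK & HB)].
  - assert (HUc : forall w, (Cmod w <= r2)%R -> Re (c * (G (z0 + w) - G z0)) = 0%R).
    { intros w Hw.
      assert (B : (Cmod (RtoC (Re (c * (G (z0 + w)%C - G z0))) - RtoC (Re (c * (G z0 - G z0)))) <= 0 * Cmod w)%R).
      { apply (rdiff_MVT (fun z => RtoC (Re (c * (G z - G z0)))) (fun z => F z / 2) (fun z => Cconj (F z) / 2) z0 w 0).
        intros s Hs z. assert (Hsw := Hseg w s Hs). split; [apply HU, Hsub; lra|].
        unfold z. rewrite HZ by lra. replace (Cconj 0) with (RtoC 0) by (apply Ceq_Re_Im; simpl; ring).
        unfold Cdiv. rewrite Cmult_0_l, Cmod_0. lra. }
      rewrite Cminus_diag, Cmult_0_r, Rmult_0_l in B. simpl (Re 0) in B.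
      replace (RtoC (Re (c * (G (z0 + w) - G z0))) - 0) with (RtoC (Re (c * (G (z0 + w) - G z0)))) in B by ring.
      rewrite Cmod_R in B. assert (T := Rabs_pos (Re (c * (G (z0 + w) - G z0)))).
      apply NNPP. intros Hne. apply Rabs_pos_lt in Hne. lra. }
    destruct (open_map_disc G z0 r2 Hr2 CGr) as (eps & Heps & HO).
    { intros z w H1 H2. apply Hi1; lra. }
    assert (Hc' := proj1 (Cmod_gt_0 _) Hc).
    (* The value [G z0 + s * Cconj c] is close enough to be attained but lies off the line: there
       [U] equals s |c|^2. *)
    set (s := (eps / 2 / Cmod c)%R). assert (Hs : (0 < s)%R) by (apply Rdiv_lt_0_compat; lra).
    destruct (HO (G z0 + RtoC s * Cconj c)) as (z & Hzz & Ez).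
    { replace (G z0 + RtoC s * Cconj c - G z0) with (RtoC s * Cconj c) by ring.
      rewrite Cmod_mult, Cmod_conj, Cmod_pos_eq by lra. unfold s. replace (eps / 2 / Cmod c * Cmod c)%R with (eps / 2)%R by (field; lra). lra. }
    assert (H := HUc (z - z0) ltac:(lra)). replace (z0 + (z - z0)) with z in H by ring. rewrite Ez in H.
    replace (c * (G z0 + RtoC s * Cconj c - G z0)) with (RtoC s * (c * Cconj c)) in H by ring.
    rewrite <- Cmod2_conj, <- RtoC_mult in H. change (s * Cmod c ^ 2 = 0)%R in H.
    assert (0 < s * Cmod c ^ 2)%R by (apply Rmult_lt_0_compat; [exact Hs|now apply pow_lt]). lra.
  - assert (Hk' : (0 < k)%nat).
    { apply Hk. unfold F. rewrite Cplus_0_r. exact E. }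
    set (n := S k). assert (Hnn : (0 < INR n)%R) by (apply lt_0_INR; unfold n; lia).
    assert (HnC : RtoC (INR n) <> 0) by (intros E0; apply RtoC_inj in E0; lra).
    set (B := A / RtoC (INR n)).
    assert (HBC : B <> 0).
    { unfold B, Cdiv. apply Cmult_neq_0; [exact HA|]. apply Cmod_gt_0. rewrite Cmod_inv by exact HnC. apply Rinv_0_lt_compat. now apply Cmod_gt_0. }
    apply (no_straightening G z0 c B n K r2 Hc HBC); [unfold n; lia|exact HK|exact Hr2|exact CGr| |].
    + intros z w H1 H2. apply Hi1; lra.
    + intros w Hw.
      (* [U] minus the real part of the primitive A u^n / n. Its Wirtinger derivatives are half of F
         - A u^k and half of its conjugate, so the mean value bound integrates the remainder and
         gains one power of |w|. *)
      set (V := fun u => RtoC (Re (c * (G (z0 + u) - G z0))) - RtoC (Re (B * u ^ n))).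
      assert (HV : (Cmod (V (0 + w)%C - V 0) <= K * Cmod w ^ n * Cmod w)%R).
      { apply (rdiff_MVT V (fun u => (F (z0 + u) - A * u ^ k) / 2) (fun u => Cconj (F (z0 + u) - A * u ^ k) / 2) 0 w).
        intros s Hs z. assert (Hsw := Hseg w s Hs). assert (Ez : z = RtoC s * w) by (unfold z; ring). rewrite Ez. split.
        - assert (D1 := rdiff_shift (fun z => RtoC (Re (c * (G z - G z0)))) z0 (RtoC s * w) _ _ (HU _ (Hsub (RtoC s * w) ltac:(lra)))).
          assert (D2 := rdiff_scal B _ _ _ _ (rdiff_pow n (RtoC s * w))).
          assert (D3 := rdiff_scal (/ 2) _ _ _ _ (rdiff_plus _ _ _ _ _ _ _ D2 (rdiff_conj _ _ _ _ D2))).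
          assert (D4 := rdiff_minus _ _ _ _ _ _ _ D1 D3).
          assert (E1 : B * (RtoC (INR n) * (RtoC s * w) ^ (n - 1)) = A * (RtoC s * w) ^ k).
          { unfold B. replace (n - 1)%nat with k by (unfold n; lia). field. exact HnC. }
          rewrite E1 in D4.
          eapply (rdiff_ext_loc _ _ _ _ _ 1 Rlt_0_1); [|eapply rdiff_val; [| |exact D4]].
          + intros u _. unfold V. rewrite (re_alt (B * u ^ n)). unfold Cdiv. ring.
          + replace (Cconj (B * 0)) with (RtoC 0) by (rewrite Cmult_0_r; apply Ceq_Re_Im; simpl; ring). unfold Cdiv. ring.
          + rewrite Cminus_conj. unfold Cdiv. ring.
        - unfold Cdiv. rewrite !Cmod_mult, Cmod_conj, Cmod_inv by (intros E0; injection E0; lra).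
          rewrite (Cmod_pos_eq 2) by lra.
          assert (HBs := HB (RtoC s * w) ltac:(lra)).
          assert (P : (K * Cmod (RtoC s * w) ^ n <= K * Cmod w ^ n)%R).
          { apply Rmult_le_compat_l; [lra|]. apply pow_incr. split; [apply Cmod_ge_0|exact Hsw]. }
          fold n in HBs. lra. }
      rewrite Cplus_0_l in HV.
      assert (V0 : V 0 = 0).
      { unfold V. rewrite Cplus_0_r, Cminus_diag, Cmult_0_r. unfold n. simpl (0 ^ S k). rewrite Cmult_0_l, Cmult_0_r. simpl. ring. }
      rewrite V0 in HV. replace (V w - 0) with (V w) in HV by ring.
      unfold V in HV. rewrite <- RtoC_minus, Cmod_R in HV.
      eapply Rle_trans; [exact HV|]. right. simpl. ring.
Qed.

(** * Nonexistence of proper sense-preserving harmonic immersions of the disk into the plane *)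

Lemma rdiff_comp_lin (F : C -> C) (z0 c w a b : C) :
  rdiff F (z0 + c * w) a b -> rdiff (fun u => F (z0 + c * u)) w (a * c) (b * Cconj c).
Proof.
  intros H eps Heps.
  assert (Hc : (0 < Cmod c + 1)%R) by (assert (T := Cmod_ge_0 c); lra).
  destruct (H (eps / (Cmod c + 1))%R ltac:(now apply Rdiv_lt_0_compat)) as (d & Hd & Hw).
  exists (d / (Cmod c + 1))%R. split; [now apply Rdiv_lt_0_compat|]. intros u Hu.
  apply Rlt_div_r in Hu; [|exact Hc].
  assert (T := Cmod_ge_0 u). assert (Tc := Cmod_ge_0 c).
  specialize (Hw (c * u)). rewrite Cmod_mult in Hw. specialize (Hw ltac:(nra)).
  replace (F (z0 + c * (w + u)) - F (z0 + c * w) - (a * c * u + b * Cconj c * Cconj u))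
    with (F (z0 + c * w + c * u) - F (z0 + c * w) - (a * (c * u) + b * Cconj (c * u))).
  - eapply Rle_trans; [exact Hw|].
    replace (eps / (Cmod c + 1) * (Cmod c * Cmod u))%R with (Cmod c / (Cmod c + 1) * (eps * Cmod u))%R by (field; lra).
    assert (Q : (Cmod c / (Cmod c + 1) <= 1)%R) by (apply Rle_div_l; lra).
    assert (0 <= eps * Cmod u)%R by nra. nra.
  - rewrite Cmult_conj. replace (z0 + c * (w + u)) with (z0 + c * w + c * u) by ring. ring.
Qed.

(** Sum over the fourth roots of unity. Applied to increments it is a discrete Laplacian: w,
    conj(w), w^2 and conj(w)^2 all cancel, and of the terms up to second order only |w|^2
    remains. *)
Definition sum4 (F : C -> C) : C := F 1 + F Ci + F (- (1)) + F (- Ci).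

Lemma Cmod_sum4 (F : C -> C) (M : R) : (forall c, Cmod c = 1%R -> (Cmod (F c) <= M)%R) -> (Cmod (sum4 F) <= 4 * M)%R.
Proof.
  intros H. unfold sum4.
  assert (H1 := H 1 Cmod_1). assert (H2 := H Ci Cmod_Ci).
  assert (H3 := H (- (1)) ltac:(rewrite Cmod_opp; apply Cmod_1)). assert (H4 := H (- Ci) ltac:(rewrite Cmod_opp; apply Cmod_Ci)).
  assert (T1 := Cmod_triangle (F 1 + F Ci + F (- (1))) (F (- Ci))).
  assert (T2 := Cmod_triangle (F 1 + F Ci) (F (- (1)))). assert (T3 := Cmod_triangle (F 1) (F Ci)). lra.
Qed.

(** A harmonic map has no |w|^2 term, so the sum is o(|w|^2). The argument runs on the derivatives
    of the sum: constants drop because the four roots sum to 0, linear parts because their squares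
    do. The mean value bound integrates the remainders. *)
Lemma four_point (G h g : C -> C) (z1 h' g' : C) (d : R) : (0 < d)%R ->
  (forall w, (Cmod w < d)%R -> rdiff G (z1 + w) (h (z1 + w)) (g (z1 + w))) ->
  rdiff h z1 h' 0 -> rdiff g z1 0 g' ->
  forall eta : R, (0 < eta)%R -> exists e0 : R, (0 < e0)%R /\ forall w, (Cmod w < e0)%R ->
    (Cmod (sum4 (fun c => G (z1 + c * w) - G z1)%C) <= eta * Cmod w ^ 2)%R.
Proof.
  intros Hd HG Hh Hg eta Heta.
  destruct (Hh (eta / 8)%R ltac:(lra)) as (d1 & Hd1 & H1). destruct (Hg (eta / 8)%R ltac:(lra)) as (d2 & Hd2 & H2).
  exists (Rmin d (Rmin d1 d2)). split; [repeat apply Rmin_pos; assumption|]. intros w Hw.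
  assert (Hwd := Rlt_min_l Hw). assert (Hw' := Rlt_min_r Hw).
  assert (Hw1 := Rlt_min_l Hw'). assert (Hw2 := Rlt_min_r Hw').
  set (N := fun u => sum4 (fun c => G (z1 + c * u))).
  set (a := fun u => sum4 (fun c => h (z1 + c * u) * c)).
  set (b := fun u => sum4 (fun c => g (z1 + c * u) * Cconj c)).
  assert (RN : forall u, (Cmod u < d)%R -> rdiff N u (a u) (b u)).
  { intros u Hu. unfold N, a, b, sum4.
    assert (K : forall c, Cmod c = 1%R -> rdiff (fun u => G (z1 + c * u)) u (h (z1 + c * u) * c) (g (z1 + c * u) * Cconj c)).
    { intros c Hc. apply rdiff_comp_lin. apply HG. rewrite Cmod_mult, Hc. lra. }
    repeat apply rdiff_plus; apply K; rewrite ?Cmod_opp; apply Cmod_1 || apply Cmod_Ci. }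
  assert (Ba : forall u, (Cmod u < d1)%R -> (Cmod (a u) <= eta / 2 * Cmod u)%R).
  { intros u Hu. replace (a u) with (sum4 (fun c => (h (z1 + c * u) - h z1 - (h' * (c * u) + 0 * Cconj (c * u))) * c)).
    - eapply Rle_trans; [apply Cmod_sum4 with (M := (eta / 8 * Cmod u)%R)|right; field].
      intros c Hc. rewrite Cmod_mult, Hc, Rmult_1_r. specialize (H1 (c * u)). rewrite Cmod_mult, Hc, Rmult_1_l in H1. now apply H1.
    - unfold a, sum4.
      transitivity (h (z1 + 1 * u) * 1 + h (z1 + Ci * u) * Ci + h (z1 + - (1) * u) * - (1) + h (z1 + - Ci * u) * - Ci - h' * u * 2 * (1 + Ci * Ci)); [ring|rewrite Ci_sqr; ring]. }
  assert (Bb : forall u, (Cmod u < d2)%R -> (Cmod (b u) <= eta / 2 * Cmod u)%R).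
  { intros u Hu. replace (b u) with (sum4 (fun c => (g (z1 + c * u) - g z1 - (0 * (c * u) + g' * Cconj (c * u))) * Cconj c)).
    - eapply Rle_trans; [apply Cmod_sum4 with (M := (eta / 8 * Cmod u)%R)|right; field].
      intros c Hc. rewrite Cmod_mult, Cmod_conj, Hc, Rmult_1_r. specialize (H2 (c * u)). rewrite Cmod_mult, Hc, Rmult_1_l in H2. now apply H2.
    - unfold b, sum4. rewrite !Cmult_conj, !Copp_conj.
      replace (Cconj 1) with (RtoC 1) by (apply Ceq_Re_Im; simpl; ring).
      replace (Cconj Ci) with (- Ci) by (apply Ceq_Re_Im; simpl; ring).
      transitivity (g (z1 + 1 * u) * 1 + g (z1 + Ci * u) * - Ci + g (z1 + - (1) * u) * - (1) + g (z1 + - Ci * u) * - - Ci - g' * Cconj u * 2 * (1 + Ci * Ci)); [ring|rewrite Ci_sqr; ring]. }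
  assert (HM : (Cmod (N (0 + w)%C - N 0) <= eta * Cmod w * Cmod w)%R).
  { apply (rdiff_MVT N a b 0 w). intros s Hs z. assert (Ez : z = RtoC s * w) by (unfold z; ring). rewrite Ez.
    assert (Hsw : (Cmod (RtoC s * w) <= Cmod w)%R).
    { rewrite Cmod_mult, Cmod_pos_eq by lra. assert (T := Cmod_ge_0 w). nra. }
    split; [apply RN; lra|]. assert (B1 := Ba (RtoC s * w) ltac:(lra)). assert (B2 := Bb (RtoC s * w) ltac:(lra)). nra. }
  replace (sum4 (fun c => G (z1 + c * w) - G z1)) with (N (0 + w) - N 0); [eapply Rle_trans; [exact HM|right; ring]|].
  unfold N, sum4. rewrite Cplus_0_l, !Cmult_0_r, Cplus_0_r. ring.
Qed.

(** Discrete form of the harmonicity of log |F|. The pair F(w) F(-w) equals c0^2 + kap w^2 up to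
    O(|w|^3), and replacing w by i w reverses the sign of kap w^2, so the second-order terms cancel
    in the product of the two pairs. *)
Lemma four_product (R0 : R) (F F' : C -> C) : (0 < R0)%R -> hol R0 F F' ->
  exists e0 K : R, (0 < e0)%R /\ (0 < K)%R /\ forall w, (Cmod w < e0)%R ->
    (Cmod (F w * F (Ci * w)%C * F (- w)%C * F (- (Ci * w))%C) <= Cmod (F 0) ^ 4 + K * Cmod w ^ 3)%R.
Proof.
  intros HR HF. destruct (taylor R0 F F' HR HF) as (c & r & K0 & Hr & HK0 & HT).
  set (K := (K0 / r ^ 3)%R). assert (HK : (0 < K)%R) by (apply Rdiv_lt_0_compat; [lra|apply pow_lt; lra]).
  assert (H3 : forall w, (Cmod w <= r / 2)%R -> (Cmod (F w - (c 0%nat + c 1%nat * w + c 2%nat * (w * w))) <= K * Cmod w ^ 3)%R).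
  { intros w Hw. specialize (HT 3%nat w Hw). simpl psum in HT.
    replace (c 0%nat + c 1%nat * w + c 2%nat * (w * w)) with (0 + c 0%nat * 1 + c 1%nat * (w * 1) + c 2%nat * (w * (w * 1))) by ring.
    eapply Rle_trans; [exact HT|]. right. unfold K, Rdiv. rewrite Rpow_mult_distr, pow_inv. ring. }
  assert (E0 : c 0%nat = F 0).
  { assert (H := H3 0 ltac:(rewrite Cmod_0; lra)). rewrite Cmod_0 in H.
    replace (F 0 - (c 0%nat + c 1%nat * 0 + c 2%nat * (0 * 0))) with (F 0 - c 0%nat) in H by ring.
    assert (T := Cmod_ge_0 (F 0 - c 0%nat)). symmetry. apply Ceq_minus, Cmod_eq_0. simpl in H. lra. }
  set (c0 := c 0%nat) in *. set (c1 := c 1%nat) in *. set (c2 := c 2%nat) in *.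
  set (M := (Cmod c0 + Cmod c1 + Cmod c2)%R).
  assert (P0 := Cmod_ge_0 c0). assert (P1 := Cmod_ge_0 c1). assert (P2 := Cmod_ge_0 c2).
  set (kap := 2 * c0 * c2 - c1 * c1).
  set (K1 := (Cmod c2 * Cmod c2 + 2 * M * K + K * K)%R).
  assert (HM : (0 <= M)%R) by (unfold M; lra).
  assert (HMK := Rmult_le_pos _ _ HM (Rlt_le _ _ HK)).
  assert (HK1 : (0 < K1)%R) by (unfold K1; nra).
  assert (Pair : forall w, (Cmod w <= r / 2)%R -> (Cmod w <= 1)%R ->
    (Cmod (F w * F (- w)%C - (c0 * c0 + kap * (w * w))) <= K1 * Cmod w ^ 3)%R).
  { intros w Hw Hw1. assert (T := Cmod_ge_0 w).
    assert (HA := H3 w Hw). assert (HB := H3 (- w) ltac:(rewrite Cmod_opp; exact Hw)). rewrite Cmod_opp in HB.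
    set (e1 := F w - (c0 + c1 * w + c2 * (w * w))) in *.
    set (e2 := F (- w) - (c0 + c1 * - w + c2 * (- w * - w))) in *.
    set (x := Cmod w) in *.
    replace (F w * F (- w) - (c0 * c0 + kap * (w * w))) with
      (c2 * c2 * (w * w * (w * w)) + ((c0 + c1 * w + c2 * (w * w)) * e2 + ((c0 + c1 * - w + c2 * (w * w)) * e1 + e1 * e2)))
      by (unfold e1, e2, kap; ring).
    assert (X2 : (0 <= x * x <= 1)%R) by nra.
    assert (X3 : (0 <= x ^ 3 <= 1)%R) by (simpl; nra).
    assert (A1 : forall s : C, Cmod s = 1%R -> (Cmod (c0 + c1 * (s * w) + c2 * (w * w)) <= M)%R).
    { intros s Hs. eapply Rle_trans; [apply Cmod_triangle|]. eapply Rle_trans; [apply Rplus_le_compat_r, Cmod_triangle|].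
      rewrite !Cmod_mult, Hs. fold x. unfold M. nra. }
    assert (A2 := A1 1 Cmod_1). assert (A3 := A1 (- (1)) ltac:(rewrite Cmod_opp; apply Cmod_1)).
    replace (1 * w) with w in A2 by ring. replace (- (1) * w) with (- w) in A3 by ring.
    eapply Rle_trans; [apply Cmod_triangle|]. eapply Rle_trans; [apply Rplus_le_compat_l, Cmod_triangle|].
    eapply Rle_trans; [apply Rplus_le_compat_l, Rplus_le_compat_l, Cmod_triangle|].
    rewrite !Cmod_mult. fold x.
    assert (Y1 : (Cmod c2 * Cmod c2 * (x * x * (x * x)) <= Cmod c2 * Cmod c2 * x ^ 3)%R).
    { apply Rmult_le_compat_l; [nra|]. simpl. nra. }
    assert (Y2 : (Cmod (c0 + c1 * w + c2 * (w * w)) * Cmod e2 <= M * (K * x ^ 3))%R).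
    { apply Rmult_le_compat; try apply Cmod_ge_0; assumption. }
    assert (Y3 : (Cmod (c0 + c1 * - w + c2 * (w * w)) * Cmod e1 <= M * (K * x ^ 3))%R).
    { apply Rmult_le_compat; try apply Cmod_ge_0; assumption. }
    assert (Y4 : (Cmod e1 * Cmod e2 <= (K * x ^ 3) * (K * 1))%R).
    { apply Rmult_le_compat; try apply Cmod_ge_0; [assumption|]. eapply Rle_trans; [exact HB|]. apply Rmult_le_compat_l; lra. }
    unfold K1. lra. }
  set (Q := (Cmod kap * Cmod kap + 2 * K1 * (Cmod (F 0) ^ 2 + Cmod kap) + K1 * K1)%R).
  assert (Pk := Cmod_ge_0 kap). assert (PF := Cmod_ge_0 (F 0)).
  assert (PF2 : (0 <= Cmod (F 0) ^ 2)%R) by (simpl; nra).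
  exists (Rmin (r / 2) 1), (Q + 1)%R. split; [apply Rmin_pos; lra|]. split.
  { unfold Q. nra. }
  intros w Hw. assert (Hw1 := Rlt_min_l Hw). assert (Hw2 := Rlt_min_r Hw).
  assert (HwC : Cmod (Ci * w) = Cmod w) by (rewrite Cmod_mult, Cmod_Ci; ring).
  assert (HA := Pair w ltac:(lra) ltac:(lra)). assert (HB := Pair (Ci * w) ltac:(lra) ltac:(lra)).
  rewrite HwC in HB. replace (Ci * w * (Ci * w)) with (Ci * Ci * (w * w)) in HB by ring. rewrite Ci_sqr in HB.
  set (x := Cmod w) in *. assert (T : (0 <= x)%R) by apply Cmod_ge_0.
  set (u := kap * (w * w)) in *.
  replace (kap * (- (1) * (w * w))) with (- u) in HB by (unfold u; ring).
  set (e1 := F w * F (- w) - (c0 * c0 + u)) in *. set (e2 := F (Ci * w) * F (- (Ci * w)) - (c0 * c0 + - u)) in *.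
  replace (F w * F (Ci * w) * F (- w) * F (- (Ci * w))) with
    (c0 * c0 * (c0 * c0) + (- (u * u) + ((c0 * c0 + u) * e2 + ((c0 * c0 + - u) * e1 + e1 * e2)))) by (unfold e1, e2; ring).
  assert (X2 : (0 <= x * x <= 1)%R) by nra.
  assert (X3 : (0 <= x ^ 3 <= 1)%R) by (simpl; nra).
  assert (Hu : Cmod u = (Cmod kap * (x * x))%R) by (unfold u; rewrite !Cmod_mult; reflexivity).
  assert (Hu1 : (0 <= Cmod u <= Cmod kap)%R) by (rewrite Hu; nra).
  eapply Rle_trans; [apply Cmod_triangle|]. eapply Rle_trans; [apply Rplus_le_compat_l, Cmod_triangle|].
  eapply Rle_trans; [apply Rplus_le_compat_l, Rplus_le_compat_l, Cmod_triangle|].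
  eapply Rle_trans; [apply Rplus_le_compat_l, Rplus_le_compat_l, Rplus_le_compat_l, Cmod_triangle|].
  rewrite !Cmod_mult, Cmod_opp, Cmod_mult.
  assert (A2 : (Cmod (c0 * c0 + u) <= Cmod (F 0) ^ 2 + Cmod kap)%R).
  { eapply Rle_trans; [apply Cmod_triangle|]. rewrite Cmod_mult, E0. simpl. lra. }
  assert (A3 : (Cmod (c0 * c0 + - u) <= Cmod (F 0) ^ 2 + Cmod kap)%R).
  { eapply Rle_trans; [apply Cmod_triangle|]. rewrite Cmod_mult, Cmod_opp, E0. simpl. lra. }
  assert (Y1 : (Cmod u * Cmod u <= Cmod kap * Cmod kap * x ^ 3)%R).
  { rewrite Hu. replace (Cmod kap * (x * x) * (Cmod kap * (x * x)))%R with (Cmod kap * Cmod kap * (x * x ^ 3))%R by (simpl; ring).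
    apply Rmult_le_compat_l; [nra|]. nra. }
  assert (Y2 : (Cmod (c0 * c0 + u) * Cmod e2 <= (Cmod (F 0) ^ 2 + Cmod kap) * (K1 * x ^ 3))%R).
  { apply Rmult_le_compat; try apply Cmod_ge_0; assumption. }
  assert (Y3 : (Cmod (c0 * c0 + - u) * Cmod e1 <= (Cmod (F 0) ^ 2 + Cmod kap) * (K1 * x ^ 3))%R).
  { apply Rmult_le_compat; try apply Cmod_ge_0; assumption. }
  assert (Y4 : (Cmod e1 * Cmod e2 <= (K1 * x ^ 3) * (K1 * 1))%R).
  { apply Rmult_le_compat; try apply Cmod_ge_0; [assumption|]. eapply Rle_trans; [exact HB|]. apply Rmult_le_compat_l; lra. }
  rewrite E0 in *. unfold Q. simpl (Cmod (F 0) ^ 4)%R. simpl (Cmod (F 0) ^ 2)%R in *. lra.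
Qed.

Lemma ln_le_sub (y : R) : (0 < y)%R -> (ln y <= y - 1)%R.
Proof.
  intros Hy. destruct (Req_dec y 1) as [->|Hn]; [rewrite ln_1; lra|].
  rewrite <- (ln_exp (y - 1)). apply ln_le; [exact Hy|].
  assert (H := exp_ineq1_le (y - 1)). lra.
Qed.

Lemma ln_ge_quadratic (x : R) : (- (1 / 2) <= x)%R -> (x - 2 * x ^ 2 <= ln (1 + x))%R.
Proof.
  intros Hx. assert (H := ln_le_sub (/ (1 + x)) ltac:(apply Rinv_0_lt_compat; lra)).
  rewrite ln_Rinv in H by lra.
  assert (E : (1 - / (1 + x) = x - x ^ 2 * / (1 + x))%R) by (field; lra).
  assert (I : (/ (1 + x) <= 2)%R).
  { rewrite <- (Rinv_inv 2). apply Rinv_le_contravar; lra. }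
  assert (x ^ 2 * / (1 + x) <= x ^ 2 * 2)%R by (apply Rmult_le_compat_l; [simpl; nra|exact I]). lra.
Qed.

Lemma small_enough (l : list R) : (forall b, In b l -> (0 < b)%R) ->
  exists e : R, (0 < e)%R /\ forall b, In b l -> (e < b)%R.
Proof.
  induction l as [|a l IH]; intros H.
  - exists 1%R. split; [lra|]. intros b [].
  - destruct IH as (e & He & Hl). { intros b Hb. apply H. now right. }
    assert (Ha : (0 < a)%R) by (apply H; now left).
    exists (Rmin e (a / 2)). split; [apply Rmin_pos; lra|]. intros b [->|Hb].
    + assert (T := Rmin_r e (b / 2)). lra.
    + assert (T := Rmin_l e (a / 2)). specialize (Hl b Hb). lra.
Qed.

Lemma Cmod2_diff (a b : C) :
  (Cmod b ^ 2 - Cmod a ^ 2 = 2 * Re (Cconj a * (b - a)) + Cmod (b - a) ^ 2)%R.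
Proof. rewrite !Cmod2_alt. destruct a, b; simpl; ring. Qed.

(** Keller-Osserman estimate at a local maximum of [exp |z|^2 (Rad^2 - |G|^2) / |G_z|]: comparing with
    the four neighbours [z1 + c e], [c^4 = 1], replaces the Laplacian of the logarithm. *)
Lemma keller_osserman (G : C -> C) (z1 : C) (Rad : R) : harmonic G -> disk z1 -> (0 < Rad)%R ->
  (Cmod (d_zbar G z1) <= Cmod (d_z G z1))%R -> d_z G z1 <> 0 -> (Cmod (G z1) < Rad)%R ->
  (exists d, (0 < d)%R /\ forall z, (Cmod (z - z1) < d)%R -> (Cmod (G z) < Rad)%R -> d_z G z <> 0 ->
    (exp (Cmod z ^ 2) * (Rad ^ 2 - Cmod (G z) ^ 2) / Cmod (d_z G z) <=
     exp (Cmod z1 ^ 2) * (Rad ^ 2 - Cmod (G z1) ^ 2) / Cmod (d_z G z1))%R) ->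
  (Rad ^ 2 - Cmod (G z1) ^ 2 <= 16 * Rad * Cmod (d_z G z1))%R.
Proof.
  intros HG Hz HR Hgh Hh0 HGR (d & Hd & Hmax).
  destruct (harmonic_hol G HG) as (CG & _ & _ & Hh & Hg).
  set (h := d_z G) in *. set (lam := Cmod (h z1)) in *.
  assert (Hlam : (0 < lam)%R) by now apply Cmod_gt_0.
  set (T1 := (Rad ^ 2 - Cmod (G z1) ^ 2)%R) in *.
  assert (G1 := Cmod_ge_0 (G z1)).
  assert (HT1 : (0 < T1 <= Rad ^ 2)%R) by (unfold T1; simpl; nra).
  destruct (disk_open z1 Hz) as (d1 & Hd1 & HD1).
  destruct (CG z1 Hz) as [RG _].
  destruct (RG lam Hlam) as (d2 & Hd2 & H2).
  assert (HDel : forall w, (Cmod w < d2)%R -> (Cmod (G (z1 + w)%C - G z1) <= 3 * lam * Cmod w)%R).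
  { intros w Hw. specialize (H2 w Hw).
    replace (G (z1 + w) - G z1) with (G (z1 + w) - G z1 - (d_z G z1 * w + d_zbar G z1 * Cconj w) + (d_z G z1 * w + d_zbar G z1 * Cconj w)) by ring.
    eapply Rle_trans; [apply Cmod_triangle|]. assert (T := Cmod_triangle (d_z G z1 * w) (d_zbar G z1 * Cconj w)).
    rewrite !Cmod_mult, Cmod_conj in T. assert (T2 := Cmod_ge_0 w). fold h lam in T, H2 |- *. nra. }
  (* Tolerance for the four-point sum of [G]: after multiplication by |G z1| < Rad it costs at most
     lam^2 e^2. *)
  assert (Heta : (0 < lam ^ 2 / Rad)%R) by (apply Rdiv_lt_0_compat; [apply pow_lt; exact Hlam|exact HR]).
  destruct (four_point G h (d_zbar G) z1 (d_z h z1) (Cconj (Cconj (d_zbar (d_zbar G) z1))) d1 Hd1) with (eta := (lam ^ 2 / Rad)%R) as (d3 & Hd3 & H3).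
  { intros w Hw. apply CG. apply HD1. now replace (z1 + w - z1) with w by ring. }
  { apply (Hh z1 Hz). }
  { eapply (rdiff_ext_loc _ _ _ _ _ 1 Rlt_0_1); [|eapply rdiff_val; [| |apply rdiff_conj; apply (proj1 (Hg z1 Hz))]].
    - intros w _. cbv beta. apply Cconj_conj.
    - apply Ceq_Re_Im; simpl; ring.
    - reflexivity. }
  { exact Heta. }
  destruct (four_product (1 - Cmod z1) _ _ ltac:(unfold disk in Hz; lra) (hol_shift h _ z1 Hh)) as (d4 & K & Hd4 & HK & H4).
  rewrite Cplus_0_r in H4. fold lam in H4.
  assert (Ch : cont h z1) by (eapply rdiff_cont; apply (Hh z1 Hz)).
  destruct (Ch lam Hlam) as (d5 & Hd5 & H5).
  assert (Hl4 : (0 < lam ^ 4)%R) by now apply pow_lt.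
  (* Besides keeping the neighbours within reach of the local estimates, the last three bounds give
     |De| <= Rad, |x| <= 1/2 inside the logarithm, and K e^3 <= lam^4 e^2. *)
  destruct (small_enough (d :: d2 :: d3 :: d4 :: d5 :: Rad / (3 * lam) :: T1 / (18 * lam * Rad) :: lam ^ 4 / K :: nil)%R) as (e & He & Hsm).
  { intros b Hb. simpl In in Hb. decompose [or] Hb; subst; try assumption; try contradiction; apply Rdiv_lt_0_compat; nra. }
  assert (He1 : (e < d)%R) by (apply Hsm; simpl; tauto). assert (He2 : (e < d2)%R) by (apply Hsm; simpl; tauto).
  assert (He3 : (e < d3)%R) by (apply Hsm; simpl; tauto). assert (He4 : (e < d4)%R) by (apply Hsm; simpl; tauto).
  assert (He5 : (e < d5)%R) by (apply Hsm; simpl; tauto).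
  assert (He6 : (e < Rad / (3 * lam))%R) by (apply Hsm; simpl; tauto).
  assert (He7 : (e < T1 / (18 * lam * Rad))%R) by (apply Hsm; simpl; tauto).
  assert (He8 : (e < lam ^ 4 / K)%R) by (apply Hsm; simpl; tauto).
  apply Rlt_div_r in He6; [|lra]. apply Rlt_div_r in He7; [|nra]. apply Rlt_div_r in He8; [|lra].
  set (w := RtoC e). assert (Hw : Cmod w = e) by (apply Cmod_pos_eq; lra).
  (* Bound for the loss 2 x^2 in [ln_ge_quadratic], where |x| <= 9 lam Rad e / T1; 162 is twice
     81. *)
  set (B := (162 * lam ^ 2 * Rad ^ 2 / T1 ^ 2 * e ^ 2)%R).
  (* Logarithm of the maximality at one neighbour: the changes of |z|^2 and of ln (Rad^2 - |G|^2)
     together do not exceed the change of ln |G_z|. *)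
  assert (Pt : forall c, Cmod c = 1%R ->
    (0 < Cmod (h (z1 + c * w)%C) /\
    (Cmod (z1 + c * w) ^ 2 - Cmod z1 ^ 2) - (2 * Re (Cconj (G z1) * (G (z1 + c * w)%C - G z1)) + 9 * lam ^ 2 * e ^ 2) / T1 - B
    <= ln (Cmod (h (z1 + c * w)%C)) - ln lam)%R).
  { intros c Hc. assert (Hcw : Cmod (c * w) = e) by (rewrite Cmod_mult, Hc, Hw; ring).
    set (z := z1 + c * w). assert (Hzz : z - z1 = c * w) by (unfold z; ring).
    set (De := G z - G z1). assert (HDe : (Cmod De <= 3 * lam * e)%R).
    { unfold De, z. rewrite <- Hcw. apply HDel. lra. }
    assert (HDe0 := Cmod_ge_0 De).
    assert (HhB : (0 < Cmod (h z))%R).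
    { specialize (H5 z). rewrite Hzz, Hcw in H5. specialize (H5 He5).
      assert (T := Cmod_triangle_sub (h z1) (h z)). rewrite Cmod_minus_sym in T. fold lam in T. lra. }
    split; [exact HhB|].
    set (m := (2 * Re (Cconj (G z1) * De) + Cmod De ^ 2)%R).
    assert (Em : (Cmod (G z) ^ 2 = Cmod (G z1) ^ 2 + m)%R).
    { unfold m, De. rewrite <- Cmod2_diff. ring. }
    assert (Bm : (Rabs m <= 9 * lam * Rad * e)%R).
    { unfold m. eapply Rle_trans; [apply Rabs_triang|]. rewrite Rabs_mult, (Rabs_pos_eq 2) by lra.
      assert (T := re_le_Cmod (Cconj (G z1) * De)). rewrite Cmod_mult, Cmod_conj in T.
      rewrite (Rabs_pos_eq (Cmod De ^ 2)) by (apply pow2_ge_0).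
      assert (Q1 : (Cmod (G z1) * Cmod De <= Rad * (3 * lam * e))%R) by (apply Rmult_le_compat; lra).
      assert (Q2 : (Cmod De ^ 2 <= 3 * lam * e * Rad)%R).
      { simpl. rewrite Rmult_1_r. apply Rmult_le_compat; lra. }
      lra. }
    set (x := (- m / T1)%R).
    assert (Ex : (Rad ^ 2 - Cmod (G z) ^ 2 = T1 * (1 + x))%R).
    { rewrite Em. unfold x. field_simplify; [unfold T1; ring|lra]. }
    assert (Bx : (Rabs x <= 9 * lam * Rad * e / T1)%R).
    { unfold x, Rdiv. rewrite Rabs_mult, Rabs_Ropp, (Rabs_pos_eq (/ T1)) by (left; apply Rinv_0_lt_compat; lra).
      apply Rmult_le_compat_r; [left; apply Rinv_0_lt_compat; lra|exact Bm]. }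
    assert (Bx2 : (9 * lam * Rad * e / T1 <= 1 / 2)%R) by (apply Rle_div_l; lra).
    assert (Bx3 : (- (1 / 2) <= x)%R) by (apply Rabs_le_between in Bx; lra).
    assert (HGz : (Cmod (G z) < Rad)%R).
    { assert (0 < T1 * (1 + x))%R by (apply Rmult_lt_0_compat; lra).
      apply Rnot_le_lt. intros HRle. assert (Rad ^ 2 <= Cmod (G z) ^ 2)%R by (apply pow_incr; lra). lra. }
    assert (HM := Hmax z ltac:(rewrite Hzz, Hcw; exact He1) HGz ltac:(apply Cmod_gt_0; exact HhB)).
    rewrite Ex in HM. fold h T1 in HM. fold lam in HM.
    apply ln_le in HM.
    2:{ apply Rdiv_lt_0_compat; [|exact HhB]. apply Rmult_lt_0_compat; [apply exp_pos|]. apply Rmult_lt_0_compat; lra. }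
    assert (LD : forall a b c, (0 < b)%R -> (0 < c)%R -> ln (exp a * b / c) = (a + ln b - ln c)%R).
    { intros a b c' Hb Hc'. assert (Ea := exp_pos a). assert (Eb := Rmult_lt_0_compat _ _ Ea Hb).
      assert (Ec := Rinv_0_lt_compat _ Hc'). unfold Rdiv.
      rewrite ln_mult, ln_mult, ln_Rinv, ln_exp by assumption. ring. }
    rewrite !LD in HM; try lra; [|apply Rmult_lt_0_compat; lra].
    rewrite ln_mult in HM by lra.
    assert (LQ := ln_ge_quadratic x Bx3).
    assert (Bxx : (2 * x ^ 2 <= B)%R).
    { assert (x ^ 2 <= (9 * lam * Rad * e / T1) ^ 2)%R.
      { rewrite <- (pow2_abs x). apply pow_incr. split; [apply Rabs_pos|exact Bx]. }
      replace B with (2 * (9 * lam * Rad * e / T1) ^ 2)%R by (unfold B; field; lra). lra. }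
    assert (Bxl : (- (2 * Re (Cconj (G z1) * De) + 9 * lam ^ 2 * e ^ 2) / T1 <= x)%R).
    { unfold x. apply Rmult_le_compat_r; [left; apply Rinv_0_lt_compat; lra|]. unfold m.
      assert (Cmod De ^ 2 <= (3 * lam * e) ^ 2)%R by (apply pow_incr; lra).
      replace (9 * lam ^ 2 * e ^ 2)%R with ((3 * lam * e) ^ 2)%R by ring. lra. }
    unfold Rdiv in Bxl. rewrite Ropp_mult_distr_l_reverse in Bxl. unfold Rdiv. lra. }
  destruct (Pt 1 Cmod_1) as [L1 P1]. destruct (Pt Ci Cmod_Ci) as [L2 P2].
  destruct (Pt (- (1)) ltac:(rewrite Cmod_opp; apply Cmod_1)) as [L3 P3].
  destruct (Pt (- Ci) ltac:(rewrite Cmod_opp; apply Cmod_Ci)) as [L4 P4].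
  specialize (H3 w ltac:(lra)). specialize (H4 w ltac:(lra)). rewrite Hw in H3, H4.
  assert (SR : (Re (Cconj (G z1) * (G (z1 + 1 * w)%C - G z1)) + Re (Cconj (G z1) * (G (z1 + Ci * w)%C - G z1)) +
     Re (Cconj (G z1) * (G (z1 + - (1) * w)%C - G z1)) + Re (Cconj (G z1) * (G (z1 + - Ci * w)%C - G z1)) <= lam ^ 2 * e ^ 2)%R).
  { match goal with |- (?L <= _)%R => replace L with (Re (Cconj (G z1) * sum4 (fun c => G (z1 + c * w) - G z1))) end.
    - eapply Rle_trans; [apply Rle_abs|]. eapply Rle_trans; [apply re_le_Cmod|]. rewrite Cmod_mult, Cmod_conj.
      apply Rle_trans with (Rad * (lam ^ 2 / Rad * e ^ 2))%R; [|right; field; lra].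
      apply Rmult_le_compat; try apply Cmod_ge_0; lra.
    - unfold sum4. rewrite !Cmult_plus_distr_l. reflexivity. }
  (* The gain from the weight exp |z|^2, whose logarithm has Laplacian 4. It exceeds the e^2
     conceded to ln |G_z| in [SL]. *)
  assert (SZ : (Cmod (z1 + 1 * w) ^ 2 + Cmod (z1 + Ci * w) ^ 2 + Cmod (z1 + - (1) * w) ^ 2 + Cmod (z1 + - Ci * w) ^ 2 - 4 * Cmod z1 ^ 2 = 4 * e ^ 2)%R).
  { rewrite !Cmod2_alt. unfold w. destruct z1; simpl; ring. }
  assert (SL : (ln (Cmod (h (z1 + 1 * w)%C)) + ln (Cmod (h (z1 + Ci * w)%C)) + ln (Cmod (h (z1 + - (1) * w)%C)) + ln (Cmod (h (z1 + - Ci * w)%C)) - 4 * ln lam <= e ^ 2)%R).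
  { replace (z1 + 1 * w) with (z1 + w) in * by ring. replace (z1 + - (1) * w) with (z1 + - w) in * by ring.
    replace (z1 + - Ci * w) with (z1 + - (Ci * w)) in * by ring.
    rewrite !Cmod_mult in H4. rewrite <- !ln_mult by (repeat apply Rmult_lt_0_compat; assumption).
    set (Pi := (Cmod (h (z1 + w)%C) * Cmod (h (z1 + Ci * w)%C) * Cmod (h (z1 + - w)%C) * Cmod (h (z1 + - (Ci * w))%C))%R) in *.
    assert (HPi : (0 < Pi)%R) by (repeat apply Rmult_lt_0_compat; assumption).
    replace (4 * ln lam)%R with (ln (lam ^ 4)) by (rewrite ln_pow by exact Hlam; simpl INR; ring).
    assert (E : (ln Pi - ln (lam ^ 4) = ln (Pi / lam ^ 4))%R) by (unfold Rdiv; rewrite ln_mult, ln_Rinv by auto using Rinv_0_lt_compat; ring).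
    rewrite E. eapply Rle_trans; [apply ln_le_sub; now apply Rdiv_lt_0_compat|].
    assert (Pi / lam ^ 4 <= 1 + e ^ 2)%R; [|lra]. apply Rle_div_l; [exact Hl4|].
    assert (K * e ^ 3 <= lam ^ 4 * e ^ 2)%R; [|lra]. simpl in *. nra. }
  assert (Total : (4 * e ^ 2 - (2 * (lam ^ 2 * e ^ 2) + 36 * lam ^ 2 * e ^ 2) / T1 - 4 * B <= e ^ 2)%R).
  { assert (HI : (0 < / T1)%R) by (apply Rinv_0_lt_compat; lra). unfold Rdiv in *.
    apply (Rmult_le_compat_r (/ T1)) in SR; [|lra]. lra. }
  (* Multiplication by T1^2 / e^2 removes the step; 38 is 2 + 36 and 648 is 4 times 162. *)
  assert (Fin : (3 * T1 ^ 2 <= 38 * lam ^ 2 * T1 + 648 * lam ^ 2 * Rad ^ 2)%R).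
  { unfold B in Total. assert (He20 : (0 < e ^ 2)%R) by now apply pow_lt.
    apply Rmult_le_reg_r with (e ^ 2 / T1 ^ 2)%R; [apply Rdiv_lt_0_compat; [exact He20|apply pow_lt; lra]|].
    replace (3 * T1 ^ 2 * (e ^ 2 / T1 ^ 2))%R with (3 * e ^ 2)%R by (field; lra).
    replace ((38 * lam ^ 2 * T1 + 648 * lam ^ 2 * Rad ^ 2) * (e ^ 2 / T1 ^ 2))%R with
      ((2 * (lam ^ 2 * e ^ 2) + 36 * lam ^ 2 * e ^ 2) / T1 + 4 * (162 * lam ^ 2 * Rad ^ 2 / T1 ^ 2 * e ^ 2))%R by (field; lra). lra. }
  assert (Hl2 : (0 < lam ^ 2)%R) by now apply pow_lt.
  (* As T1 <= Rad^2, the right side of [Fin] is at most 686 lam^2 Rad^2, and 686 / 3 < 256 =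
     16^2. *)
  assert (Fin2 : (T1 ^ 2 <= (16 * Rad * lam) ^ 2)%R).
  { replace ((16 * Rad * lam) ^ 2)%R with (256 * (lam ^ 2 * Rad ^ 2))%R by ring.
    assert (lam ^ 2 * T1 <= lam ^ 2 * Rad ^ 2)%R by (apply Rmult_le_compat_l; lra).
    assert (0 < lam ^ 2 * Rad ^ 2)%R by (apply Rmult_lt_0_compat; [lra|apply pow_lt; lra]). lra. }
  apply Rnot_lt_le. intros Hlt. assert (0 < 16 * Rad * lam)%R by (repeat apply Rmult_lt_0_compat; lra). simpl in Fin2. nra.
Qed.

Theorem no_proper_harmonic (G : C -> C) : harmonic G ->
  (forall z, disk z -> (Cmod (d_zbar G z) < Cmod (d_z G z))%R) ->
  ~ (forall M : R, exists rho, (0 < rho < 1)%R /\ forall z, disk z -> (rho <= Cmod z)%R -> (M <= Cmod (G z))%R).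
Proof.
  intros HG HJ HP.
  assert (D0 : disk 0) by (unfold disk; rewrite Cmod_0; lra).
  assert (Hh : forall z, disk z -> (0 < Cmod (d_z G z))%R).
  { intros z Hz. specialize (HJ z Hz). assert (T := Cmod_ge_0 (d_zbar G z)). lra. }
  destruct (harmonic_hol G HG) as (CG & _ & _ & Hhol & _).
  set (lam := Cmod (d_z G 0)). assert (Hlam : (0 < lam)%R) by now apply Hh.
  set (g0 := Cmod (G 0)). assert (Hg0 : (0 <= g0)%R) by apply Cmod_ge_0.
  (* 48 is the 16 of [keller_osserman] times the bound 3 for exp |z|^2 on the disk. The maximum will
     give Rad^2 - g0^2 <= 48 Rad lam, whereas this choice makes Rad^2 - 48 Rad lam = Rad (g0 + 1),
     which exceeds g0^2. *)
  set (Rad := (48 * lam + g0 + 1)%R). assert (HR : (0 < Rad)%R) by (unfold Rad; lra).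
  destruct (HP Rad) as (rho & Hrho & HGR).
  set (q := fun z => (exp (Cmod z ^ 2) * (Rad ^ 2 - Cmod (G z) ^ 2) / Cmod (d_z G z))%R).
  assert (Hin : forall z, (Cmod (z - 0) <= rho)%R -> disk z).
  { intros z Hz. rewrite Cminus_0_r in Hz. unfold disk. lra. }
  assert (Cexp : forall x : R, cont (fun w => RtoC (exp (Re w))) (RtoC x)).
  { intros x eps Heps.
    assert (CE : continuity_pt exp x) by (apply derivable_continuous_pt, derivable_pt_exp).
    destruct (CE eps Heps) as (d & Hd & H). exists d. split; [exact Hd|]. intros w Hw.
    rewrite <- RtoC_minus, Cmod_R. simpl (Re (RtoC x)).
    destruct (Req_dec x (Re w)) as [E|E]; [rewrite <- E, Rminus_diag, Rabs_R0; exact Heps|].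
    apply H. split; [now split|]. eapply Rle_lt_trans; [apply (re_le_Cmod (w - RtoC x))|exact Hw]. }
  destruct (disc_max q 0 rho) as (z1 & Hz1 & Hmax); [lra| |].
  { intros z Hz. specialize (Hin z Hz).
    apply (cont_ext_loc (fun w => RtoC (exp (Re (RtoC (Cmod w) ^ 2))) * (RtoC (Rad ^ 2)%R - RtoC (Cmod (G w)) ^ 2) * / RtoC (Cmod (d_z G w))) _ z (1 - Cmod z)).
    - unfold disk in Hin. lra.
    - intros w Hw. assert (Dw : disk w).
      { unfold disk. assert (T := Cmod_triangle_sub w z). lra. }
      assert (Hne : Cmod (d_z G w) <> 0%R) by (specialize (Hh w Dw); lra).
      unfold q, Rdiv. rewrite !RtoC_mult, RtoC_minus, RtoC_inv by exact Hne. rewrite <- !RtoC_pow. reflexivity.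
    - apply cont_mult; [apply cont_mult|].
      + apply (cont_comp (fun w => RtoC (Cmod w) ^ 2) (fun w => RtoC (exp (Re w)))).
        * apply cont_pow. apply (cont_Cmod (fun w => w)), cont_id.
        * rewrite <- RtoC_pow. apply Cexp.
      + apply cont_minus; [apply cont_const|]. apply cont_pow. apply cont_Cmod. eapply rdiff_cont. now apply CG.
      + apply cont_inv.
        * intros E. apply RtoC_inj in E. specialize (Hh z Hin). lra.
        * apply cont_Cmod. eapply rdiff_cont. now apply Hhol. }
  assert (Dz1 := Hin z1 Hz1). assert (Hl1 := Hh z1 Dz1).
  assert (Q0 : q 0 = ((Rad ^ 2 - g0 ^ 2) / lam)%R).
  { unfold q. fold g0 lam. rewrite Cmod_0. replace (0 ^ 2)%R with 0%R by ring. rewrite exp_0. unfold Rdiv. ring. }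
  assert (HRg : (0 < Rad ^ 2 - g0 ^ 2)%R) by (unfold Rad; simpl; nra).
  assert (Hq0 : (0 < q 0)%R) by (rewrite Q0; now apply Rdiv_lt_0_compat).
  assert (Hq1 := Hmax 0 ltac:(rewrite Cminus_diag, Cmod_0; lra)).
  (* [q] is nonpositive where |G| >= Rad and positive at 0. Hence |G| < Rad at the maximum, which
     therefore lies strictly inside the circle of radius [rho] and is a local maximum in the
     plane. *)
  assert (HGz1 : (Cmod (G z1) < Rad)%R).
  { apply Rnot_le_lt. intros HRle. assert (Rad ^ 2 <= Cmod (G z1) ^ 2)%R by (apply pow_incr; lra).
    assert (q z1 <= 0)%R; [|lra]. unfold q.
    assert (exp (Cmod z1 ^ 2) * (Rad ^ 2 - Cmod (G z1) ^ 2) <= 0)%R by (assert (T := exp_pos (Cmod z1 ^ 2)); nra).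
    apply Rle_div_l; lra. }
  assert (Hint : (Cmod z1 < rho)%R).
  { apply Rnot_le_lt. intros Hle. specialize (HGR z1 Dz1 Hle). lra. }
  assert (KO := keller_osserman G z1 Rad HG Dz1 HR (Rlt_le _ _ (HJ z1 Dz1)) (proj2 (Cmod_gt_0 _) Hl1) HGz1).
  assert (HKO : (Rad ^ 2 - Cmod (G z1) ^ 2 <= 16 * Rad * Cmod (d_z G z1))%R).
  { apply KO. exists (rho - Cmod z1)%R. split; [lra|]. intros z Hz _ _. apply Hmax.
    rewrite Cminus_0_r. assert (T := Cmod_triangle_sub z z1). lra. }
  assert (Hexp : (exp (Cmod z1 ^ 2) <= 3)%R).
  { eapply Rle_trans; [|apply exp_le_3].
    assert (Hle : (Cmod z1 ^ 2 <= 1)%R) by (assert (T := Cmod_ge_0 z1); unfold disk in Dz1; simpl; nra).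
    destruct Hle as [Hle|Hle]; [left; now apply exp_increasing|rewrite Hle; apply Rle_refl]. }
  assert (Hq48 : (q z1 <= 48 * Rad)%R).
  { unfold q. apply Rle_div_l; [exact Hl1|].
    assert (HT : (0 <= Rad ^ 2 - Cmod (G z1) ^ 2)%R) by (assert (T := Cmod_ge_0 (G z1)); simpl; nra).
    apply Rle_trans with (3 * (16 * Rad * Cmod (d_z G z1)))%R; [|right; ring].
    apply Rmult_le_compat; [left; apply exp_pos|exact HT|exact Hexp|exact HKO]. }
  rewrite Q0 in Hq1. assert (Hq2 : ((Rad ^ 2 - g0 ^ 2) / lam <= 48 * Rad)%R) by lra.
  apply (Rmult_le_compat_r lam) in Hq2; [|lra].
  replace ((Rad ^ 2 - g0 ^ 2) / lam * lam)%R with (Rad ^ 2 - g0 ^ 2)%R in Hq2 by (field; lra).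
  assert (E : (Rad ^ 2 - 48 * Rad * lam = Rad * (g0 + 1))%R) by (unfold Rad; ring).
  assert (g0 < Rad)%R by (unfold Rad; lra). simpl in *. nra.
Qed.

(** * Topology of locally injective maps of the disk *)

(** Connectedness of a segment as an induction principle. The local step leads from any point near a
    given one to any other, so it expresses both that [Q] is open and that it is closed along the
    segment. *)
Lemma seg_ind (Q : C -> Prop) (a b : C) : Q a ->
  (forall t : R, (0 <= t <= 1)%R -> exists d : R, (0 < d)%R /\
    forall u v, (Cmod (u - (a + RtoC t * (b - a))) < d)%R -> (Cmod (v - (a + RtoC t * (b - a))) < d)%R -> Q u -> Q v) ->
  Q b.
Proof.
  intros Qa HL. set (p := fun t : R => a + RtoC t * (b - a)).
  assert (Hp : forall s t, Cmod (p s - p t) = (Rabs (s - t) * Cmod (b - a))%R).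
  { intros s t. unfold p. replace (a + RtoC s * (b - a) - (a + RtoC t * (b - a))) with ((RtoC s - RtoC t) * (b - a)) by ring.
    now rewrite <- RtoC_minus, Cmod_mult, Cmod_R. }
  set (L := (Cmod (b - a) + 1)%R). assert (HL0 : (0 < L)%R) by (unfold L; assert (T := Cmod_ge_0 (b - a)); lra).
  assert (HL' : forall t, (0 <= t <= 1)%R -> exists d, (0 < d)%R /\ forall s s', (Rabs (s - t) < d)%R -> (Rabs (s' - t) < d)%R -> Q (p s) -> Q (p s')).
  { intros t Ht. destruct (HL t Ht) as (d & Hd & H). exists (d / L)%R. split; [now apply Rdiv_lt_0_compat|].
    assert (K : forall s, (Rabs (s - t) < d / L)%R -> (Cmod (p s - p t) < d)%R).
    { intros s Hs. apply Rlt_div_r in Hs; [|exact HL0]. rewrite Hp. unfold L in Hs. assert (T := Rabs_pos (s - t)). lra. }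
    intros s s' Hs Hs'. apply H; now apply K. }
  set (E := fun t : R => (0 <= t <= 1)%R /\ forall s, (0 <= s <= t)%R -> Q (p s)).
  assert (E0 : E 0%R).
  { split; [lra|]. intros s Hs. replace s with 0%R by lra. unfold p. now replace (a + 0 * (b - a)) with a by ring. }
  destruct (completeness E) as [m [Hm1 Hm2]].
  - exists 1%R. intros t [Ht _]. lra.
  - now exists 0%R.
  - assert (Hm : (0 <= m <= 1)%R).
    { split; [now apply Hm1|]. apply Hm2. intros t [Ht _]. lra. }
    destruct (HL' m Hm) as (d & Hd & H).
    assert (Hex : exists e, E e /\ (m - d < e)%R).
    { apply NNPP. intros HN. assert (m <= m - d)%R; [|lra]. apply Hm2. intros t Ht.
      apply Rnot_lt_le. intros Hlt. apply HN. now exists t. }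
    destruct Hex as (e & [He1 He2] & Hem). assert (Hle := Hm1 e (conj He1 He2)).
    assert (Qe : Q (p e)) by (apply He2; lra).
    assert (Near : forall s, (Rabs (s - m) < d)%R -> Q (p s)).
    { intros s Hs. apply (H e s); [|exact Hs|exact Qe]. rewrite Rabs_left1; lra. }
    set (t := Rmin 1 (m + d / 2)).
    assert (Ht1 := Rmin_l 1 (m + d / 2)). assert (Ht2 := Rmin_r 1 (m + d / 2)). fold t in Ht1, Ht2.
    assert (Htm : (m <= t)%R) by (apply Rmin_glb; lra).
    assert (Et : E t).
    { split; [lra|]. intros s Hs. destruct (Rle_lt_dec s e) as [Hse|Hse]; [apply He2; lra|].
      apply Near. apply Rabs_lt_between. lra. }
    assert (Htm2 := Hm1 t Et). assert (Ht : t = 1%R).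
    { unfold t, Rmin in *. destruct (Rle_dec 1 (m + d / 2)); lra. }
    replace b with (p 1%R) by (unfold p; ring). apply (proj2 Et). lra.
Qed.

Lemma seg_disk (z : C) (t : R) : disk z -> (0 <= t <= 1)%R -> disk (0 + RtoC t * (z - 0)).
Proof.
  unfold disk. intros Hz Ht. replace (0 + RtoC t * (z - 0)) with (RtoC t * z) by ring.
  rewrite Cmod_mult, Cmod_pos_eq by lra. assert (T := Cmod_ge_0 z). nra.
Qed.

Lemma disk_ind (Q : C -> Prop) : Q 0 ->
  (forall z, disk z -> exists d : R, (0 < d)%R /\
    forall u v, disk u -> disk v -> (Cmod (u - z) < d)%R -> (Cmod (v - z) < d)%R -> Q u -> Q v) ->
  forall z, disk z -> Q z.
Proof.
  intros Q0 HL z Hz. apply (seg_ind Q 0 z Q0). intros t Ht.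
  assert (Hp := seg_disk z t Hz Ht). destruct (HL _ Hp) as (d & Hd & H). destruct (disk_open _ Hp) as (d1 & Hd1 & HD).
  exists (Rmin d d1). split; [now apply Rmin_pos|]. intros u v Hu Hv.
  assert (M1 := Rmin_l d d1). assert (M2 := Rmin_r d d1). apply H; try lra; apply HD; lra.
Qed.

(** Local univalence on a closed disc contained in the unit disk, the form that [open_map_disc]
    consumes. *)
Definition locally_injective (F : C -> C) : Prop :=
  forall z0, disk z0 -> exists r, (0 < r)%R /\ (forall z, (Cmod (z - z0) <= r)%R -> disk z) /\
   forall z w, (Cmod (z - z0) <= r)%R -> (Cmod (w - z0) <= r)%R -> F z = F w -> z = w.

Lemma univalent_locally (F : C -> C) : univalent F -> locally_univalent F.
Proof. intros H z0 _. exists 1%R. split; [lra|]. intros z w Hz Hw _ _. now apply H. Qed.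

Lemma locally_univalent_injective (F : C -> C) : locally_univalent F -> locally_injective F.
Proof. intros H z0 Hz. now apply loc_univ_disc. Qed.

Lemma open_at (F : C -> C) (z0 : C) (r : R) : locally_injective F -> (forall z, disk z -> cont F z) ->
  disk z0 -> (0 < r)%R ->
  exists eps : R, (0 < eps)%R /\ forall w, (Cmod (w - F z0) < eps)%R ->
    exists z, disk z /\ (Cmod (z - z0) < r)%R /\ F z = w.
Proof.
  intros HF Hc Hz Hr. destruct (HF z0 Hz) as (r1 & Hr1 & HD & Hi).
  assert (M1 := Rmin_l r r1). assert (M2 := Rmin_r r r1).
  destruct (open_map_disc F z0 (Rmin r r1)) as (eps & Heps & H).
  - now apply Rmin_pos.
  - intros z Hzz. apply Hc, HD. lra.
  - intros z w H1 H2. apply Hi; lra.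
  - exists eps. split; [exact Heps|]. intros w Hw. destruct (H w Hw) as (z & Hzz & E). exists z.
    split; [apply HD; lra|]. split; [lra|exact E].
Qed.

(** [w] is not a cluster value of [F] at the unit circle. *)
Definition far (F : C -> C) (w : C) : Prop :=
  exists rho eta : R, (0 < rho < 1)%R /\ (0 < eta)%R /\
    forall z, disk z -> (rho <= Cmod z)%R -> (eta <= Cmod (F z - w))%R.

(** Values near [F z0] are already taken near [z0], so injectivity leaves none of them for points
    near the circle. *)
Lemma injective_far (F : C -> C) (z0 : C) : univalent F -> (forall z, disk z -> cont F z) -> disk z0 -> far F (F z0).
Proof.
  intros HF Hc Hz. assert (HL := locally_univalent_injective _ (univalent_locally _ HF)).
  assert (T0 := Cmod_ge_0 z0). assert (Hz' := Hz). unfold disk in Hz'.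
  destruct (open_at F z0 ((1 - Cmod z0) / 2) HL Hc Hz ltac:(lra)) as (eps & Heps & H).
  exists ((1 + Cmod z0) / 2)%R, eps. split; [lra|]. split; [exact Heps|]. intros z Hzz Hle.
  apply Rnot_lt_le. intros Hlt. destruct (H _ Hlt) as (u & Hu & Hu2 & E). apply HF in E; [|exact Hu|exact Hzz].
  rewrite E in Hu2. assert (T := Cmod_triangle_sub z z0). lra.
Qed.

Lemma far_not_closure (F : C -> C) (w : C) : (forall z, disk z -> cont F z) -> far F w ->
  (forall z, disk z -> F z <> w) -> exists eta : R, (0 < eta)%R /\ forall z, disk z -> (eta <= Cmod (F z - w))%R.
Proof.
  intros Hc (rho & eta & Hrho & Heta & H) Hn.
  destruct (disc_pos_lower (fun z => F z - w) 0 rho disk) as (m & Hm & HM).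
  - intros z Hz. rewrite Cminus_0_r in Hz. apply cont_minus; [|apply cont_const]. apply Hc. unfold disk. lra.
  - intros z Hz E. rewrite Cminus_0_r in Hz. exfalso. apply (Hn z); [unfold disk; lra|].
    now apply Ceq_minus.
  - exists (Rmin m eta). split; [now apply Rmin_pos|]. intros z Hz. destruct (Rle_lt_dec rho (Cmod z)) as [Hle|Hlt].
    + eapply Rle_trans; [apply Rmin_r|now apply H].
    + eapply Rle_trans; [apply Rmin_l|]. apply HM; [exact Hz|]. rewrite Cminus_0_r. lra.
Qed.

(** The condition that [A z] is a value of [B] is open because [B] is an open map. It is also
    closed: [A z] is not a cluster value of [A], hence not of [B], and a point missed by [B] is then
    at positive distance from its image. *)
Lemma image_sub (A B : C -> C) : univalent A -> univalent B ->
  (forall z, disk z -> cont A z) -> (forall z, disk z -> cont B z) -> A 0 = B 0 ->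
  (forall w, far A w -> far B w) -> forall z, disk z -> image_disk B (A z).
Proof.
  intros HA HB CA CB E0 Hfar. apply (disk_ind (fun z => image_disk B (A z))).
  - exists 0. split; [unfold disk; rewrite Cmod_0; lra|now symmetry].
  - assert (LB := locally_univalent_injective _ (univalent_locally _ HB)).
    intros z Hz. destruct (classic (image_disk B (A z))) as [(z' & Hz' & E)|Hn].
    + destruct (open_at B z' 1 LB CB Hz' Rlt_0_1) as (eps & Heps & H). rewrite E in H.
      destruct (CA z Hz eps Heps) as (d & Hd & HD). exists d. split; [exact Hd|].
      intros u v _ _ _ Hv _. destruct (H _ (HD v Hv)) as (x & Hx & _ & Ex). now exists x.
    + destruct (far_not_closure B (A z) CB) as (eta & Heta & H).
      * apply Hfar. now apply injective_far.
      * intros x Hx Ex. apply Hn. now exists x.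
      * destruct (CA z Hz eta Heta) as (d & Hd & HD). exists d. split; [exact Hd|].
        intros u v _ _ Hu _ (x & Hx & Ex) . exfalso. specialize (H x Hx). rewrite Ex in H. specialize (HD u Hu). lra.
Qed.

(** * Images of two maps whose quotient tends to 1 at the circle *)

Section Boundary_ratio.
Variables (f g s : C -> C).
Hypothesis (Hfg : forall z, disk z -> f z = g z * s z).
Hypothesis (Hs : forall eps : R, (0 < eps)%R -> exists rho : R, (0 < rho < 1)%R /\
  forall z, disk z -> (rho <= Cmod z)%R -> (Cmod (s z - 1) < eps)%R).
Hypothesis (Cf : forall z, disk z -> cont f z) (Cg : forall z, disk z -> cont g z).
Hypothesis (If : univalent f).

Lemma ratio_bound (w : C) (eps : R) : (0 < eps)%R -> exists rho : R, (0 < rho < 1)%R /\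
  forall z, disk z -> (rho <= Cmod z)%R -> (Cmod (s z - 1) < 1 / 2)%R /\ (Cmod (s z - 1) * Cmod w < eps)%R.
Proof.
  intros Heps. assert (Hw : (0 < Cmod w + 1)%R) by (assert (T := Cmod_ge_0 w); lra).
  destruct (Hs (Rmin (1 / 2) (eps / (Cmod w + 1)))) as (rho & Hrho & H).
  { apply Rmin_pos; [lra|now apply Rdiv_lt_0_compat]. }
  exists rho. split; [exact Hrho|]. intros z Hz Hle. specialize (H z Hz Hle).
  assert (H1 := Rlt_min_l H). assert (H2 := Rlt_min_r H).
  split; [exact H1|]. apply Rlt_div_r in H2; [|exact Hw]. assert (T := Cmod_ge_0 (s z - 1)). lra.
Qed.

Lemma ratio_close (z w : C) : disk z -> (Cmod (s z - 1) < 1 / 2)%R ->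
  (Cmod (g z - w) <= 2 * (Cmod (f z - w) + Cmod (s z - 1) * Cmod w))%R /\
  (Cmod (f z - w) <= 2 * Cmod (g z - w) + Cmod (s z - 1) * Cmod w)%R.
Proof.
  intros Hz H. assert (E : s z * (g z - w) = (f z - w) + - ((s z - 1) * w)) by (rewrite Hfg by exact Hz; ring).
  assert (T1 := Cmod_triangle_sub (RtoC 1) (RtoC 1 - s z)). rewrite Cmod_1, Cmod_minus_sym in T1.
  replace (1 - (1 - s z)) with (s z) in T1 by ring. rewrite Cmod_minus_sym in T1.
  assert (H' : (Cmod (1 - s z) < 1 / 2)%R) by (rewrite Cmod_minus_sym; exact H).
  assert (T2 := Cmod_triangle (RtoC 1) (s z - 1)). rewrite Cmod_1 in T2. replace (1 + (s z - 1)) with (s z) in T2 by ring.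
  assert (Hsz : (1 / 2 <= Cmod (s z))%R).
  { assert (T3 := Cmod_triangle_sub (RtoC 1) (1 - s z)). rewrite Cmod_1 in T3. replace (1 - (1 - s z)) with (s z) in T3 by ring. lra. }
  assert (Hsz2 : (Cmod (s z) <= 2)%R) by lra.
  assert (Tg := Cmod_ge_0 (g z - w)). split.
  - assert (N := f_equal Cmod E). rewrite Cmod_mult in N.
    assert (T := Cmod_triangle (f z - w) (- ((s z - 1) * w))). rewrite Cmod_opp, Cmod_mult in T. nra.
  - replace (f z - w) with (s z * (g z - w) + (s z - 1) * w) by (rewrite E; ring).
    eapply Rle_trans; [apply Cmod_triangle|]. rewrite !Cmod_mult. nra.
Qed.

(** f - w and s (g - w) differ by (s - 1) w, which tends to 0 at the circle, while |s| stays between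
    two positive constants there. *)
Lemma ratio_far (w : C) : far f w <-> far g w.
Proof.
  split; intros (rho & eta & Hrho & Heta & H).
  - destruct (ratio_bound w (eta / 2)) as (rho2 & Hrho2 & H2); [lra|].
    exists (Rmax rho rho2), (eta / 4)%R. assert (M1 := Rmax_l rho rho2). assert (M2 := Rmax_r rho rho2).
    split; [split; [lra|apply Rmax_lub_lt; lra]|]. split; [lra|]. intros z Hz Hle.
    specialize (H z Hz ltac:(lra)). destruct (H2 z Hz ltac:(lra)) as [A B].
    destruct (ratio_close z w Hz A) as [_ K]. lra.
  - destruct (ratio_bound w (eta / 4)) as (rho2 & Hrho2 & H2); [lra|].
    exists (Rmax rho rho2), (eta / 4)%R. assert (M1 := Rmax_l rho rho2). assert (M2 := Rmax_r rho rho2).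
    split; [split; [lra|apply Rmax_lub_lt; lra]|]. split; [lra|]. intros z Hz Hle.
    specialize (H z Hz ltac:(lra)). destruct (H2 z Hz ltac:(lra)) as [A B].
    destruct (ratio_close z w Hz A) as [K _]. lra.
Qed.

Lemma same_image (w : C) : univalent g -> f 0 = g 0 -> image_disk f w <-> image_disk g w.
Proof.
  intros Ig E0. split; intros (z & Hz & <-).
  - apply (image_sub f g); auto. intros v. apply ratio_far.
  - apply (image_sub g f); auto. intros v. apply ratio_far.
Qed.

Hypothesis (Lg : locally_injective g).

Definition unique_preimage (w : C) : Prop :=
  (exists z, disk z /\ g z = w) /\ forall u v, disk u -> disk v -> g u = w -> g v = w -> u = v.

(** Off the cluster values [g] behaves like a proper map. A missed value has a missed neighbourhood,
    and two preimages persist by openness. When [z0] is the only preimage, openness keeps one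
    nearby, and compactness confines all preimages of nearby values to a disc about [z0] where [g]
    is injective. *)
Lemma unique_preimage_locally (w0 : C) : far g w0 -> exists d, (0 < d)%R /\
  forall w1 w2, (Cmod (w1 - w0) < d)%R -> (Cmod (w2 - w0) < d)%R -> unique_preimage w1 -> unique_preimage w2.
Proof.
  intros Hfar. destruct (classic (exists z, disk z /\ g z = w0)) as [(z0 & Hz0 & E0)|Hn].
  2:{ destruct (far_not_closure g w0 Cg Hfar) as (eta & Heta & H).
      - intros z Hz E. apply Hn. now exists z.
      - exists eta. split; [exact Heta|]. intros w1 w2 H1 _ [(z & Hz & E) _]. exfalso. specialize (H z Hz). rewrite E in H. lra. }
  destruct (classic (exists z1, disk z1 /\ g z1 = w0 /\ z1 <> z0)) as [(z1 & Hz1 & E1 & Hne)|Hu].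
  - assert (Hr : (0 < Cmod (z1 - z0) / 2)%R).
    { assert (T : (0 < Cmod (z1 - z0))%R); [|lra]. apply Cmod_gt_0. intros E. apply Hne. now apply Ceq_minus. }
    destruct (open_at g z0 _ Lg Cg Hz0 Hr) as (e0 & He0 & O0). destruct (open_at g z1 _ Lg Cg Hz1 Hr) as (e1 & He1 & O1).
    rewrite E0 in O0. rewrite E1 in O1.
    exists (Rmin e0 e1). split; [now apply Rmin_pos|]. intros w1 w2 H1 _ [_ Hun]. exfalso.
    destruct (O0 w1 (Rlt_min_l H1)) as (u & Hu & Hu2 & Eu).
    destruct (O1 w1 (Rlt_min_r H1)) as (v & Hv & Hv2 & Ev).
    assert (Euv := Hun u v Hu Hv Eu Ev). subst v.
    assert (T := Cmod_triangle (z1 - u) (u - z0)). replace (z1 - u + (u - z0)) with (z1 - z0) in T by ring.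
    rewrite (Cmod_minus_sym z1 u) in T. lra.
  - destruct (Lg z0 Hz0) as (r & Hr & HD & Hi).
    destruct (open_at g z0 r Lg Cg Hz0 Hr) as (e0 & He0 & O0). rewrite E0 in O0.
    destruct Hfar as (rho & eta & Hrho & Heta & Hfar).
    destruct (disc_pos_lower (fun z => g z - w0) 0 rho (fun u => (r <= Cmod (u - z0))%R)) as (m & Hm & HM).
    + intros z Hz. rewrite Cminus_0_r in Hz. apply cont_minus; [|apply cont_const]. apply Cg. unfold disk. lra.
    + intros z Hz E. rewrite Cminus_0_r in Hz. apply Ceq_minus in E.
      assert (Ez : z = z0). { apply NNPP. intros Hne. apply Hu. exists z. split; [unfold disk; lra|now split]. }
      exists r. split; [exact Hr|]. intros u Hu2. rewrite Ez in Hu2. lra.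
    + exists (Rmin e0 (Rmin m eta)). split; [repeat apply Rmin_pos; assumption|]. intros w1 w2 _ H2 _.
      assert (A1 := Rlt_min_l H2). assert (A' := Rlt_min_r H2).
      assert (A2 := Rlt_min_l A'). assert (A3 := Rlt_min_r A').
      split.
      * destruct (O0 w2 A1) as (u & Hu2 & _ & E). now exists u.
      * assert (K : forall u, disk u -> g u = w2 -> (Cmod (u - z0) <= r)%R).
        { intros u Du Eu. apply Rnot_lt_le. intros Hlt.
          assert (Hur : (Cmod u < rho)%R).
          { apply Rnot_le_lt. intros Hle. specialize (Hfar u Du Hle). rewrite Eu in Hfar. lra. }
          assert (B := HM u ltac:(lra) ltac:(rewrite Cminus_0_r; lra)). rewrite Eu in B. lra. }
        intros u v Du Dv Eu Ev. apply Hi; [now apply K|now apply K|congruence].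
Qed.

Lemma attained_locally (w0 : C) : far g w0 -> exists d, (0 < d)%R /\
  forall w1 w2, (Cmod (w1 - w0) < d)%R -> (Cmod (w2 - w0) < d)%R -> image_disk g w1 -> image_disk g w2.
Proof.
  intros Hfar. destruct (classic (image_disk g w0)) as [(z0 & Hz0 & E0)|Hn].
  - destruct (open_at g z0 1 Lg Cg Hz0 Rlt_0_1) as (e0 & He0 & O0). rewrite E0 in O0.
    exists e0. split; [exact He0|]. intros w1 w2 _ H2 _. destruct (O0 w2 H2) as (u & Hu & _ & E). now exists u.
  - destruct (far_not_closure g w0 Cg Hfar) as (eta & Heta & H).
    + intros z Hz E. apply Hn. now exists z.
    + exists eta. split; [exact Heta|]. intros w1 w2 H1 _ (z & Hz & E). exfalso. specialize (H z Hz). rewrite E in H. lra.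
Qed.

Hypothesis (f0 : f 0 = 0) (g0 : g 0 = 0) (gz : forall z, disk z -> g z = 0 -> z = 0).
Hypothesis (Star : starlike_domain (image_disk f)).

(** Continuation from 0, whose only preimage is 0. Each point of the segment is a value of the
    injective [f], so it is no cluster value of [f], nor of [g]. *)
Lemma unique_preimage_image (w : C) : image_disk f w -> unique_preimage w.
Proof.
  intros Hw. apply (seg_ind unique_preimage 0 w).
  - split.
    + exists 0. split; [unfold disk; rewrite Cmod_0; lra|exact g0].
    + intros u v Hu Hv Eu Ev. rewrite (gz u Hu Eu), (gz v Hv Ev). reflexivity.
  - intros t Ht. replace (0 + RtoC t * (w - 0)) with (RtoC t * w) by ring.
    apply unique_preimage_locally. apply ratio_far.
    destruct (proj2 (proj2 Star) w t Hw Ht) as (z & Hz & <-). now apply injective_far.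
Qed.

(** If [g z1] were exterior to the starlike domain, [g] would attain every [t * g z1], [t >= 1];
    for large [t] the preimage is close to the circle, where [f] and [g] nearly agree in ratio. *)
Lemma image_closure (z1 : C) (eps : R) : disk z1 -> (0 < eps)%R -> exists z, disk z /\ (Cmod (f z - g z1) < eps)%R.
Proof.
  intros Hz1 Heps. apply NNPP. intros HN.
  set (w1 := g z1) in *.
  (* If [f] came closer than t eps to t w1, division by [t], which the starlike image permits, would
     produce a value of [f] closer than eps to [w1]. *)
  assert (Ext : forall t z, (1 <= t)%R -> disk z -> (t * eps <= Cmod (f z - RtoC t * w1))%R).
  { intros t z Ht Hz. assert (HtC : RtoC t <> 0) by (intros E; apply RtoC_inj in E; lra).
    assert (Ht' : (0 <= / t <= 1)%R).
    { split; [left; apply Rinv_0_lt_compat; lra|]. rewrite <- Rinv_1. apply Rinv_le_contravar; lra. }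
    destruct (proj2 (proj2 Star) (f z) (/ t)%R) as (z' & Hz' & E'); [now exists z|exact Ht'|].
    assert (Hge : (eps <= Cmod (f z' - w1))%R).
    { apply Rnot_lt_le. intros Hlt. apply HN. now exists z'. }
    replace (f z - RtoC t * w1) with (RtoC t * (f z' - w1)).
    - rewrite Cmod_mult, Cmod_pos_eq by lra. apply Rmult_le_compat_l; lra.
    - rewrite E', RtoC_inv by lra. field. exact HtC. }
  assert (Hw1 : w1 <> 0).
  { intros E. assert (H := Ext 1%R 0 ltac:(lra) ltac:(unfold disk; rewrite Cmod_0; lra)).
    rewrite f0, E in H. replace (0 - 1 * 0) with (RtoC 0) in H by ring. rewrite Cmod_0 in H. lra. }
  assert (Hw1' := proj1 (Cmod_gt_0 _) Hw1).
  (* By [Ext] no point of the ray is a cluster value of [f], hence none is one of [g], and being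
     attained propagates outward from [w1]. *)
  assert (Att : forall t, (1 <= t)%R -> image_disk g (RtoC t * w1)).
  { intros t Ht. apply (seg_ind (image_disk g) w1 (RtoC t * w1)).
    - now exists z1.
    - intros u Hu. replace (w1 + RtoC u * (RtoC t * w1 - w1)) with (RtoC (1 + u * (t - 1))%R * w1)
        by (rewrite RtoC_plus, RtoC_mult, RtoC_minus; ring).
      apply attained_locally. apply ratio_far.
      exists (1 / 2)%R, eps. split; [lra|]. split; [exact Heps|]. intros z Hz _.
      assert (Hut : (0 <= u * (t - 1))%R) by (apply Rmult_le_pos; lra).
      eapply Rle_trans; [|apply Ext; [|exact Hz]]; nra. }
  destruct (ratio_bound w1 eps Heps) as (rho & Hrho & HR).
  destruct (disc_bounded g 0 rho) as (M & HM0 & HM).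
  { intros z Hz. apply Cg. rewrite Cminus_0_r in Hz. unfold disk. lra. }
  set (t := (M / Cmod w1 + 1)%R). assert (Ht : (1 < t)%R) by (unfold t; assert (0 < M / Cmod w1)%R by (now apply Rdiv_lt_0_compat); lra).
  destruct (Att t ltac:(lra)) as (z & Hz & E).
  assert (Hbig : (M < Cmod (g z))%R).
  { rewrite E, Cmod_mult, Cmod_pos_eq by lra. replace (t * Cmod w1)%R with (M + Cmod w1)%R by (unfold t; field; lra). lra. }
  assert (Hzr : (rho <= Cmod z)%R).
  { apply Rnot_lt_le. intros Hlt. specialize (HM z). rewrite Cminus_0_r in HM. specialize (HM ltac:(lra)). lra. }
  destruct (HR z Hz Hzr) as [_ HR2].
  assert (HE := Ext t z ltac:(lra) Hz).
  rewrite (Hfg z Hz), E in HE. replace (RtoC t * w1 * s z - RtoC t * w1) with (RtoC t * ((s z - 1) * w1)) in HE by ring.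
  rewrite !Cmod_mult, Cmod_pos_eq in HE by lra. nra.
Qed.

(** A value w2 = g z2 outside the image of [f] is still a limit of values f z, necessarily with z
    near the circle, and then g z is close to w2 too. A value f z3 close to g z has one preimage
    under [g] near z and another near [z2], against uniqueness over the image of [f]. *)
Lemma image_inclusion (z2 : C) : disk z2 -> image_disk f (g z2).
Proof.
  intros Hz2. apply NNPP. intros HN. set (w2 := g z2) in *.
  assert (T2 := Cmod_ge_0 z2). assert (Hz2' := Hz2). unfold disk in Hz2'.
  destruct (open_at g z2 ((1 - Cmod z2) / 2) Lg Cg Hz2 ltac:(lra)) as (e2 & He2 & O2). fold w2 in O2.
  destruct (ratio_bound w2 (e2 / 8)) as (rho1 & Hrho1 & HR); [lra|].
  (* [rho] separates the two preimages found below: |v| < (1 + |z2|) / 2 <= rho < |u|. *)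
  set (rho := Rmax rho1 ((1 + Cmod z2) / 2)).
  assert (M1 := Rmax_l rho1 ((1 + Cmod z2) / 2)). assert (M2 := Rmax_r rho1 ((1 + Cmod z2) / 2)). fold rho in M1, M2.
  assert (Hrho : (rho < 1)%R) by (apply Rmax_lub_lt; lra).
  destruct (disc_pos_lower (fun z => f z - w2) 0 rho disk) as (m & Hm & HM).
  { intros z Hz. rewrite Cminus_0_r in Hz. apply cont_minus; [|apply cont_const]. apply Cf. unfold disk. lra. }
  { intros z Hz E. rewrite Cminus_0_r in Hz. exfalso. apply HN. exists z. split; [unfold disk; lra|now apply Ceq_minus]. }
  destruct (image_closure z2 (Rmin m (e2 / 8)) Hz2) as (z & Hz & Hzw); [apply Rmin_pos; lra|]. fold w2 in Hzw.
  assert (A1 := Rlt_min_l Hzw). assert (A2 := Rlt_min_r Hzw).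
  assert (Hzr : (rho < Cmod z)%R).
  { apply Rnot_le_lt. intros Hle. specialize (HM z Hz). rewrite Cminus_0_r in HM. specialize (HM Hle). lra. }
  destruct (HR z Hz ltac:(lra)) as [B1 B2]. destruct (ratio_close z w2 Hz B1) as [B3 _].
  assert (Hgz : (Cmod (g z - w2) < e2 / 2)%R) by lra.
  destruct (open_at g z (Cmod z - rho) Lg Cg Hz ltac:(lra)) as (e3 & He3 & O3).
  destruct (image_closure z (Rmin e3 (e2 / 2)) Hz) as (z3 & Hz3 & Hzw3); [apply Rmin_pos; lra|].
  assert (D1 := Rlt_min_l Hzw3). assert (D2 := Rlt_min_r Hzw3).
  destruct (O3 (f z3) D1) as (u & Hu & Hu2 & Eu).
  destruct (O2 (f z3)) as (v & Hv & Hv2 & Ev).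
  { replace (f z3 - w2) with ((f z3 - g z) + (g z - w2)) by ring. eapply Rle_lt_trans; [apply Cmod_triangle|lra]. }
  destruct (unique_preimage_image (f z3)) as [_ Hun]; [now exists z3|].
  assert (Euv := Hun u v Hu Hv Eu Ev). subst v.
  assert (T3 := Cmod_triangle_sub z u). rewrite Cmod_minus_sym in T3. assert (T4 := Cmod_triangle_sub u z2). lra.
Qed.

Lemma ratio_univalent : univalent g.
Proof.
  intros u v Hu Hv E. destruct (unique_preimage_image (g u) (image_inclusion u Hu)) as [_ H].
  apply H; auto.
Qed.

End Boundary_ratio.

(** * Orientation and the boundary value of the radial factor *)

Lemma jacobian_sign (G : C -> C) : harmonic G -> locally_univalent G ->
  (forall z, disk z -> (0 < jacobian G z)%R) \/ (forall z, disk z -> (jacobian G z < 0)%R).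
Proof.
  intros HG HL. destruct (harmonic_hol G HG) as (CG & _).
  assert (Cj : forall z, disk z -> cont (fun w => RtoC (jacobian G w)) z).
  { intros z Hz. destruct (CG z Hz) as (_ & C1 & C2).
    apply (cont_ext_loc (fun w => RtoC (Cmod (d_z G w)) ^ 2 - RtoC (Cmod (d_zbar G w)) ^ 2) _ _ 1 Rlt_0_1).
    - intros w _. unfold jacobian. now rewrite RtoC_minus, !RtoC_pow.
    - apply cont_minus; apply cont_pow; now apply cont_Cmod. }
  assert (D0 : disk 0) by (unfold disk; rewrite Cmod_0; lra).
  assert (Loc : forall z, disk z -> exists d : R, (0 < d)%R /\ forall u, (Cmod (u - z) < d)%R ->
     (0 < jacobian G z * jacobian G u)%R).
  { intros z Hz. assert (Hne := lewy G z HG HL Hz). assert (Hpos := Rabs_pos_lt _ Hne).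
    destruct (Cj z Hz _ Hpos) as (d & Hd & H). exists d. split; [exact Hd|]. intros u Hu. specialize (H u Hu).
    rewrite <- RtoC_minus, Cmod_R in H. unfold Rabs in H.
    destruct (Rcase_abs (jacobian G u - jacobian G z)), (Rcase_abs (jacobian G z)); nra. }
  destruct (Rdichotomy _ _ (lewy G 0 HG HL D0)) as [H0|H0]; [right|left].
  - apply disk_ind; [exact H0|]. intros z Hz. destruct (Loc z Hz) as (d & Hd & H). exists d. split; [exact Hd|].
    intros u v _ _ Hu Hv Ju. specialize (H u Hu) as H1. specialize (H v Hv) as H2. nra.
  - apply disk_ind; [exact H0|]. intros z Hz. destruct (Loc z Hz) as (d & Hd & H). exists d. split; [exact Hd|].
    intros u v _ _ Hu Hv Ju. specialize (H u Hu) as H1. specialize (H v Hv) as H2. nra.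
Qed.

Lemma partial_conj (F : C -> C) :
  partial_x (fun z => Cconj (F z)) = (fun z => Cconj (partial_x F z)) /\
  partial_y (fun z => Cconj (F z)) = (fun z => Cconj (partial_y F z)).
Proof.
  split; apply functional_extensionality; intros z; unfold partial_x, partial_y, Cconj; simpl; f_equal.
  - apply (Derive_opp (fun x => Im (F (x, Im z)))).
  - apply (Derive_opp (fun y => Im (F (Re z, y)))).
Qed.

Lemma class_C_conj (k : nat) (F : C -> C) : class_C k F -> class_C k (fun z => Cconj (F z)).
Proof.
  revert F. induction k as [|k IH]; intros F H.
  - intros z Hz. apply cont_continuous. apply cont_conj. apply cont_continuous. now apply H.
  - destruct H as (H0 & H1 & H2). destruct (partial_conj F) as [E1 E2].
    assert (K : forall (h : R -> C) t, ex_derive (V := C_R_NormedModule) h t -> ex_derive (V := C_R_NormedModule) (fun x => Cconj (h x)) t).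
    { intros h t [l Hl]. apply is_derive_C_pair in Hl. destruct Hl as [L1 L2]. exists (Cconj l). apply is_derive_C_pair.
      split; [exact L1|]. apply (is_derive_opp (fun x => Im (h x)) t (Im l) L2). }
    split; [|split].
    + intros z Hz. destruct (H0 z Hz). split; now apply K.
    + rewrite E1. now apply IH.
    + rewrite E2. now apply IH.
Qed.

Lemma harmonic_conj (G : C -> C) : harmonic G -> harmonic (fun z => Cconj (G z)) /\
  forall z, disk z -> d_z (fun z => Cconj (G z)) z = Cconj (d_zbar G z) /\ d_zbar (fun z => Cconj (G z)) z = Cconj (d_z G z).
Proof.
  intros HG. destruct (harmonic_hol G HG) as (CG & CD & _ & Hh & _).
  assert (E : forall z, disk z -> d_z (fun z => Cconj (G z)) z = Cconj (d_zbar G z) /\ d_zbar (fun z => Cconj (G z)) z = Cconj (d_z G z)).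
  { intros z Hz. apply rdiff_d. apply rdiff_conj. now apply CG. }
  split; [|exact E]. split.
  - apply class_C_conj. apply HG.
  - intros z Hz. simpl. unfold laplacian.
    assert (D : rdiff (d_zbar (fun z => Cconj (G z))) z (Cconj 0) (Cconj (d_z (d_z G) z))).
    { eapply rdiff_ext_disk; [exact Hz|intros w Hw; symmetry; apply (proj2 (E w Hw))|]. apply rdiff_conj. now apply Hh. }
    rewrite (proj1 (rdiff_d _ _ _ _ D)). apply Ceq_Re_Im; simpl; ring.
Qed.

(** Conjugation reverses orientation and preserves |G|, which reduces a negative Jacobian to the
    sense-preserving case. *)
Lemma no_proper_locally_univalent (G : C -> C) : harmonic G -> locally_univalent G ->
  ~ (forall M : R, exists rho, (0 < rho < 1)%R /\ forall z, disk z -> (rho <= Cmod z)%R -> (M <= Cmod (G z))%R).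
Proof.
  intros HG HL HP.
  assert (Jlt : forall a b : C, (Cmod a ^ 2 - Cmod b ^ 2 < 0)%R -> (Cmod a < Cmod b)%R).
  { intros a b H. assert (T1 := Cmod_ge_0 a). assert (T2 := Cmod_ge_0 b). simpl in H. nra. }
  destruct (jacobian_sign G HG HL) as [J|J].
  - apply (no_proper_harmonic G HG); [|exact HP]. intros z Hz. specialize (J z Hz). unfold jacobian in J. apply Jlt. lra.
  - destruct (harmonic_conj G HG) as [HG' E].
    apply (no_proper_harmonic _ HG').
    + intros z Hz. specialize (J z Hz). destruct (E z Hz) as [-> ->]. rewrite !Cmod_conj. now apply Jlt.
    + intros M. destruct (HP M) as (rho & Hrho & H). exists rho. split; [exact Hrho|]. intros z Hz Hle. rewrite Cmod_conj. auto.
Qed.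

Lemma radial_boundary (p : nat) (lambda : nat -> C) (eps : R) : (0 < eps)%R -> exists rho : R, (0 < rho < 1)%R /\
  forall z, disk z -> (rho <= Cmod z)%R -> (Cmod (radial p lambda z - radial p lambda 1) < eps)%R.
Proof.
  intros Heps. destruct (cont_radial p lambda 1 eps Heps) as (d & Hd & H).
  exists (Rmax (1 / 2) (1 - d / 2)). assert (M1 := Rmax_l (1 / 2) (1 - d / 2)). assert (M2 := Rmax_r (1 / 2) (1 - d / 2)).
  split; [split; [lra|apply Rmax_lub_lt; lra]|]. intros z Hz Hle. unfold disk in Hz.
  rewrite (radial_Cmod p lambda z (RtoC (Cmod z))) by (symmetry; apply Cmod_pos_eq, Cmod_ge_0).
  apply H. rewrite <- RtoC_minus, Cmod_R, Rabs_left1; lra.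
Qed.

Lemma radial_boundary_neq_0 (p : nat) (lambda : nat -> C) (f G : C -> C) : harmonic G -> locally_univalent G ->
  univalent f -> (forall z, disk z -> cont f z) -> f 0 = 0 ->
  (forall z, disk z -> f z = G z * radial p lambda z) -> radial p lambda 1 <> 0.
Proof.
  intros HG HL Hf Cf f0 HfG E.
  assert (D0 : disk 0) by (unfold disk; rewrite Cmod_0; lra).
  destruct (injective_far f 0 Hf Cf D0) as (rho & eta & Hrho & Heta & H). rewrite f0 in H.
  apply (no_proper_locally_univalent G HG HL). intros M.
  assert (HM : (0 < Rabs M + 1)%R) by (assert (T := Rabs_pos M); lra).
  destruct (radial_boundary p lambda (eta / (Rabs M + 1))) as (rho2 & Hrho2 & H2); [now apply Rdiv_lt_0_compat|].
  exists (Rmax rho rho2). assert (M1 := Rmax_l rho rho2). assert (M2 := Rmax_r rho rho2).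
  split; [split; [lra|apply Rmax_lub_lt; lra]|]. intros z Hz Hle.
  specialize (H z Hz ltac:(lra)). specialize (H2 z Hz ltac:(lra)).
  replace (f z - 0) with (f z) in H by ring. rewrite E in H2. replace (radial p lambda z - 0) with (radial p lambda z) in H2 by ring.
  rewrite HfG, Cmod_mult in H by exact Hz. apply Rlt_div_r in H2; [|exact HM].
  apply Rnot_lt_le. intros Hlt. assert (T1 := Cmod_ge_0 (G z)). assert (T2 := Cmod_ge_0 (radial p lambda z)). assert (T3 := Rle_abs M). nra.
Qed.

(** When the radial factor vanishes at the origin and [G 0 <> 0], [f] maps small circles into half-planes
    bounded by lines through [f 0 = 0], hence has winding number 0 there and cannot be injective. *)
Lemma radial_origin (p : nat) (lambda : nat -> C) (f G : C -> C) :
  univalent f -> (forall z, disk z -> cont f z) -> (forall z, disk z -> cont G z) -> f 0 = 0 ->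
  (forall z, disk z -> f z = G z * radial p lambda z) -> G 0 = 0.
Proof.
  intros Hf Cf CG f0 HfG. apply NNPP. intros HG0. assert (HG := proj1 (Cmod_gt_0 _) HG0).
  assert (D0 : disk 0) by (unfold disk; rewrite Cmod_0; lra).
  destruct (CG 0 D0 (Cmod (G 0)) HG) as (d & Hd & H).
  set (r := Rmin (1 / 2) (d / 2)). assert (M1 := Rmin_l (1 / 2) (d / 2)). assert (M2 := Rmin_r (1 / 2) (d / 2)). fold r in M1, M2.
  assert (Hr : (0 < r)%R) by (apply Rmin_pos; lra).
  assert (Hin : forall z, (Cmod (z - 0) <= r)%R -> disk z) by (intros z Hz; rewrite Cminus_0_r in Hz; unfold disk; lra).
  assert (Hcirc : forall t, disk (0 + RtoC r * cis t)) by (intros t; apply Hin; rewrite circle_point; lra).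
  set (S := radial p lambda (RtoC r)).
  assert (HS : forall t, f (0 + RtoC r * cis t) = G (0 + RtoC r * cis t) * S).
  { intros t. rewrite HfG by apply Hcirc. f_equal. apply radial_Cmod.
    rewrite Cplus_0_l, Cmod_mult, Cmod_cis. ring. }
  (* A zero of the radial factor at radius [r] would make [f] vanish on a whole circle as well as at
     0. *)
  assert (HS0 : S <> 0).
  { intros E. assert (Ef := HS 0%R). rewrite E, Cmult_0_r in Ef. apply (eq_trans (z := f 0)) in Ef; [|now symmetry].
    apply Hf in Ef; [|apply Hcirc|exact D0].
    assert (Ec := circle_point 0 0 r ltac:(lra)). rewrite Ef in Ec. replace (0 - 0) with (RtoC 0) in Ec by ring. rewrite Cmod_0 in Ec. lra. }
  apply (injective_no_log f 0 r Hr).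
  - intros z Hz. apply Cf. now apply Hin.
  - intros z w Hz Hw. apply Hf; now apply Hin.
  - apply (has_log_close (fun _ => G 0 * S)).
    + split; [|reflexivity]. intros t. split; apply continuity_pt_const_fun.
    + apply loop_circle; [lra|]. intros z Hz. apply Cf. now apply Hin.
    + intros t. rewrite HS, f0. replace (G (0 + RtoC r * cis t) * S - 0 - G 0 * S) with ((G (0 + RtoC r * cis t) - G 0) * S) by ring.
      rewrite !Cmod_mult. apply Rmult_lt_compat_r; [now apply Cmod_gt_0|]. apply H. rewrite circle_point; lra.
    + assert (Hne : G 0 * S <> 0) by now apply Cmult_neq_0.
      exists (G 0 * S / RtoC (Cmod (G 0 * S))), (fun _ => 0%R).
      split; [intros t; apply continuity_pt_const_fun|]. split; [reflexivity|]. intros t. rewrite cis_0. field.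
      apply Cmod_gt_0 in Hne. intros E. apply RtoC_inj in E. lra.
Qed.

(** * Transfer of convexity and starlikeness *)

Lemma starlike_domain_scale (c : C) (A B : C -> Prop) : c <> 0 -> (forall w, A w <-> B (c * w)) ->
  starlike_domain B -> starlike_domain A.
Proof.
  intros Hc HAB (HO & H0 & HS). assert (Hc' := proj1 (Cmod_gt_0 _) Hc). split; [|split].
  - apply open_Cmod. intros z Hz. apply HAB in Hz. destruct (proj1 (open_Cmod B) HO _ Hz) as (d & Hd & H).
    exists (d / Cmod c)%R. split; [now apply Rdiv_lt_0_compat|]. intros w Hw. apply HAB, H.
    replace (c * w - c * z) with (c * (w - z)) by ring. rewrite Cmod_mult. apply Rlt_div_r in Hw; [|exact Hc']. lra.
  - apply HAB. now rewrite Cmult_0_r.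
  - intros w t Hw Ht. apply HAB. replace (c * (RtoC t * w)) with (RtoC t * (c * w)) by ring. apply HS; [now apply HAB|exact Ht].
Qed.

Theorem theorem1 (p : nat) (f G : C -> C) (lambda : nat -> C)
  (hp : (1 <= p)%nat)
  (hf_harm : p_harmonic p f)
  (hf_univ : univalent f)
  (hG_harm : harmonic G)
  (hG_loc : locally_univalent G)
  (hfG : forall z : C, disk z ->
     f z = G z * sum_n_m (fun k : nat => lambda k * RtoC (Cmod z ^ (2 * (k - 1)))%R) 1 p) :
  (forall z : C, disk z ->
     (f z <> 0 -> Dop f z / f z = Dop G z / G z) /\
     (Dop f z <> 0 -> Dop (Dop f) z / Dop f z = Dop (Dop G) z / Dop G z)) /\
  ((convex f -> convex G) /\
   (sense_preserving f -> convex G -> convex f)) /\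
  (starlike f <-> starlike G).
Proof.
  set (S := radial p lambda).
  assert (HS : forall z, disk z -> f z = G z * S z) by exact hfG.
  assert (D0 : disk 0) by (unfold disk; rewrite Cmod_0; lra).
  destruct (harmonic_hol G hG_harm) as (CG & CDz & CDzb & _ & _).
  assert (CDG := C1_Dop G CDz CDzb).
  assert (HD : forall z, disk z -> Dop f z = Dop G z * S z).
  { intros z Hz. apply Dop_radial_mult; auto. now apply CG. }
  assert (HD2 : forall z, disk z -> Dop (Dop f) z = Dop (Dop G) z * S z).
  { intros z Hz. apply Dop_radial_mult; auto. now apply CDG. }
  assert (Quot : forall a b s : C, b * s <> 0 -> a * s / (b * s) = a / b).
  { intros a b s H. field. split; intros E; apply H; rewrite E; ring. }
  assert (Ha : forall z, disk z ->
     (f z <> 0 -> Dop f z / f z = Dop G z / G z) /\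
     (Dop f z <> 0 -> Dop (Dop f) z / Dop f z = Dop (Dop G) z / Dop G z)).
  { intros z Hz. rewrite HD2, HD, HS by exact Hz. split; intros H; now apply Quot. }
  split; [exact Ha|].
  assert (C1f : C1_disk f) by (apply (C1_radial_mult p lambda f G); auto).
  assert (Cf : forall z, disk z -> cont f z) by (intros z Hz; eapply rdiff_cont; now apply C1f).
  assert (CGc : forall z, disk z -> cont G z) by (intros z Hz; eapply rdiff_cont; now apply CG).
  assert (C1Df : C1_disk (Dop f)) by (apply (C1_radial_mult p lambda (Dop f) (Dop G)); auto).
  split; [split|].
  - intros (_ & _ & Jf & f0 & Hnz & Hre).
    assert (J0 : (0 < Cmod (S 0) ^ 2 * jacobian G 0)%R).
    { assert (J := Jf 0 D0). destruct (rdiff_radial p lambda) as [s Hs]. destruct (Hs 0) as [Rs _].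
      assert (RD := rdiff_mult _ _ _ _ _ _ _ (proj1 (CG 0 D0)) Rs).
      assert (RD' := rdiff_ext_disk _ f _ _ _ D0 (fun w Hw => eq_sym (HS w Hw)) RD).
      destruct (rdiff_d _ _ _ _ RD') as [E1 E2]. unfold jacobian in *. rewrite E1, E2 in J.
      (* The derivatives of the radial factor carry the factors conj(0) and 0, so at the origin both
         Wirtinger derivatives of [f] are those of [G] times [S 0]. *)
      replace (d_z G 0 * radial p lambda 0 + G 0 * (s 0 * Cconj 0)) with (S 0 * d_z G 0) in J
        by (replace (Cconj 0) with (RtoC 0) by (apply Ceq_Re_Im; simpl; ring); unfold S; ring).
      replace (d_zbar G 0 * radial p lambda 0 + G 0 * (s 0 * 0)) with (S 0 * d_zbar G 0) in J by (unfold S; ring).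
      rewrite !Cmod_mult in J. replace (Cmod (S 0) ^ 2 * (Cmod (d_z G 0) ^ 2 - Cmod (d_zbar G 0) ^ 2))%R with
        ((Cmod (S 0) * Cmod (d_z G 0)) ^ 2 - (Cmod (S 0) * Cmod (d_zbar G 0)) ^ 2)%R by ring. exact J. }
    assert (HS0 : S 0 <> 0).
    { intros E. rewrite E, Cmod_0 in J0. lra. }
    assert (HSp : (0 < Cmod (S 0) ^ 2)%R) by (apply pow_lt; now apply Cmod_gt_0).
    split; [now apply class_C_1|]. split; [now apply class_C_1|]. split; [|split; [|split]].
    + destruct (jacobian_sign G hG_harm hG_loc) as [J|J]; [exact J|]. exfalso. specialize (J 0 D0). nra.
    + assert (E := HS 0 D0). rewrite f0 in E. apply NNPP. intros HG0. apply (Cmult_neq_0 _ _ HG0 HS0). now symmetry.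
    + intros z Hz Hz0 E. apply (Hnz z Hz Hz0). rewrite HS, HD by exact Hz.
      replace (G z * S z * (Dop G z * S z)) with (G z * Dop G z * (S z * S z)) by ring. rewrite E. ring.
    + intros z Hz Hz0. rewrite <- (proj2 (Ha z Hz)); [now apply Hre|].
      intros E. apply (Hnz z Hz Hz0). rewrite E. ring.
  - intros Jf (_ & _ & _ & G0 & Hnz & Hre).
    assert (f0 : f 0 = 0) by (rewrite HS, G0 by exact D0; ring).
    (* Injectivity and f 0 = 0 exclude zeros of [f] off the origin, hence zeros of [S] there, so
       [Dop f] inherits nonvanishing from [Dop G]. *)
    assert (HDf : forall z, disk z -> z <> 0 -> f z <> 0 /\ Dop f z <> 0).
    { intros z Hz Hz0. assert (Hf : f z <> 0) by (rewrite <- f0; intros E; now apply Hz0, hf_univ).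
      split; [exact Hf|]. rewrite HD by exact Hz. apply Cmult_neq_0.
      - intros E. apply (Hnz z Hz Hz0). rewrite E. ring.
      - intros E. apply Hf. rewrite HS, E by exact Hz. ring. }
    split; [now apply class_C_1|]. split; [now apply class_C_1|]. split; [exact Jf|]. split; [exact f0|]. split.
    + intros z Hz Hz0. destruct (HDf z Hz Hz0). now apply Cmult_neq_0.
    + intros z Hz Hz0. rewrite (proj2 (Ha z Hz)) by now apply HDf. now apply Hre.
  - (* [g = S(1) G], so that [f / g] tends to 1 at the unit circle *)
    set (g := fun z => S 1 * G z). set (s := fun z => S z / S 1).
    assert (Cg : forall z, disk z -> cont g z) by (intros z Hz; apply cont_mult; [apply cont_const|now apply CGc]).
    assert (Prep : f 0 = 0 -> S 1 <> 0 /\ (forall z, disk z -> f z = g z * s z) /\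
       (forall eps : R, (0 < eps)%R -> exists rho : R, (0 < rho < 1)%R /\
          forall z, disk z -> (rho <= Cmod z)%R -> (Cmod (s z - 1) < eps)%R)).
    { intros f0. assert (HS1 : S 1 <> 0) by (apply (radial_boundary_neq_0 p lambda f G); auto).
      assert (HS1' := proj1 (Cmod_gt_0 _) HS1).
      split; [exact HS1|]. split.
      - intros z Hz. rewrite HS by exact Hz. unfold g, s. field. exact HS1.
      - intros eps Heps. destruct (radial_boundary p lambda (eps * Cmod (S 1))) as (rho & Hrho & H).
        { now apply Rmult_lt_0_compat. }
        exists rho. split; [exact Hrho|]. intros z Hz Hle. specialize (H z Hz Hle). fold S in H.
        unfold s. replace (S z / S 1 - 1) with ((S z - S 1) / S 1) by (field; exact HS1).
        rewrite Cmod_div by exact HS1. apply Rlt_div_l; [exact HS1'|exact H]. }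
    assert (Img : S 1 <> 0 -> forall w, image_disk g (S 1 * w) <-> image_disk G w).
    { intros HS1 w. unfold g. split; intros (z & Hz & E); exists z; (split; [exact Hz|]).
      - transitivity (/ S 1 * (S 1 * G z)); [field; exact HS1|]. rewrite E. field. exact HS1.
      - now rewrite E. }
    split.
    + intros (_ & f0 & _ & Star). destruct (Prep f0) as (HS1 & Hfg & Hs).
      assert (G0 : G 0 = 0) by (apply (radial_origin p lambda f G); auto).
      assert (Lg : locally_injective g).
      { apply locally_univalent_injective. intros z0 Hz0. destruct (hG_loc z0 Hz0) as (r & Hr & H). exists r. split; [exact Hr|].
        intros z w Hz Hw H1 H2 E. apply H; auto. transitivity (/ S 1 * g z); [unfold g; field; exact HS1|]. rewrite E. unfold g. field. exact HS1. }
      assert (g0 : g 0 = 0) by (unfold g; rewrite G0; ring).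
      assert (gz : forall z, disk z -> g z = 0 -> z = 0).
      { intros z Hz E. apply hf_univ; [exact Hz|exact D0|]. rewrite Hfg, E, f0 by exact Hz. ring. }
      assert (Ig : univalent g) by (eapply ratio_univalent; eassumption).
      split; [now apply class_C_1|]. split; [exact G0|]. split.
      * intros z w Hz Hw E. apply Ig; auto. unfold g. now rewrite E.
      * apply (starlike_domain_scale (S 1) _ (image_disk f) HS1); [|exact Star].
        intros w. rewrite (same_image f g s Hfg Hs Cf Cg hf_univ (S 1 * w) Ig) by congruence. symmetry. now apply Img.
    + intros (_ & G0 & IG & Star).
      assert (f0 : f 0 = 0) by (rewrite HS, G0 by exact D0; ring).
      destruct (Prep f0) as (HS1 & Hfg & Hs).
      assert (Ig : univalent g).
      { intros z w Hz Hw E. apply IG; auto. transitivity (/ S 1 * g z); [unfold g; field; exact HS1|]. rewrite E. unfold g. field. exact HS1. }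
      assert (g0 : g 0 = 0) by (unfold g; rewrite G0; ring).
      split; [now apply class_C_1|]. split; [exact f0|]. split; [exact hf_univ|].
      apply (starlike_domain_scale (/ S 1) _ (image_disk G)).
      * apply Cmod_gt_0. rewrite Cmod_inv by exact HS1. apply Rinv_0_lt_compat. now apply Cmod_gt_0.
      * intros w. rewrite (same_image f g s Hfg Hs Cf Cg hf_univ w Ig) by congruence.
        rewrite <- (Img HS1). replace (S 1 * (/ S 1 * w)) with w by (field; exact HS1). reflexivity.
      * exact Star.
Qed.
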